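(* For all $u\otimes e^{\alpha}\in M_\alpha$ and $v\otimes e^{\beta}\in M_\beta$ (with $u,v\in M^l$, $\alpha,\beta\in\mathbb{C}^l$), the vertex operators $\mathcal{Y}(u\otimes e^{\alpha},z)=e^{\alpha}Y_-(\alpha,z)Y(u,z)Y_+(\alpha,z)z^{\alpha(0)}$ on $\mathcal{M}=\bigoplus_{\gamma\in\mathbb{C}^l}M_\gamma$ satisfy the generalized Jacobi identity $$z_0^{-1}\left(\frac{z_1-z_2}{z_0}\right)^{-\alpha\cdot\beta}\delta\left(\frac{z_1-z_2}{z_0}\right)\mathcal{Y}(u\otimes e^{\alpha},z_1)\,\mathcal{Y}(v\otimes e^{\beta},z_2)$$ $$-\,C(\alpha,\beta)\,z_0^{-1}\left(\frac{z_2-z_1}{z_0}\right)^{-\alpha\cdot\beta}\delta\left(\frac{z_2-z_1}{-z_0}\right)\mathcal{Y}(v\otimes e^{\beta},z_2)\,\mathcal{Y}(u\otimes e^{\alpha},z_1)$$ $$=z_2^{-1}\,\delta\left(\frac{z_1-z_0}{z_2}\right)\mathcal{Y}\big(\mathcal{Y}(u\otimes e^{\alpha},z_0)(v\otimes e^{\beta}),z_2\big)\left(\frac{z_1-z_0}{z_2}\right)^{\alpha(0)}.$$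
   Context: Fix $l\ge 1$. For $\alpha,\beta\in\mathbb{C}^l$ write $\alpha\cdot\beta=\sum_{i=1}^l\alpha^i\beta^i$ (complex bilinear). $M^l$ is the rank $l$ Heisenberg vertex operator algebra, generated by weight one vectors $a^1,\dots,a^l$ whose modes satisfy $[a^i(n),a^j(m)]=n\,\delta_{n,-m}\delta_{i,j}$; it is spanned by the vectors $a^{i_1}(-k_1)\cdots a^{i_r}(-k_r)\mathbf{1}$, $k_j>0$, with Virasoro vector $\omega=\frac12\sum_i a^i(-1)^2\mathbf{1}$. For $\alpha\in\mathbb{C}^l$, $M_\alpha=M^l\otimes e^\alpha$ is the irreducible $M^l$-module with $a^i(0)(u\otimes e^\alpha)=\alpha^i(u\otimes e^\alpha)$ and $a^i(n)(u\otimes e^\alpha)=(a^i(n)u)\otimes e^\alpha$ for $n\ne 0$; $M_0=M^l$ and $u\otimes e^0$ is written $u$. For $u\in M^l$, $Y(u,z)=\sum_n u(n)z^{-n-1}$ denotes the (module) vertex operator on every $M_\alpha$. Put $\alpha(n)=\sum_i\alpha^i a^i(n)$ and $$Y_\pm(\alpha,z)=\exp\Big(\mp\sum_{n>0}\frac{\alpha(\pm n)}{n}z^{\mp n}\Big).$$ $\mathcal{M}=\bigoplus_{\beta\in\mathbb{C}^l}M_\beta$. The operator $e^{\alpha\cdot q}$ is $u\otimes e^\beta\mapsto u\otimes e^{\alpha+\beta}$. Cocycle structure: fix $\epsilon:\mathbb{C}^l\times\mathbb{C}^l\to\mathbb{C}^\times$ with $\epsilon(\alpha,0)=\epsilon(0,\alpha)=1$.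 Let $c_\alpha(u\otimes e^\beta)=\epsilon(\alpha,\beta)\,u\otimes e^\beta$ and define the operator $e^\alpha=e^{\alpha\cdot q}c_\alpha$ on $\mathcal{M}$. It is assumed that $e^\alpha e^\beta=\epsilon(\alpha,\beta)e^{\alpha+\beta}$ and $e^0=1$ (i.e. $\epsilon$ is a 2-cocycle). The commutator function is $C(\alpha,\beta)=\epsilon(\alpha,\beta)/\epsilon(\beta,\alpha)$, so $e^\alpha e^\beta=C(\alpha,\beta)e^\beta e^\alpha$. $\mathcal{Y}(\cdot,z)$ takes values in formal series in complex powers of $z$ with coefficients in $\mathrm{Lin}(\mathcal{M},\mathcal{M})$, where $z^{\alpha(0)}$ acts on $M_\gamma$ as $z^{\alpha\cdot\gamma}$; it is extended linearly in its first argument, and similarly $\left(\frac{z_1-z_0}{z_2}\right)^{\alpha(0)}$ acts on $M_\gamma$ as $\left(\frac{z_1-z_0}{z_2}\right)^{\alpha\cdot\gamma}$. Formal conventions: $\delta(x/y)=\sum_{n\in\mathbb{Z}}x^ny^{-n}$, $(x+y)^\kappa=\sum_{m\ge0}\binom{\kappa}{m}x^{\kappa-m}y^m$ for $\kappa\in\mathbb{C}$ (expansion in nonnegative powers of the second variable), and $\left(\frac{x+y}{z}\right)^\kappa=(x+y)^\kappa z^{-\kappa}$. *)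

(* Defs.v *)
From HB Require Import structures.
From mathcomp Require Import all_boot all_order all_algebra finmap.
From mathcomp Require Import classical_sets functions cardinality fsbigop reals.
From mathcomp Require Import complex.
From mathcomp.multinomials Require Import monalg.

Set Implicit Arguments.
Unset Strict Implicit.
Unset Printing Implicit Defensive.
Import GRing.Theory Num.Theory.
Local Open Scope classical_set_scope.
Local Open Scope ring_scope.

(* A formal series with coefficients in [T] and exponents in the additive group
   [X] is its coefficient function [X -> T].  One-variable series in complex
   powers of [z] have [X = K], and series in [z0, z1, z2] have [X = 'rV[K]_3].

   [\sum_(i \in A) F i] is the sum of a finitely supported family (and [0] if the
   support is infinite).  Operator-valued series are multiplied pointwise on
   vectors, as usual in formal calculus: in all the products formed below, only
   finitely many terms contribute to a given coefficient applied to a given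
   vector, although the family of operators itself may have infinite support. *)

Section Series.
Variables (K : fieldType) (X : zmodType).

Definition cauchy (S T : Type) (V : zmodType) (op : S -> T -> V)
    (f : X -> S) (g : X -> T) : X -> V :=
  fun e => \sum_(d \in [set: X]) op (f (e - d)) (g d).

Definition monomial (d : X) : X -> K := fun e => (e == d)%:R.

Definition smul (f g : X -> K) : X -> K := cauchy *%R f g.

Variable V : lmodType K.

Definition sact (f : X -> K) (A : X -> V -> V) : X -> V -> V :=
  fun e w => cauchy *:%R f (A^~ w) e.

Definition scomp (A B : X -> V -> V) : X -> V -> V :=
  fun e w => cauchy (fun T x => T x) A (B^~ w) e.

Definition sconst (T : V -> V) : X -> V -> V :=
  fun e w => if e == 0 then T w else 0.

(* [\sum_(i in P) T i * z ^ (d i)] *)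
Definition series (I : choiceType) (P : set I) (d : I -> X) (T : I -> V -> V) :
    X -> V -> V :=
  fun e w => \sum_(i \in [set i | P i /\ d i = e]) T i w.

Definition sexp (A : X -> V -> V) : X -> V -> V :=
  fun e w => \sum_(k \in [set: nat])
    (k`!%:R)^-1 *: iter k (scomp A) (sconst id) e w.

Lemma sexp_0 (A : X -> V -> V) :
  (forall e, A e 0 = 0) -> forall e, sexp A e 0 = 0.
Proof.
move=> A0 e; rewrite /sexp fsbig1 // => k _.
suff -> : iter k (scomp A) (sconst id) e 0 = 0 by rewrite scaler0.
elim: k e => [|k IH] e /=; first by rewrite /sconst if_same.
by rewrite /scomp /cauchy fsbig1 // => d _; rewrite IH A0.
Qed.

End Series.

Definition gbinom (K : fieldType) (x : K) (m : nat) : K :=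
  (\prod_(i < m) (x - i%:R)) / m`!%:R.

(* The direct sum of copies of [V] indexed by [I]: finitely supported families.
   For [V = K] this is the [K]-module [{malg K[I]}]; for other [V] the type
   [{malg V[I]}] carries no [K]-module structure in the library. *)
Definition dsum (K : pzRingType) (V : lmodType K) (I : choiceType) := {malg V[I]}.

Section DirectSum.
Variables (K : pzRingType) (V : lmodType K) (I : choiceType).
Implicit Types (c : K) (w : dsum V I).

HB.instance Definition _ := GRing.Zmodule.on (dsum V I).

Definition dsum_scale c w : dsum V I := \sum_(i <- msupp w) << c *: w@_i *g i >>.

Fact dsum_scaleE c w i : (dsum_scale c w)@_i = c *: w@_i.
Proof.
rewrite /dsum_scale raddf_sum /=; under eq_bigr do rewrite mcoeffU.
case: msuppP => iw; last first.
  rewrite scaler0 big1_seq // => j /andP[_ jw]; case: eqVneq => // ji.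
  by rewrite -ji jw in iw.
rewrite (big_fsetD1 i) //= eqxx big1_seq ?addr0 // => j /andP[_].
by rewrite in_fsetD1 => /andP[/negPf ->].
Qed.

Fact dsum_scaleA c1 c2 w : dsum_scale c1 (dsum_scale c2 w) = dsum_scale (c1 * c2) w.
Proof. by apply/malgP => i; rewrite !dsum_scaleE scalerA. Qed.

Fact dsum_scale1 : left_id 1 dsum_scale.
Proof. by move=> w; apply/malgP => i; rewrite dsum_scaleE scale1r. Qed.

Fact dsum_scaleDr : right_distributive dsum_scale +%R.
Proof.
move=> c w1 w2; apply/malgP => i.
by rewrite mcoeffD !dsum_scaleE mcoeffD scalerDr.
Qed.

Fact dsum_scaleDl w : {morph dsum_scale^~ w : c1 c2 / c1 + c2}.
Proof.
by move=> c1 c2; apply/malgP => i; rewrite mcoeffD !dsum_scaleE scalerDl.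
Qed.

HB.instance Definition _ := GRing.Zmodule_isLmodule.Build K (dsum V I)
  dsum_scaleA dsum_scale1 dsum_scaleDr dsum_scaleDl.

End DirectSum.

(* The variable [(i, k)] stands for [a^i(-(k+1)) 1]. *)
Definition oscillator (l : nat) : choiceType := ('I_l * nat)%type.

(* The polynomial model of [M^l], in which [1] is the vacuum *)
Definition fock (K : fieldType) (l : nat) : comAlgType K :=
  {malg K[{cmonom (oscillator l)}]}.

(* The direct sum of the [M_beta], [beta] in [K^l] *)
Definition heis_sum (K : fieldType) (l : nat) : lmodType K :=
  dsum (fock K l) 'rV[K]_l.

Section Heisenberg.
Variables (K : fieldType) (l : nat).
Local Notation M := (fock K l).
Local Notation MM := (heis_sum K l).

Definition dotp (al be : 'rV[K]_l) : K := \sum_i al 0 i * be 0 i.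

(* [u (x) e^al] *)
Definition tens (u : M) (al : 'rV[K]_l) : MM := << u *g al >>.

(* The operator on the direct sum given by [f ga] on the summand [M_ga]. *)
Definition blockwise (f : 'rV[K]_l -> M -> M) (w : MM) : MM :=
  \sum_(ga <- msupp w) tens (f ga w@_ga) ga.

Lemma blockwise_tens f u ga :
  f ga 0 = 0 -> blockwise f (tens u ga) = tens (f ga u) ga.
Proof.
move=> f0; rewrite /blockwise /tens msuppU; case: eqP => [->|_].
  by rewrite big_seq_fset0 f0 monalgU0.
by rewrite big_seq_fset1 mcoeffUU.
Qed.

Definition fock_deriv (x : oscillator l) (u : M) : M :=
  \sum_(m <- msupp u) (u@_m * (m x)%:R) *: << divcm m (ucm x) >>.

(* The mode [a^i(n)] on [M^l]; [Negz k] is [-(k+1)]. *)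
Definition fock_mode (i : 'I_l) (n : int) (u : M) : M :=
  match n with
  | Posz 0 => 0
  | Posz k.+1 => k.+1%:R *: fock_deriv (i, k) u
  | Negz k => << ucm (i, k) >> * u
  end.

Definition amode (i : 'I_l) (n : int) : MM -> MM :=
  blockwise (fun ga u => if n == 0 then ga 0 i *: u else fock_mode i n u).

Lemma fock_mode0 i n : fock_mode i n 0 = 0.
Proof.
case: n => [[|k]|k] //=; last by rewrite mulr0.
by rewrite /fock_deriv msupp0 big_seq_fset0 scaler0.
Qed.

Lemma amode_tens0 i u ga : amode i 0 (tens u ga) = ga 0 i *: tens u ga.
Proof.
rewrite /amode blockwise_tens /= ?scaler0 //; apply/malgP => be.
by rewrite dsum_scaleE !mcoeffU scalerMnr.
Qed.

Lemma amode_tens i n u ga :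
  n != 0 -> amode i n (tens u ga) = tens (fock_mode i n u) ga.
Proof.
by move=> n0; rewrite /amode blockwise_tens ?fock_mode0 ?scaler0 ?if_same // (negPf n0).
Qed.

(* [al(n) = \sum_i al^i a^i(n)] *)
Definition lin_mode (al : 'rV[K]_l) (n : int) (w : MM) : MM :=
  \sum_i al 0 i *: amode i n w.

(* For [x = (i, k)] and [B(z) = \sum_p B(p) z^(-p-1)], the modes of the normally ordered product
   [: (1/k!) (d/dz)^k a^i(z) B(z) :], where [a^i(z) = \sum_j a^i(j) z^(-j-1)]. *)
Definition normal_mul (x : oscillator l) (B : int -> MM -> MM) : int -> MM -> MM :=
  fun n w => \sum_(j \in [set: int]) gbinom (- j - 1)%:~R x.2 *:
    (let p := n - j - x.2.+1%:Z in
     if j < 0 then amode x.1 j (B p w) else B p (amode x.1 j w)).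

(* The vacuum has [B(z) = 1]. *)
Definition vacuum_modes (n : int) (w : MM) : MM := if n == -1 then w else 0.

(* [Y(a^{i_1}(-k_1) ... a^{i_r}(-k_r) 1, z)] is the normally ordered product of the
   fields [(1/(k_j-1)!) (d/dz)^(k_j-1) a^{i_j}(z)]; modes [a^i(j)] of the same sign
   commute, so that the order of the factors is irrelevant. *)
Definition monomial_modes (m : {cmonom (oscillator l)}) : int -> MM -> MM :=
  foldr (fun x B => iter (m x) (normal_mul x) B) vacuum_modes (finsupp m).

(* [u(n)] *)
Definition vmode (u : M) (n : int) (w : MM) : MM :=
  \sum_(m <- msupp u) u@_m *: monomial_modes m n w.

(* [Y(u, z) = \sum_n u(n) z^(-n-1)] on every [M_ga] *)
Definition Yfield (u : M) : K -> MM -> MM :=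
  series [set: int] (fun n => (- n - 1)%:~R) (vmode u).

Definition Yplus (al : 'rV[K]_l) : K -> MM -> MM :=
  sexp (series [set n | (0 < n)%N] (fun n : nat => - n%:R)
    (fun n w => - (n%:R^-1 *: lin_mode al n%:Z w))).

Definition Yminus (al : 'rV[K]_l) : K -> MM -> MM :=
  sexp (series [set n | (0 < n)%N] (fun n : nat => n%:R)
    (fun n w => n%:R^-1 *: lin_mode al (- n%:Z) w)).

(* [z^{al(0)}] *)
Definition zpow0 (al : 'rV[K]_l) : K -> MM -> MM :=
  fun e => blockwise (fun ga u => monomial K (dotp al ga) e *: u).

(* The operator [e^al = e^{al.q} c_al]. *)
Definition eop (eps : 'rV[K]_l -> 'rV[K]_l -> K) (al : 'rV[K]_l) (w : MM) : MM :=
  \sum_(ga <- msupp w) eps al ga *: tens w@_ga (al + ga).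

Record is_cocycle (eps : 'rV[K]_l -> 'rV[K]_l -> K) : Prop := IsCocycle {
  cocycle_neq0 : forall al be, eps al be != 0;
  cocycle_r0 : forall al, eps al 0 = 1;
  cocycle_0l : forall al, eps 0 al = 1;
  cocycle_eop : forall al be w,
    eop eps al (eop eps be w) = eps al be *: eop eps (al + be) w;
  cocycle_eop0 : forall w, eop eps 0 w = w
}.

Definition commutator (eps : 'rV[K]_l -> 'rV[K]_l -> K) (al be : 'rV[K]_l) : K :=
  eps al be / eps be al.

(* [e^al Y_-(al, z) Y(u, z) Y_+(al, z) z^{al(0)}] *)
Definition vertex_tens (eps : 'rV[K]_l -> 'rV[K]_l -> K) (u : M) (al : 'rV[K]_l) :
    K -> MM -> MM :=
  scomp (sconst (eop eps al))
    (scomp (Yminus al) (scomp (Yfield u) (scomp (Yplus al) (zpow0 al)))).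

Definition vertex (eps : 'rV[K]_l -> 'rV[K]_l -> K) (U : MM) : K -> MM -> MM :=
  fun e w => \sum_(al <- msupp U) vertex_tens eps U@_al al e w.

Lemma Yfield0 e w : Yfield 0 e w = 0.
Proof. by rewrite /Yfield /series fsbig1 // => n _; rewrite /vmode msupp0 big_seq_fset0. Qed.

Lemma lin_mode_0 al n : lin_mode al n 0 = 0.
Proof.
rewrite /lin_mode big1 // => i _.
by rewrite /amode /blockwise msupp0 big_seq_fset0 scaler0.
Qed.

Lemma Yminus_0 al e : Yminus al e 0 = 0.
Proof.
apply: sexp_0 => x; rewrite /series fsbig1 // => n _.
by rewrite lin_mode_0 scaler0.
Qed.

Lemma vertex_tensE eps u al e w :
  vertex eps (tens u al) e w = vertex_tens eps u al e w.
Proof.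
rewrite /vertex /tens msuppU; case: eqP => [->|_]; last first.
  by rewrite big_seq_fset1 mcoeffUU.
have Y0 x v : scomp (Yfield 0) (scomp (Yplus al) (zpow0 al)) x v = 0.
  by rewrite /scomp /cauchy fsbig1 // => d _; rewrite Yfield0.
have Ym0 x v : scomp (Yminus al)
    (scomp (Yfield 0) (scomp (Yplus al) (zpow0 al))) x v = 0.
  by rewrite {1}/scomp /cauchy fsbig1 // => d _; rewrite Y0 Yminus_0.
rewrite big_seq_fset0 /vertex_tens {1}/scomp /cauchy fsbig1 // => d _.
by rewrite Ym0 /sconst /eop msupp0 big_seq_fset0 if_same.
Qed.

End Heisenberg.

Definition z0 : 'I_3 := @Ordinal 3 0 isT.
Definition z1 : 'I_3 := @Ordinal 3 1 isT.
Definition z2 : 'I_3 := @Ordinal 3 2 isT.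

Section ThreeVariables.
Variable K : fieldType.

(* The exponent of [z_i^x] *)
Definition zexp (i : 'I_3) (x : K) : 'rV[K]_3 := x *: delta_mx 0 i.

Definition zmono (i : 'I_3) (x : K) : 'rV[K]_3 -> K := monomial K (zexp i x).

(* [(z_i - z_j)^x], expanded in nonnegative powers of [z_j] *)
Definition diff_pow (i j : 'I_3) (x : K) : 'rV[K]_3 -> K :=
  fun e => \sum_(m \in [set: nat]) gbinom x m * (-1) ^+ m *
    monomial K (zexp i (x - m%:R) + zexp j m%:R) e.

(* [((z_i - z_j) / z_k)^x] *)
Definition quot_pow (i j k : 'I_3) (x : K) : 'rV[K]_3 -> K :=
  smul (diff_pow i j x) (zmono k (- x)).

(* [delta ((z_i - z_j) / (s z_k))], for a sign [s] *)
Definition delta_quot (s : K) (i j k : 'I_3) : 'rV[K]_3 -> K :=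
  fun e => \sum_(n \in [set: int]) s ^ (- n) * quot_pow i j k n%:~R e.

(* The one-variable series [A(z)] at [z = z_i] *)
Definition at_var (V : lmodType K) (i : 'I_3) (A : K -> V -> V) :
    'rV[K]_3 -> V -> V :=
  fun e w => if e == zexp i (e 0 i) then A (e 0 i) w else 0.

Variable l : nat.
Variable eps : 'rV[K]_l -> 'rV[K]_l -> K.

(* [Y(Y(U, z0) V, z2)] *)
Definition vertex_iterate (U V : heis_sum K l) :
    'rV[K]_3 -> heis_sum K l -> heis_sum K l :=
  fun e w => if e == zexp z0 (e 0 z0) + zexp z2 (e 0 z2)
    then vertex eps (vertex eps U (e 0 z0) V) (e 0 z2) w else 0.

(* [((z_i - z_j) / z_k)^{al(0)}] *)
Definition quot_pow0 (i j k : 'I_3) (al : 'rV[K]_l) :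
    'rV[K]_3 -> heis_sum K l -> heis_sum K l :=
  fun e => blockwise (fun ga u => quot_pow i j k (dotp al ga) e *: u).

End ThreeVariables.

(* Main.v *)
Require Import Defs.
From HB Require Import structures.
From mathcomp Require Import all_boot all_order all_algebra finmap.
From mathcomp Require Import boolp classical_sets cardinality fsbigop reals.
From mathcomp Require Import complex ring zify.
From mathcomp.multinomials Require Import monalg.

Set Implicit Arguments.
Unset Strict Implicit.
Unset Printing Implicit Defensive.
Import GRing.Theory Num.Theory.
Local Open Scope classical_set_scope.
Local Open Scope ring_scope.


(** Comparing coefficients of the monomials in [z0], [z1], [z2] turns the Jacobi
    identity into a family of identities between finite sums. Write [U] and [V]
    for the vectors over [al] and [be], let [w] lie over [ga], and put
    [N = n - al.be] with [n] an integer. The coefficient of [z0^(-1-N) z1^e1 z2^e2]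
    in the first term is [product N e1 e2 U V w], the coefficient of [z1^e1 z2^e2]
    in [(z1 - z2)^N Y(U, z1) Y(V, z2) w]; in the second term it is
    [(-1)^n product N e2 e1 V U w], and in the third one [iterate N e1 e2 U V w].
    All other exponents of [z0] or [z1] contribute zero on both sides, since
    [Y(U, z1)] has exponents in [al.ga + Z] only. So the claim is the Borcherds
    identity
      [product N e1 e2 U V w =
         C(al, be) (-1)^n product N e2 e1 V U w + iterate N e1 e2 U V w].

    This identity is reduced to [e^al], [e^be], [e^ga] by the creation operators.
    The field of [a^i(-k-1) U] is the normally ordered product of the field of [U]
    with a derivative of [a^i(z)] ([vertex_normal]); this holds because [Y_-]
    commutes with creation and [Y_+] with annihilation operators
    ([dressed_normal]). It implies the commutator formula of [a^i(n)] with all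
    fields ([vertex_comm]). From these two facts, replacing [U] by [a^i(-k-1) U]
    changes each of the three terms by the same normally ordered product and by
    contractions of [a^i] with [V], with coefficients that match
    ([product_left], [product_right], [iterate_left], and similarly for [V]).
    Hence the identity for [(U, V)] and [(U, a^i(r) V)], [r >= 0], implies the one
    for [(a^i(-k-1) U, V)] ([borcherds_left], [borcherds_right]).

    For [U = e^al] and [V = e^be] let [J] be the difference of the two sides. All
    three terms satisfy [[a^i(n), J] = (al^i z1^n + be^i z2^n) J] ([mode_defect]).
    With [n < 0] this allows to take [w = e^ga]. With [n > 0] it says that the
    coefficients of [J e^ga], which are polynomials in the oscillators, span a
    space closed under all partial derivatives; such polynomials vanish as soon as
    their constant terms do ([vacuum_coef_detect]).

    The constant terms are scalars. Moving [Y_+(al, z1)] to the right of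
    [Y_-(be, z2)] produces [(1 - z2/z1)^(al.be)] ([plus_minus_ket]), which cancels
    the non-integral part of [(z1 - z2)^N]. What is left is the relation between
    the expansions of [(z1 - z2)^n] in the two directions and around [z1 = z2]
    ([jacobi_constant]), and the cocycle identity for the scalar factors.

    The argument works over every field of characteristic zero. *)

(** * Sums of finitely supported families *)

Section FiniteSums.
Variable V : zmodType.

Lemma fsum_inj (I X : choiceType) (g : I -> X) (F : X -> V) :
  injective g -> (forall x, F x != 0 -> exists i, x = g i) ->
  \sum_(x \in [set: X]) F x = \sum_(i \in [set: I]) F (g i).
Proof.
move=> ginj Fg; rewrite -(@fsbig_image _ 0 _ _ _ [set: I] g F); last by move=> i j _ _; apply: ginj.
apply/esym/fsbig_widen => // x [_ /= xg]; apply/eqP; apply: contra_notT xg.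
by move=> /Fg[i ->]; exists i.
Qed.

Lemma fsum1 (X : choiceType) (x0 : X) (F : X -> V) :
  (forall x, x != x0 -> F x = 0) -> \sum_(x \in [set: X]) F x = F x0.
Proof.
move=> F0; transitivity (\sum_(x \in [set x0]) F x); last by rewrite fsbig_set1.
apply/esym/fsbig_widen => // x [_ /= xx0].
by apply: F0; apply/eqP.
Qed.

Lemma fsum_subset (X : choiceType) (r : seq X) (F : X -> V) :
  uniq r -> (forall x, x \notin r -> F x = 0) ->
  \sum_(x \in [set: X]) F x = \sum_(x <- r) F x.
Proof.
move=> ur F0; rewrite (fsbigE r) // => [|x _]; last exact: F0.
by apply: eq_bigl => x; rewrite in_setT.
Qed.

(** Eventually zero. As [\sum_(m \in _)] is [0] on families of infinite support,
    linearity of [nsum] holds only under this condition. *)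
Definition evz (f : nat -> V) := exists B, forall m, (B <= m)%N -> f m = 0.

Definition nsum (f : nat -> V) : V := \sum_(m \in [set: nat]) f m.

Lemma nsumE B f : (forall m, (B <= m)%N -> f m = 0) -> nsum f = \sum_(m < B) f m.
Proof.
move=> f0; rewrite /nsum (fsum_subset (r := iota 0 B)) ?iota_uniq //.
  by rewrite -(big_mkord xpredT) /index_iota subn0.
by move=> m; rewrite mem_iota add0n /= -leqNgt; apply: f0.
Qed.

Lemma eq_nsum f g : f =1 g -> nsum f = nsum g.
Proof. by move=> fg; apply: eq_fsbigr => m _; apply: fg. Qed.

Lemma nsum0 f : (forall m, f m = 0) -> nsum f = 0.
Proof. by move=> f0; apply: fsbig1 => m _; apply: f0. Qed.

Lemma nsum1 m0 f : (forall m, m != m0 -> f m = 0) -> nsum f = f m0.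
Proof. exact: fsum1. Qed.

Lemma evzD f g : evz f -> evz g -> evz (fun m => f m + g m).
Proof.
move=> [B f0] [C g0]; exists (maxn B C) => m; rewrite geq_max => /andP[Bm Cm].
by rewrite f0 // g0 // addr0.
Qed.

Lemma evzN f : evz f -> evz (fun m => - f m).
Proof. by move=> [B f0]; exists B => m Bm; rewrite f0 // oppr0. Qed.

Lemma nsumD f g : evz f -> evz g -> nsum (fun m => f m + g m) = nsum f + nsum g.
Proof.
move=> [B f0] [C g0].
rewrite !(@nsumE (maxn B C)) ?big_split // => m; rewrite geq_max => /andP[Bm Cm].
- exact: g0.
- exact: f0.
- by rewrite f0 // g0 // addr0.
Qed.

Lemma nsumN f : nsum (fun m => - f m) = - nsum f.
Proof.
rewrite /nsum; case: (pselect (finite_set ([set: nat] `&` f @^-1` [set~ 0]))) => [fin|inf].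
  rewrite !(@fsum_subset _ (fset_set ([set: nat] `&` f @^-1` [set~ 0]))) ?sumrN //.
    move=> x; rewrite in_fset_set // notin_setE /= => h.
    by apply/eqP/negP => /negP/eqP h1; apply: h.
  move=> x; rewrite in_fset_set // notin_setE /= => h; apply/eqP; rewrite oppr_eq0.
  by apply/negP => /negP/eqP h1; apply: h.
rewrite !fsbig_dflt ?oppr0 //; apply: contra_not inf.
apply: sub_finite_set => x [_ /= fx]; split=> //= /eqP; rewrite oppr_eq0 => /eqP.
exact: fx.
Qed.

Lemma nsumB f g : evz f -> evz g -> nsum (fun m => f m - g m) = nsum f - nsum g.
Proof. by move=> ef eg; rewrite nsumD ?nsumN //; apply: evzN. Qed.

Lemma evz_sum (I : Type) (r : seq I) (P : pred I) (f : I -> nat -> V) :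
  (forall i, P i -> evz (f i)) -> evz (fun m => \sum_(i <- r | P i) f i m).
Proof.
move=> ef; elim: r => [|i r [B IH]].
  by exists 0%N => m _; rewrite big_nil.
case Pi: (P i); last by exists B => m Bm; rewrite big_cons Pi IH.
have [C fC] := ef i Pi; exists (maxn B C) => m; rewrite geq_max => /andP[Bm Cm].
by rewrite big_cons Pi IH // fC // addr0.
Qed.

Lemma nsum_sum (I : Type) (r : seq I) (P : pred I) (f : I -> nat -> V) :
  (forall i, P i -> evz (f i)) ->
  nsum (fun m => \sum_(i <- r | P i) f i m) = \sum_(i <- r | P i) nsum (f i).
Proof.
move=> ef; elim: r => [|i r IH].
  by rewrite big_nil nsum0 // => m; rewrite big_nil.
rewrite big_cons; case: ifPn => Pi; last first.
  by rewrite -IH; apply: eq_nsum => m; rewrite big_cons (negPf Pi).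
rewrite -IH -nsumD; [|exact: ef|exact: evz_sum].
by apply: eq_nsum => m; rewrite big_cons Pi.
Qed.

(** A family on [nat * nat] that vanishes for large first index, and in each
    row for large second index, has finite support. *)
Definition evz2 (f : nat -> nat -> V) :=
  (exists B, forall m j, (B <= m)%N -> f m j = 0) /\ (forall m, evz (f m)).

Lemma evz2_bound f : evz2 f ->
  exists B, forall m j, (B <= m)%N || (B <= j)%N -> f m j = 0.
Proof.
move=> [[B fB] fr].
have [C fC] : exists C, forall m j, (m < B)%N -> (C <= j)%N -> f m j = 0.
  elim: B {fB} => [|B [C IH]]; first by exists 0%N.
  have [D fD] := fr B; exists (maxn C D) => m j; rewrite geq_max ltnS leq_eqVlt.
  by move=> /orP[/eqP -> | mB] /andP[Cj Dj]; [apply: fD | apply: IH].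
exists (maxn B C) => m j; rewrite !geq_max => /orP[/andP[Bm _]|/andP[_ Cj]].
  exact: fB.
by have [Bm|mB] := leqP B m; [apply: fB | apply: fC].
Qed.

Lemma evz2_nsum f : evz2 f -> evz (fun m => nsum (f m)).
Proof. by move=> [[B fB] _]; exists B => m Bm; apply: nsum0 => j; apply: fB. Qed.

Lemma evz2_sym f : evz2 f -> evz2 (fun j m => f m j).
Proof.
move=> /evz2_bound[B fB]; split; first by exists B => j m Bj; rewrite fB ?Bj ?orbT.
by move=> j; exists B => m Bm; rewrite fB ?Bm.
Qed.

Lemma nsum_exchange f : evz2 f ->
  nsum (fun m => nsum (f m)) = nsum (fun j => nsum (fun m => f m j)).
Proof.
move=> /evz2_bound[B fB].
rewrite (@nsumE B) => [|m Bm]; last by apply: nsum0 => j; rewrite fB ?Bm.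
rewrite (@nsumE B) => [|j Bj]; last by apply: nsum0 => m; rewrite fB ?Bj ?orbT.
have rowE m : nsum (f m) = \sum_(j < B) f m j.
  by apply: nsumE => j Bj; rewrite fB ?Bj ?orbT.
have colE j : nsum (fun m => f m j) = \sum_(m < B) f m j.
  by apply: nsumE => m Bm; rewrite fB ?Bm.
under eq_bigr do rewrite rowE; under [in RHS]eq_bigr do rewrite colE.
by rewrite exchange_big.
Qed.

Lemma nsum_shift i f : (forall m, (m < i)%N -> f m = 0) ->
  nsum f = nsum (fun m => f (i + m)%N).
Proof.
move=> f0; apply: (@fsum_inj _ _ (addn i)) => [m n /addnI //|m fm].
exists (m - i)%N; rewrite subnKC // leqNgt; apply: contra fm => /f0 ->.
exact: eqxx.
Qed.

Lemma nsum_antidiag f : evz2 f ->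
  nsum (fun m => nsum (f m)) = nsum (fun s => \sum_(m < s.+1) f m (s - m)%N).
Proof.
move=> ef; have [B fB] := evz2_bound ef.
pose g m s := if (m <= s)%N then f m (s - m)%N else 0.
have eg : evz2 g.
  split; first by exists B => m s Bm; rewrite /g; case: ifP => // _; rewrite fB ?Bm.
  move=> m; exists (m + B)%N => s ms; rewrite /g; case: ifP => // _.
  by rewrite fB // leq_subRL ?ms ?orbT // (leq_trans _ ms) ?leq_addr.
transitivity (nsum (fun m => nsum (g m))).
  apply: eq_nsum => m; rewrite [RHS](@nsum_shift m) => [|s sm].
    by apply: eq_nsum => j; rewrite /g leq_addr addKn.
  by rewrite /g leqNgt sm.
rewrite nsum_exchange //; apply: eq_nsum => s.
rewrite (@nsumE s.+1) => [|m sm]; last by rewrite /g leqNgt sm.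
by apply: eq_bigr => m _; rewrite /g -ltnS ltn_ord.
Qed.

End FiniteSums.

Lemma raddf_nsum (U V : zmodType) (F : {additive U -> V}) f :
  evz f -> F (nsum f) = nsum (fun m => F (f m)).
Proof.
move=> [B f0]; rewrite !(@nsumE _ B) ?raddf_sum // => m Bm.
by rewrite f0 // raddf0.
Qed.

Lemma evz_raddf (U V : zmodType) (F : {additive U -> V}) f :
  evz f -> evz (fun m => F (f m)).
Proof. by move=> [B f0]; exists B => m Bm; rewrite f0 // raddf0. Qed.

Lemma evzZ (K : pzRingType) (V : lmodType K) (c : nat -> K) (f : nat -> V) :
  evz f -> evz (fun m => c m *: f m).
Proof. by move=> [B f0]; exists B => m Bm; rewrite f0 // scaler0. Qed.

Lemma nsumZ (K : fieldType) (V : lmodType K) (c : K) (f : nat -> V) :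
  evz f -> nsum (fun m => c *: f m) = c *: nsum f.
Proof.
move=> [B f0]; rewrite !(@nsumE _ B) ?scaler_sumr // => m Bm.
by rewrite f0 // scaler0.
Qed.

(** * Binomial coefficients with arbitrary upper index *)

Section Binomials.
Variable K : fieldType.
Hypothesis charK : [pchar K] =i pred0.
Implicit Types x y : K.

Lemma natSr_neq0 n : n.+1%:R != 0 :> K.
Proof. by rewrite (pcharf0P K).1. Qed.

Lemma natr_eq n m : (n%:R == m%:R :> K) = (n == m).
Proof.
wlog nm : n m / (n <= m)%N => [sym|].
  by case: (leqP n m) => [/sym //|/ltnW /sym]; rewrite [m == n]eq_sym [m%:R == n%:R]eq_sym.
by rewrite eq_sym -subr_eq0 -natrB // (pcharf0P K).1 // subn_eq0 eqn_leq nm.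
Qed.

Lemma gbinom0 x : gbinom x 0 = 1.
Proof. by rewrite /gbinom big_ord0 fact0 divr1. Qed.

Lemma gbinomS x m : m.+1%:R * gbinom x m.+1 = (x - m%:R) * gbinom x m.
Proof.
rewrite /gbinom big_ord_recr /= factS natrM; field.
by rewrite addrC natr1 natSr_neq0 (pcharf0P K).1 // -lt0n fact_gt0.
Qed.

(** Vandermonde's identity is proved by this recursion instead of expanding
    powers: both sides of it are functions of [m] satisfying the recursion. *)
Lemma gbinom_unique x (c : nat -> K) :
  c 0%N = 1 -> (forall m, m.+1%:R * c m.+1 = (x - m%:R) * c m) ->
  forall m, c m = gbinom x m.
Proof.
move=> c0 cS; elim=> [|m IH]; first by rewrite gbinom0.
by apply: (mulfI (natSr_neq0 m)); rewrite cS gbinomS IH.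
Qed.

Lemma gbinom_vandermonde x y m :
  \sum_(i < m.+1) gbinom x i * gbinom y (m - i)%N = gbinom (x + y) m.
Proof.
pose c m := \sum_(i < m.+1) gbinom x i * gbinom y (m - i)%N.
apply: (@gbinom_unique _ c) m => [|m]; rewrite /c; first by rewrite big_ord1 !gbinom0 mulr1.
rewrite mulr_sumr.
transitivity (\sum_(i < m.+2) (i%:R * gbinom x i) * gbinom y (m.+1 - i)%N
  + \sum_(i < m.+2) gbinom x i * ((m.+1 - i)%:R * gbinom y (m.+1 - i)%N)).
  rewrite -big_split; apply: eq_bigr => i _ /=.
  rewrite [in RHS]natrB ?[_ m.+1]natr1 -1?ltnS ?ltn_ord //; ring.
rewrite big_ord_recl mul0r mul0r add0r [X in _ + X]big_ord_recr /= subnn mul0r.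
rewrite mulr0 addr0 -big_split mulr_sumr; apply: eq_bigr => i _ /=.
have im : (i <= m)%N by rewrite -ltnS.
rewrite /bump leq0n add1n subSS subSn // !gbinomS natrB //; ring.
Qed.

Lemma gbinom_bin n m : gbinom (n%:R : K) m = 'C(n, m)%:R.
Proof.
apply/esym/(@gbinom_unique n%:R (fun m => 'C(n, m)%:R)) => [|k]; first by rewrite bin0.
rewrite -natrM mul_bin_left natrM; have [kn|nk] := leqP k n; first by rewrite natrB.
by rewrite bin_small // !mulr0.
Qed.

Lemma gbinom_trinomial x k d :
  gbinom x (k + d)%N * 'C(k + d, k)%:R = gbinom x k * gbinom (x - k%:R) d.
Proof.
elim: d => [|d IH]; first by rewrite addn0 binn gbinom0.
apply: (mulfI (natSr_neq0 d)); rewrite [RHS]mulrCA gbinomS mulrCA -natrM.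
have -> : (d.+1 * 'C(k + d.+1, k) = (k + d).+1 * 'C(k + d, k))%N.
  by have := mul_bin_down (k + d).+1 k; rewrite /= -addnS addKn => ->.
rewrite [in LHS]natrM mulrA [_ * (k + d).+1%:R]mulrC addnS gbinomS -mulrA IH natrD; ring.
Qed.

Lemma gbinom_absorb x m : m.+1%:R * gbinom x m.+1 = x * gbinom (x - 1) m.
Proof.
have := gbinom_trinomial x 1 m; rewrite bin1 add1n mulrC => ->; congr (_ * _).
by apply: (mulfI (natSr_neq0 0)); rewrite gbinomS gbinom0 subr0 mulr1 mul1r.
Qed.

(** The coefficients of [(1 - t)^x]. *)
Definition sbinom x m : K := (-1) ^+ m * gbinom x m.

Lemma sbinom0 x : sbinom x 0 = 1.
Proof. by rewrite /sbinom gbinom0 mulr1. Qed.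

Lemma sbinom_vandermonde x y m :
  \sum_(i < m.+1) sbinom x i * sbinom y (m - i)%N = sbinom (x + y) m.
Proof.
rewrite /sbinom -gbinom_vandermonde mulr_sumr; apply: eq_bigr => i _.
rewrite mulrACA -exprD subnKC -1?ltnS //.
Qed.

Lemma sbinom_neg x m : sbinom (- x - 1) m = gbinom (x + m%:R) m.
Proof.
elim: m => [|m IH]; first by rewrite sbinom0 gbinom0.
apply: (mulfI (natSr_neq0 m)).
rewrite gbinom_absorb -natr1 addrA addrK -IH natr1 /sbinom mulrCA gbinomS exprS.
ring.
Qed.

Lemma sbinom_negn n m : sbinom (- n%:R - 1 : K) m = 'C(n + m, m)%:R.
Proof. by rewrite sbinom_neg -natrD gbinom_bin. Qed.

Lemma gbinom_neg x m : gbinom (- x - 1) m = (-1) ^+ m * gbinom (x + m%:R) m.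
Proof. by rewrite -sbinom_neg /sbinom signrMK. Qed.

Lemma bin_multinomial i j k :
  ('C(i + j + k, k) * 'C(i + j, i) = 'C(k + i, i) * 'C(k + i + j, j))%N.
Proof.
have e : (i + j + k)%N%:R - k%:R = (i + j)%N%:R :> K by rewrite natrD addrK.
have := gbinom_trinomial (i + j + k)%N%:R k i; rewrite e !gbinom_bin -!natrM.
move=> /eqP; rewrite natr_eq => /eqP <-; rewrite mulnC; congr (_ * _)%N.
  by rewrite -[RHS]bin_sub ?leq_addl // addnK.
by rewrite -[RHS]bin_sub ?leq_addl // addnK addnAC [(i + k)%N]addnC.
Qed.

(** The two expansions of [1/k! (d/dx)^k 1/i! (d/dy)^i (x - y)^(-1)], which is
    [(-1)^k binom(k+i, i) (x - y)^(-1-k-i)], in powers of [y / x] here and of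
    [x / y] in the next lemma. *)
Lemma gbinom_kernel_ge0 (i j k : nat) :
  gbinom (- (i + j)%:R - 1 : K) k * gbinom (i + j)%:R i =
  (-1) ^+ k * 'C(k + i, i)%:R * sbinom (- 1 - k%:R - i%:R) j.
Proof.
rewrite gbinom_neg -natrD !gbinom_bin -!mulrA -natrM bin_multinomial natrM.
have -> : - 1 - k%:R - i%:R = - (k + i)%:R - 1 :> K by rewrite natrD; ring.
by rewrite sbinom_negn.
Qed.

Lemma gbinom_kernel_lt0 (i j k : nat) :
  'C(j + k, k)%:R * gbinom (- 1 - (j + k)%:R : K) i =
  (-1) ^+ i * 'C(k + i, i)%:R * sbinom (- 1 - k%:R - i%:R) j.
Proof.
have -> : - 1 - (j + k)%:R = - (j + k)%:R - 1 :> K by ring.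
have -> : - 1 - k%:R - i%:R = - (k + i)%:R - 1 :> K by rewrite natrD; ring.
rewrite gbinom_neg -natrD sbinom_negn gbinom_bin -!mulrA mulrCA; congr (_ * _).
rewrite -!natrM; congr _%:R.
rewrite (_ : (j + k + i = i + (j + k))%N); last by lia.
have := bin_multinomial i j k; have := bin_multinomial k j i.
rewrite (_ : (k + j + i = i + (j + k))%N); last by lia.
rewrite (_ : (i + k + j = k + i + j)%N); last by lia.
rewrite (_ : ('C(i + k, k) = 'C(k + i, i))%N); last first.
  by rewrite addnC -bin_sub ?leq_addr // addKn.
by move=> + _ => <-; rewrite mulnC; congr (_ * 'C(_, _))%N; lia.
Qed.

End Binomials.

Section BinomialSums.
Variables (K : fieldType) (V : lmodType K).
Hypothesis charK : [pchar K] =i pred0.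
Implicit Types x y : K.

Let vandermonde (c c' c'' : nat -> K) (f : nat -> V) :
  (forall m, \sum_(i < m.+1) c i * c' (m - i)%N = c'' m) -> evz f ->
  nsum (fun m => nsum (fun j => (c m * c' j) *: f (m + j)%N)) =
  nsum (fun s => c'' s *: f s).
Proof.
move=> cc [B fB]; rewrite nsum_antidiag.
  apply: eq_nsum => s; rewrite -cc scaler_suml; apply: eq_bigr => i _.
  by rewrite subnKC // -ltnS.
split=> [|m]; first by exists B => m j Bm; rewrite fB ?scaler0 // (leq_trans Bm) // leq_addr.
by exists B => j Bj; rewrite fB ?scaler0 // (leq_trans Bj) // leq_addl.
Qed.

Lemma nsum_gbinom x y (f : nat -> V) : evz f ->
  nsum (fun m => nsum (fun j => (gbinom x m * gbinom y j) *: f (m + j)%N)) =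
  nsum (fun s => gbinom (x + y) s *: f s).
Proof. by apply: vandermonde; apply: gbinom_vandermonde. Qed.

Lemma nsum_sbinom x y (f : nat -> V) : evz f ->
  nsum (fun m => nsum (fun j => (sbinom x m * sbinom y j) *: f (m + j)%N)) =
  nsum (fun s => sbinom (x + y) s *: f s).
Proof. by apply: vandermonde; apply: sbinom_vandermonde. Qed.

End BinomialSums.

(** * The Fock space *)

Section Fock.
Variables (K : fieldType) (l : nat).
Local Notation M := (fock K l).
Local Notation MM := (heis_sum K l).
Implicit Types (u v : M) (w : MM) (al be ga : 'rV[K]_l) (x y : oscillator l).
Implicit Types m : {cmonom (oscillator l)}.

(** The vector [a^i(-k-1) 1], for [x = (i, k)]. *)
Definition var x : M := << ucm x >>.

Lemma fockD u v m : (u + v)@_m = u@_m + v@_m.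
Proof. exact: mcoeffD. Qed.

Lemma fockZ (c : K) u m : (c *: u)@_m = c * u@_m.
Proof. exact: mcoeffZ. Qed.

Lemma ucmM_inj x : injective (mmul (ucm x)).
Proof.
move=> m m' E; apply/eqP/cmP => i.
have : mmul (ucm x) m i = mmul (ucm x) m' i by rewrite E.
by rewrite !cmM => /addnI.
Qed.

Lemma mcoeff_varM x u m :
  (var x * u)@_m = \sum_(k <- msupp u) u@_k *+ (mmul (ucm x) k == m).
Proof.
rewrite malgM_def fgmulUg raddf_sum /=; apply: eq_bigr => k _.
by rewrite mcoeffU mul1r.
Qed.

Lemma mcoeff_varMM x u m : (var x * u)@_(mmul (ucm x) m) = u@_m.
Proof.
rewrite mcoeff_varM [in RHS](monalgE u) raddf_sum /=; apply: eq_bigr => k _.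
by rewrite mcoeffU (inj_eq (@ucmM_inj x)).
Qed.

Lemma mcoeff_varM0 x u m : m x = 0%N -> (var x * u)@_m = 0.
Proof.
move=> mx; rewrite mcoeff_varM big1 // => k _; case: eqP => // km.
by move: mx; rewrite -km cmM cmUU.
Qed.

Lemma cm_factor x m : m x != 0%N -> exists m', m = mmul (ucm x) m'.
Proof.
move=> mx; exists (divcm m (ucm x)); apply/eqP/cmP => y.
rewrite cmM cmU divcmE cmU; case: eqP => [<-|_]; last by rewrite subn0.
by rewrite add1n subn1 prednK // lt0n.
Qed.

(** Partial derivatives, behind an opaque existence proof: comparing two
    distinct ones would otherwise unfold them down to finite maps. *)
Fact sealed_fderiv : {f : oscillator l -> M -> M | forall x u, fock_deriv x u = f x u}.
Proof. by exists (@fock_deriv K l). Qed.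
Definition fderiv : oscillator l -> M -> M := sval sealed_fderiv.

Lemma fderivE x u : fock_deriv x u = fderiv x u.
Proof. exact: (svalP sealed_fderiv). Qed.

Lemma mcoeff_fderiv x u m :
  (fderiv x u)@_m = (m x).+1%:R * u@_(mmul (ucm x) m).
Proof.
rewrite -fderivE /fock_deriv raddf_sum /= [in RHS](monalgE u) raddf_sum mulr_sumr /=.
apply: eq_bigr => k _; rewrite mcoeffZ mcoeffU1 mcoeffU.
have [kx|/cm_factor[k' ->]] := eqVneq (k x) 0%N.
  rewrite kx mulr0 mul0r; case: eqP => [ke|]; last by rewrite mulr0.
  by move: kx; rewrite ke cmM cmUU.
have -> : divcm (mmul (ucm x) k') (ucm x) = k'.
  by apply/eqP/cmP => y; rewrite divcmE cmM addKn.
rewrite (inj_eq (@ucmM_inj x)); case: eqP => [->|]; last by rewrite !mulr0.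
by rewrite cmM cmUU add1n mulr1 mulrC.
Qed.

Lemma fderiv_is_linear x : linear (fderiv x).
Proof.
move=> c u v; apply/malgP => m.
by rewrite mcoeff_fderiv !fockD !fockZ !mcoeff_fderiv mulrDr mulrCA.
Qed.
HB.instance Definition _ x :=
  GRing.isLinear.Build K M M _ (fderiv x) (fderiv_is_linear x).

Lemma fderivC x y u : fderiv x (fderiv y u) = fderiv y (fderiv x u).
Proof.
apply/malgP => m; rewrite !mcoeff_fderiv !cmM !cmU [y == x]eq_sym.
have -> : mmul (ucm x) (mmul (ucm y) m) = mmul (ucm y) (mmul (ucm x) m).
  by rewrite !mulmA [mmul (ucm x) _]mulmC.
have [->|xy] := eqVneq x y; first by reflexivity.
by rewrite !add0n mulrCA.
Qed.

Lemma fderiv_varM x y u :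
  fderiv x (var y * u) = (x == y)%:R *: u + var y * fderiv x u.
Proof.
apply/malgP => m; rewrite fockD fockZ mcoeff_fderiv.
have [-> {x}|xy] := eqVneq x y.
  rewrite mcoeff_varMM mul1r; have [my|/cm_factor[m' ->]] := eqVneq (m y) 0%N.
    by rewrite my mcoeff_varM0 // addr0 mul1r.
  by rewrite mcoeff_varMM mcoeff_fderiv cmM cmUU add1n -natr1 mulrDl mul1r addrC.
rewrite mul0r add0r; have [my|/cm_factor[m' ->]] := eqVneq (m y) 0%N.
  by rewrite !mcoeff_varM0 ?mulr0 // cmM cmU (negPf xy) my.
have -> : mmul (ucm x) (mmul (ucm y) m') = mmul (ucm y) (mmul (ucm x) m').
  by rewrite !mulmA [mmul (ucm x) _]mulmC.
by rewrite !mcoeff_varMM mcoeff_fderiv cmM cmU eq_sym (negPf xy).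
Qed.

Lemma fderiv1 x : fderiv x 1 = 0.
Proof.
apply/malgP => m; rewrite mcoeff_fderiv mcoeff1 mcoeff0.
by rewrite cmM_eq1 cm1_eq1 mulr0.
Qed.

Lemma var_monomial x m : << mmul (ucm x) m >> = var x * << m >> :> M.
Proof. by rewrite malgM_def fgmulUU mulr1. Qed.

Lemma monomialZ (c : K) m : << c *g m >> = c *: << m >> :> M.
Proof.
apply/malgP => k; apply: etrans (mcoeffU _ _ _) _; apply/esym.
apply: etrans (fockZ _ _ _) _; rewrite -[RHS]mulr_natr; congr (c * _).
exact: mcoeffU1.
Qed.

Lemma cm_ind (P : {cmonom (oscillator l)} -> Prop) :
  P mone -> (forall x m, P m -> P (mmul (ucm x) m)) -> forall m, P m.
Proof.
move=> P1 PM m; have [n] := ubnP (mdeg m); elim: n m => // n IH m mn.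
have [->//|] := eqVneq m mone; rewrite -mdeg_eq0 mdegE => m0.
have [x xm] : exists x, x \in finsupp m.
  have [m1|[x xm]] := fset_0Vmem (finsupp m); last by exists x.
  by move: m0; rewrite m1 big_seq_fset0.
rewrite -cmE_neq0 in xm; have [m' E] := cm_factor xm.
rewrite E; apply: PM; apply: IH; move: mn.
by rewrite E mdegM mdegU add1n ltnS.
Qed.

Lemma fock_ind (P : M -> Prop) :
  P 1 -> (forall u v, P u -> P v -> P (u + v)) -> (forall c u, P u -> P (c *: u)) ->
  (forall x u, P u -> P (var x * u)) -> forall u, P u.
Proof.
move=> P1 PD PZ PM u; rewrite (monalgE u); apply: (big_ind P) => [|//|m _].
  by rewrite -(scale0r (1 : M)); apply: PZ.
rewrite monomialZ; apply: PZ.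
elim/cm_ind: m => [|x m Pm]; first exact: P1.
by rewrite var_monomial; apply: PM.
Qed.

End Fock.

Arguments fderiv {K l}.

(** * Direct sums of Fock modules *)

Section DirectSumOperators.
Variables (K : fieldType) (V : lmodType K) (I : choiceType).
Local Notation D := (dsum V I).
Implicit Types (c : K) (v : V) (w : D) (i : I).

Definition single v i : D := << v *g i >>.

Lemma dsumP w w' : (forall i, w@_i = w'@_i) -> w = w'.
Proof. by move=> E; apply/malgP. Qed.

Lemma mcoeff_single v i k : (single v i)@_k = v *+ (i == k).
Proof. exact: mcoeffU. Qed.

Lemma mcoeff_dsumD w w' i : (w + w')@_i = w@_i + w'@_i.
Proof. exact: mcoeffD. Qed.

Lemma singleD v v' i : single (v + v') i = single v i + single v' i.
Proof. exact: monalgUD. Qed.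

Lemma single0 i : single 0 i = 0.
Proof. exact: monalgU0. Qed.

Lemma singleZ c v i : single (c *: v) i = c *: single v i.
Proof.
apply: dsumP => k; rewrite dsum_scaleE !mcoeff_single.
by case: eqP => _ //; rewrite !mulr0n scaler0.
Qed.

Lemma dsum_ind (P : D -> Prop) :
  (forall w w', P w -> P w' -> P (w + w')) -> P 0 ->
  (forall v i, P (single v i)) -> forall w, P w.
Proof.
by move=> PD P0 P1 w; rewrite (monalgE w); apply: (big_ind P) => // i _; apply: P1.
Qed.

Fact sealed_blockw : {b : (I -> V -> V) -> D -> D |
  forall f w, \sum_(i <- msupp w) single (f i w@_i) i = b f w}.
Proof. by exists (fun f w => \sum_(i <- msupp w) single (f i w@_i) i). Qed.

(** Acting by [f i] on the summand of index [i]; the definition is kept opaque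
    because failed comparisons would unfold it down to finite maps. *)
Definition blockw : (I -> V -> V) -> D -> D := sval sealed_blockw.

Lemma blockwE f w : \sum_(i <- msupp w) single (f i w@_i) i = blockw f w.
Proof. exact: (svalP sealed_blockw). Qed.

Lemma mcoeff_blockw (f : I -> V -> V) w i :
  f i 0 = 0 -> (blockw f w)@_i = f i w@_i.
Proof.
move=> f0; rewrite -blockwE raddf_sum /=.
under eq_bigr do rewrite mcoeff_single.
case: msuppP => iw; last first.
  rewrite f0 big1_seq // => k /andP[_ kw]; case: eqP => // ki.
  by rewrite -ki kw in iw.
rewrite (big_fsetD1 i) //= eqxx big1_seq ?addr0 // => k /andP[_].
by rewrite in_fsetD1 => /andP[/negPf -> _].
Qed.

Lemma blockw_linear (f : I -> V -> V) :
  (forall i, linear (f i)) -> linear (blockw f).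
Proof.
move=> flin c w w'.
have f0 i : f i 0 = 0 by have := flin i (-1) 0 0; rewrite scaler0 addr0 scaleN1r addNr.
apply: dsumP => i; rewrite mcoeff_blockw // mcoeff_dsumD dsum_scaleE flin.
by rewrite mcoeff_dsumD dsum_scaleE !mcoeff_blockw.
Qed.

Lemma blockw_single (f : I -> V -> V) v i :
  f i 0 = 0 -> blockw f (single v i) = single (f i v) i.
Proof.
move=> f0; rewrite -blockwE /single msuppU; case: eqP => [->|_].
  by rewrite big_seq_fset0 f0 monalgU0.
by rewrite big_seq_fset1 mcoeffUU.
Qed.

End DirectSumOperators.

(** A module generated from a vacuum by the negative modes of a Heisenberg
    algebra, on which the zero modes vanish, and the direct sum of its twists by
    all eigenvalues [ga] of the zero modes. *)
Section TwistedSum.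
Variables (K : fieldType) (l : nat) (V : lmodType K) (vac : V).
Variable a : 'I_l -> int -> {linear V -> V}.
Hypothesis a_comm : forall i j n m v, a i n (a j m v) =
  a j m (a i n v) + (n%:~R *+ ((n == - m) && (i == j))) *: v.
Hypothesis a_vac : forall i (k : nat), a i k vac = 0.
Hypothesis a_ind : forall P : V -> Prop,
  P vac -> (forall v v', P v -> P v' -> P (v + v')) ->
  (forall c v, P v -> P (c *: v)) ->
  (forall i k v, P v -> P (a i (Negz k) v)) -> forall v, P v.
Local Notation D := (dsum V 'rV[K]_l).
Implicit Types (v : V) (w : D) (ga : 'rV[K]_l) (i j : 'I_l) (n m : int).

Definition twist n i ga v := if n == 0 then ga 0 i *: v else a i n v.

Fact twist_linear n i ga : linear (twist n i ga).
Proof.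
move=> c u v; rewrite /twist; case: eqP => _; last exact: linearP.
by rewrite scalerDr !scalerA mulrC.
Qed.

Lemma twist0 n i ga : twist n i ga 0 = 0.
Proof. by rewrite /twist scaler0 linear0 if_same. Qed.

Definition twisted_mode i n : D -> D := blockw (twist n i).

Fact twisted_mode_linear i n : linear (twisted_mode i n).
Proof. by apply: blockw_linear; apply: twist_linear. Qed.
HB.instance Definition _ i n :=
  GRing.isLinear.Build K D D _ (twisted_mode i n) (twisted_mode_linear i n).

Lemma mcoeff_twisted i n w ga : (twisted_mode i n w)@_ga = twist n i ga w@_ga.
Proof. by rewrite mcoeff_blockw // twist0. Qed.

Lemma twisted_single i n v ga :
  twisted_mode i n (single v ga) = single (twist n i ga v) ga.
Proof. by apply: blockw_single; apply: twist0. Qed.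

Lemma twisted_comm i j n m w : twisted_mode i n (twisted_mode j m w) =
  twisted_mode j m (twisted_mode i n w) +
  (n%:~R *+ ((n == - m) && (i == j))) *: w.
Proof.
apply: dsumP => ga; rewrite mcoeff_dsumD dsum_scaleE !mcoeff_twisted /twist.
have [->|n0] := eqVneq n 0.
  rewrite mul0rn scale0r addr0; case: eqP => _; last by rewrite linearZ.
  by rewrite !scalerA mulrC.
have [->|m0] := eqVneq m 0; last exact: a_comm.
by rewrite oppr0 (negPf n0) scale0r addr0 linearZ.
Qed.

Lemma twisted_ind (P : D -> Prop) :
  (forall ga, P (single vac ga)) -> (forall w w', P w -> P w' -> P (w + w')) ->
  (forall c w, P w -> P (c *: w)) ->
  (forall i k w, P w -> P (twisted_mode i (Negz k) w)) -> forall w, P w.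
Proof.
move=> P1 PD PZ PM; apply: dsum_ind; first exact: PD.
  by rewrite -(scale0r (single vac 0)); apply: PZ; apply: P1.
move=> v ga; elim/a_ind: v => [|u v Pu Pv|c v Pv|i k v Pv]; first exact: P1.
- by rewrite singleD; apply: PD.
- by rewrite singleZ; apply: PZ.
- by have := PM i k _ Pv; rewrite twisted_single.
Qed.

(** Creation operators commute with all but one annihilation operator, so the
    bound for [a^j(-m-1) w] is that for [w], raised above [m + 1]. It makes the sums
    over annihilation operators finite. *)
Lemma twisted_bound w :
  exists B, forall i (k : nat), (B <= k)%N -> twisted_mode i k w = 0.
Proof.
elim/twisted_ind: w => [ga|w w' [B wB] [C wC]|c w [B wB]|j m w [B wB]].
- exists 1%N => i [//|k] _; rewrite twisted_single /twist /= a_vac.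
  exact: single0.
- exists (maxn B C) => i k; rewrite geq_max => /andP[Bk Ck].
  by rewrite linearD /= wB ?wC ?addr0.
- by exists B => i k Bk; rewrite linearZ /= wB ?scaler0.
- exists (maxn B m.+2) => i k; rewrite geq_max => /andP[Bk mk].
  rewrite twisted_comm wB // linear0 add0r NegzE opprK eqz_nat.
  by rewrite gtn_eqF ?scale0r.
Qed.

End TwistedSum.

Section HeisenbergModule.
Variables (K : fieldType) (l : nat).
Local Notation M := (fock K l).
Local Notation MM := (heis_sum K l).
Implicit Types (u : M) (w : MM) (ga : 'rV[K]_l) (i j : 'I_l) (n m : int).

Fact sealed_fmode : {f : 'I_l -> int -> M -> M | forall i n u, fock_mode i n u = f i n u}.
Proof. by exists (@fock_mode K l). Qed.
Definition fmode : 'I_l -> int -> M -> M := sval sealed_fmode.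

Lemma fock_modeE i n u : fock_mode i n u = fmode i n u.
Proof. exact: (svalP sealed_fmode). Qed.

Lemma fmode_zero i u : fmode i 0 u = 0.
Proof. by rewrite -fock_modeE. Qed.

Lemma fmode_pos i (k : nat) u : fmode i k.+1 u = k.+1%:R *: fderiv (i, k) u.
Proof. by rewrite -fock_modeE -fderivE. Qed.

Lemma fmode_neg i (k : nat) u : fmode i (Negz k) u = var K (i, k) * u.
Proof. by rewrite -fock_modeE. Qed.

Lemma fmode_linear i n : linear (fmode i n).
Proof.
move=> c u v; case: n => [[|k]|k].
- by rewrite !fmode_zero scaler0 addr0.
- by rewrite !fmode_pos linearP scalerDr !scalerA mulrC.
- by rewrite !fmode_neg mulrDr scalerAr.
Qed.

Lemma fmode_comm i j n m u : fmode i n (fmode j m u) =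
  fmode j m (fmode i n u) + (n%:~R *+ ((n == - m) && (i == j))) *: u.
Proof.
have mulZD (A : algType K) (p q : K) (x y z : A) :
    p *: (q *: x + y * z) = y * (p *: z) + (p * q) *: x.
  by rewrite scalerDr scalerA scalerAr addrC.
have mulZD' (A : algType K) (p q : K) (x y z : A) :
    y * (p *: z) = p *: (q *: x + y * z) + (- (p * q)) *: x.
  by rewrite mulZD scaleNr addrK.
have lin0 k p : fmode k p 0 = 0.
  by have := fmode_linear k p (-1) 0 0; rewrite scaler0 addr0 scaleN1r addNr.
case: n => [[|n]|n].
- by rewrite !fmode_zero lin0 mul0rn scale0r addr0.
- case: m => [[|m]|m].
  + by rewrite !fmode_zero lin0 add0r scale0r.
  + by rewrite !fmode_pos !linearZ /= fderivC !scalerA mulrC scale0r addr0.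
  have <- : n.+1%:R * ((i, n) == (j, m))%:R =
      n.+1%:~R *+ ((Posz n.+1 == - Negz m) && (i == j)) :> K.
    rewrite xpair_eqE mulr_natr andbC NegzE opprK eqz_nat eqSS.
    by rewrite -mulrz_nat.
  rewrite (fmode_neg j m u) fmode_pos fderiv_varM fmode_neg fmode_pos.
  exact: mulZD.
- case: m => [[|m]|m].
  + by rewrite !fmode_zero lin0 add0r scale0r.
  + have -> : (Negz n)%:~R *+ ((Negz n == - Posz m.+1) && (i == j)) =
        - (m.+1%:R * ((j, m) == (i, n))%:R) :> K.
      rewrite xpair_eqE mulr_natr NegzE eqr_opp eqz_nat eqSS andbC.
      rewrite [j == i]eq_sym [m == n]eq_sym; case: (n =P m) => [->|_] /=.
        by rewrite rmorphN mulNrn.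
      by rewrite ?andbF !mulr0n oppr0.
    rewrite (fmode_neg i n u) !fmode_pos fderiv_varM fmode_neg.
    exact: mulZD'.
  have -> : (Negz n)%:~R *+ ((Negz n == - Negz m) && (i == j)) = 0 :> K by [].
  have mulC (A : comAlgType K) (x y z : A) : x * (y * z) = y * (x * z) + 0 *: z.
    by rewrite scale0r addr0 mulrCA.
  rewrite (fmode_neg i n (fmode j _ u)) (fmode_neg j m u).
  rewrite (fmode_neg j m (fmode i _ u)) (fmode_neg i n u); exact: mulC.
Qed.

Lemma fmode_vac i (k : nat) : fmode i k 1 = 0.
Proof. by case: k => [|k]; rewrite ?fmode_zero // fmode_pos fderiv1 scaler0. Qed.

Lemma fmode_ind (P : M -> Prop) :
  P 1 -> (forall u v, P u -> P v -> P (u + v)) -> (forall c u, P u -> P (c *: u)) ->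
  (forall i k u, P u -> P (fmode i (Negz k) u)) -> forall u, P u.
Proof.
move=> P1 PD PZ PM; apply: fock_ind => // -[i k] u Pu.
by have := PM i k u Pu; rewrite fmode_neg.
Qed.

HB.instance Definition _ i n :=
  GRing.isLinear.Build K M M _ (fmode i n) (fmode_linear i n).

Definition fmodes i n : {linear M -> M} := fmode i n.

Lemma amodeE i n w : amode i n w = twisted_mode fmodes i n w.
Proof.
rewrite /twisted_mode -blockwE; apply: eq_bigr => ga _.
by rewrite /tens /single /twist /fmodes /= -fock_modeE.
Qed.

End HeisenbergModule.

(** * Normally ordered products *)

Lemma linear0_of (K : pzRingType) (U V : lmodType K) (f : U -> V) : linear f -> f 0 = 0.
Proof. by move=> fl; have := fl (-1) 0 0; rewrite scaler0 addr0 scaleN1r addNr. Qed.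

Lemma evz_ext (V : zmodType) (f g : nat -> V) : f =1 g -> evz g -> evz f.
Proof. by move=> fg [B gB]; exists B => m /gB; rewrite fg. Qed.

Lemma evz2_add (V : zmodType) (f : nat -> nat -> V) B :
  (forall m j, (B <= m + j)%N -> f m j = 0) -> evz2 f.
Proof.
move=> fB; split; first by exists B => m j Bm; rewrite fB // (leq_trans Bm) ?leq_addr.
by move=> m; exists B => j Bj; rewrite fB // (leq_trans Bj) ?leq_addl.
Qed.

Lemma linear_nsum (K : fieldType) (U V : lmodType K) (F : {linear U -> V}) f :
  evz f -> F (nsum f) = nsum (fun m => F (f m)).
Proof. exact: raddf_nsum. Qed.

Lemma evz_linear (K : fieldType) (U V : lmodType K) (F : {linear U -> V}) f :
  evz f -> evz (fun m => F (f m)).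
Proof. exact: evz_raddf. Qed.

Lemma nsum_exchange3 (V : zmodType) (f : nat -> nat -> nat -> V) B :
  (forall m j r, (B <= m + j)%N -> f m j r = 0) -> (forall m j, evz (f m j)) ->
  nsum (fun m => nsum (fun j => nsum (f m j))) =
  nsum (fun r => nsum (fun m => nsum (fun j => f m j r))).
Proof.
move=> fB fr.
have fB' m j r : (B <= m)%N || (B <= j)%N -> f m j r = 0.
  by case/orP=> h; apply: fB; rewrite (leq_trans h) ?leq_addr ?leq_addl.
have ev2 m : evz2 (f m) by split=> //; exists B => j r Bj; rewrite fB' ?Bj ?orbT.
transitivity (nsum (fun m => nsum (fun r => nsum (fun j => f m j r)))).
  by apply: eq_nsum => m; rewrite nsum_exchange.
apply: nsum_exchange; split=> [|m].
  by exists B => m r Bm; apply: nsum0 => j; rewrite fB' ?Bm.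
exact: (evz2_nsum (evz2_sym (ev2 m))).
Qed.

Lemma intr_Negz (R : pzRingType) k : (Negz k)%:~R = - 1 - k%:R :> R.
Proof. by rewrite NegzE mulrNz -pmulrn -natr1 opprD addrC. Qed.

Section NormalProducts.
Variables (K : fieldType) (l : nat) (V : lmodType K).
Variable a : 'I_l -> int -> {linear V -> V}.
Hypothesis a_bound : forall w, exists B, forall i (k : nat), (B <= k)%N -> a i k w = 0.
Implicit Types (w : V) (i : 'I_l) (x e : K) (A B : K -> V -> V).

(** The coefficient of [z^x] in the normally ordered product of [A(z)] with the
    [k]-th divided derivative of [a^i(z)]; here [A e] is the coefficient of [z^e],
    whereas modes are numbered by [a^i(z) = \sum_j a^i(j) z^(-j-1)]. *)
Definition normal_product i (k : nat) (A : K -> V -> V) x w : V :=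
  nsum (fun j => 'C(j, k)%:R *: a i (Negz j) (A (x - j%:R + k%:R) w)) +
  nsum (fun j => gbinom (- j%:R - 1) k *: A (x + j%:R + 1 + k%:R) (a i (Posz j) w)).

(** Fields in the sense of vertex algebras: applied to a vector, the exponents
    in each class modulo the integers are bounded below. *)
Definition truncated (A : K -> V -> V) :=
  (forall x, linear (A x)) /\ forall x w, evz (fun m => A (x - m%:R) w).

Lemma evz_np1 A i k x w : truncated A ->
  evz (fun t => 'C(t, k)%:R *: a i (Negz t) (A (x - t%:R + k%:R) w)).
Proof.
move=> [_ /(_ (x + k%:R) w)[b Ab]]; exists b => t bt.
by rewrite addrAC Ab // linear0 scaler0.
Qed.

Lemma evz_np2 A i (c y : nat -> K) w : truncated A ->
  evz (fun t => c t *: A (y t) (a i (Posz t) w)).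
Proof.
move=> [Al _]; have [J wJ] := a_bound w; exists J => t Jt.
by rewrite wJ // (linear0_of (Al _)) scaler0.
Qed.

(** A linear relation between fields passes to normally ordered products. As
    needed for the Borcherds identity, the relation is assumed in one class of
    exponents only, and on a set of vectors stable under annihilation. *)
Lemma normal_product_eq i k c A B C (G : V -> Prop) e w :
  truncated B -> truncated C -> (forall (j : nat) w', G w' -> G (a i j w')) -> G w ->
  (forall (p : int) w', G w' -> A (e + p%:~R) w' = c *: B (e + p%:~R) w' + C (e + p%:~R) w') ->
  normal_product i k A e w = c *: normal_product i k B e w + normal_product i k C e w.
Proof.
move=> Bt Ct Ga Gw ABC; rewrite /normal_product scalerDr addrACA; congr (_ + _).
  rewrite -nsumZ; last exact: evz_np1.
  rewrite -nsumD; [|by apply: evzZ; apply: evz_np1|exact: evz_np1].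
  apply: eq_nsum => j; have -> : e - j%:R + k%:R = e + (k%:Z - j%:Z)%:~R.
    by rewrite rmorphB /= -!pmulrn; ring.
  by rewrite ABC // linearP scalerDr !scalerA mulrC.
rewrite -nsumZ; last exact: evz_np2.
rewrite -nsumD; [|by apply: evzZ; apply: evz_np2|exact: evz_np2].
apply: eq_nsum => j; have -> : e + j%:R + 1 + k%:R = e + (j%:Z + 1 + k%:Z)%:~R.
  by rewrite !rmorphD /= -!pmulrn; ring.
by rewrite ABC; [rewrite scalerDr !scalerA mulrC | exact: Ga].
Qed.

Lemma truncated_normal i k A : truncated A -> truncated (normal_product i k A).
Proof.
move=> At; have [Al Ab] := At; split=> [x c w w'|x w].
  rewrite /normal_product scalerDr addrACA; congr (_ + _).
    rewrite -nsumZ; last exact: evz_np1.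
    rewrite -nsumD; [|by apply: evzZ; apply: evz_np1|exact: evz_np1].
    by apply: eq_nsum => t; rewrite Al linearP scalerDr !scalerA mulrC.
  rewrite -nsumZ; last exact: evz_np2.
  rewrite -nsumD; [|by apply: evzZ; apply: evz_np2|exact: evz_np2].
  by apply: eq_nsum => t; rewrite linearP Al scalerDr !scalerA mulrC.
apply: evzD.
  have [b wb] := Ab (x + k%:R) w; exists b => m bm; apply: nsum0 => t.
  have -> : x - m%:R - t%:R + k%:R = x + k%:R - (m + t)%:R by rewrite natrD; ring.
  by rewrite wb ?linear0 ?scaler0 // (leq_trans bm) ?leq_addr.
have [J wJ] := a_bound w.
have ev t : evz (fun m => gbinom (- t%:R - 1) k *:
    A (x + t%:R + 1 + k%:R - m%:R) (a i (Posz t) w)) by apply: evzZ; apply: Ab.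
have [c fc] := evz_sum (index_enum 'I_J) (P := xpredT) (fun t _ => ev (nat_of_ord t)).
exists c => m cm; rewrite (@nsumE _ J) => [|t Jt]; last first.
  by rewrite wJ // (linear0_of (Al _)) scaler0.
by rewrite -[RHS](fc m cm); apply: eq_bigr => t _; congr (_ *: A _ _); ring.
Qed.

Hypothesis a_comm : forall i j n m w, a i n (a j m w) =
  a j m (a i n w) + (n%:~R *+ ((n == - m) && (i == j))) *: w.

Lemma creationC i j (s t : nat) w :
  a i (Negz s) (a j (Negz t) w) = a j (Negz t) (a i (Negz s) w).
Proof.
by rewrite a_comm (_ : (Negz s == - Negz t) = false) // scale0r addr0.
Qed.

Lemma annihilationC i j (s t : nat) w :
  a i (Posz s) (a j (Posz t) w) = a j (Posz t) (a i (Posz s) w).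
Proof.
rewrite a_comm; case: s => [|s]; first by rewrite mul0rn scale0r addr0.
by case: t => [|t]; rewrite scale0r addr0.
Qed.

(** Creation operators commute with each other, and so do annihilation
    operators; each of the four double sums is exchanged separately. *)
Lemma normal_productC i k j m A x w : truncated A ->
  normal_product i k (normal_product j m A) x w =
  normal_product j m (normal_product i k A) x w.
Proof.
move=> At; have [Al Ab] := At.
have A0 y : A y 0 = 0 := linear0_of (Al y).
pose F1 i' k' j' m' s t := ('C(s, k')%:R * 'C(t, m')%:R) *:
  a i' (Negz s) (a j' (Negz t) (A (x - s%:R + k'%:R - t%:R + m'%:R) w)).
pose F2 i' k' j' m' s t := ('C(s, k')%:R * gbinom (- t%:R - 1) m') *:
  a i' (Negz s) (A (x - s%:R + k'%:R + t%:R + 1 + m'%:R) (a j' (Posz t) w)).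
pose F3 i' k' j' m' s t := (gbinom (- s%:R - 1) k' * 'C(t, m')%:R) *:
  a j' (Negz t) (A (x + s%:R + 1 + k'%:R - t%:R + m'%:R) (a i' (Posz s) w)).
pose F4 i' k' j' m' s t := (gbinom (- s%:R - 1) k' * gbinom (- t%:R - 1) m') *:
  A (x + s%:R + 1 + k'%:R + t%:R + 1 + m'%:R) (a j' (Posz t) (a i' (Posz s) w)).
have [J wJ] := a_bound w.
have ev1 i' k' j' m' : evz2 (F1 i' k' j' m').
  have [b wb] := Ab (x + k'%:R + m'%:R) w; apply: (@evz2_add _ _ b) => s t bst.
  have E : x - s%:R + k'%:R - t%:R + m'%:R = x + k'%:R + m'%:R - (s + t)%:R.
    by rewrite natrD; ring.
  by rewrite /F1 E wb // !linear0 ?scaler0.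
have ev2 i' k' j' m' : evz2 (F2 i' k' j' m').
  apply: evz2_sym; split=> [|t].
    by exists J => t s Jt; rewrite /F2 wJ // A0 linear0 scaler0.
  have [b wb] := Ab (x + k'%:R + t%:R + 1 + m'%:R) (a j' (Posz t) w).
  exists b => s bs; rewrite /F2.
  have -> : x - s%:R + k'%:R + t%:R + 1 + m'%:R =
    x + k'%:R + t%:R + 1 + m'%:R - s%:R by ring.
  by rewrite wb // linear0 scaler0.
have ev3 i' k' j' m' : evz2 (F3 i' k' j' m').
  split=> [|s]; first by exists J => s t Js; rewrite /F3 wJ // A0 linear0 scaler0.
  have [b wb] := Ab (x + s%:R + 1 + k'%:R + m'%:R) (a i' (Posz s) w).
  by exists b => t bt; rewrite /F3 addrAC wb // linear0 scaler0.
have ev4 i' k' j' m' : evz2 (F4 i' k' j' m').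
  split=> [|s]; first by exists J => s t Js; rewrite /F4 wJ // linear0 A0 scaler0.
  have [b wb] := a_bound (a i' (Posz s) w).
  by exists b => t bt; rewrite /F4 wb // A0 scaler0.
have expand i' k' j' m' : normal_product i' k' (normal_product j' m' A) x w =
    nsum (fun s => nsum (F1 i' k' j' m' s)) + nsum (fun s => nsum (F2 i' k' j' m' s)) +
    (nsum (fun s => nsum (F3 i' k' j' m' s)) + nsum (fun s => nsum (F4 i' k' j' m' s))).
  rewrite {1}/normal_product; congr (_ + _); rewrite -nsumD;
    try exact: evz2_nsum; apply: eq_nsum => s.
    rewrite linearD scalerDr; congr (_ + _).
      rewrite linear_nsum; last exact: evz_np1.
      rewrite -nsumZ; last by apply: evz_linear; apply: evz_np1.
      by apply: eq_nsum => t; rewrite [a _ _ (_ *: _)]linearZ /= scalerA.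
    rewrite linear_nsum; last exact: evz_np2.
    rewrite -nsumZ; last by apply: evz_linear; apply: evz_np2.
    by apply: eq_nsum => t; rewrite [a _ _ (_ *: _)]linearZ /= scalerA.
  rewrite scalerDr -!nsumZ; [|exact: evz_np2|exact: evz_np1].
  by congr (_ + _); apply: eq_nsum => t; rewrite scalerA.
rewrite !expand [RHS]addrACA; congr (_ + _ + (_ + _)).
- rewrite nsum_exchange //; apply: eq_nsum => t; apply: eq_nsum => s.
  rewrite /F1 mulrC creationC; congr (_ *: a _ _ (a _ _ (A _ _))); ring.
- rewrite nsum_exchange //; apply: eq_nsum => t; apply: eq_nsum => s.
  rewrite /F2 /F3 mulrC; congr (_ *: a _ _ (A _ _)); ring.
- rewrite nsum_exchange //; apply: eq_nsum => t; apply: eq_nsum => s.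
  rewrite /F2 /F3 mulrC; congr (_ *: a _ _ (A _ _)); ring.
rewrite nsum_exchange //; apply: eq_nsum => t; apply: eq_nsum => s.
rewrite /F4 mulrC annihilationC; congr (_ *: A _ _); ring.
Qed.

End NormalProducts.

(** * Products and iterates of fields *)

(** Fields on a module over the Heisenberg modes [a], in the form of two
    products that determine all others: the commutators with [a], and the normally
    ordered products with derivatives of [a(z)]. *)
Section BorcherdsTerms.
Variables (K : fieldType) (l : nat) (V : lmodType K).
Hypothesis charK : [pchar K] =i pred0.
Variables (a : 'I_l -> int -> {linear V -> V}) (Y : V -> K -> {linear V -> V}).
Hypothesis Y_linear : forall x w, linear (fun u => Y u x w).
Implicit Types (u v w : V) (i : 'I_l) (x y N e : K).

Local Notation normal_product := (normal_product a).
Hypothesis a_bound : forall w, exists B, forall i (k : nat), (B <= k)%N -> a i k w = 0.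
Hypothesis Y_trunc : forall u w x, evz (fun m : nat => Y u (x - m%:R) w).
Hypothesis Y_comm : forall i n u x w, a i n (Y u x w) = Y u x (a i n w) +
  nsum (fun k => gbinom n%:~R k *: Y (a i (Posz k) u) (x - n%:~R + k%:R) w).
Hypothesis Y_normal : forall i k u x w,
  Y (a i (Negz k) u) x w = normal_product i k (Y u) x w.

Lemma Y0l x w : Y 0 x w = 0.
Proof. exact: (linear0_of (Y_linear x w)). Qed.

Lemma YZ c u x w : Y (c *: u) x w = c *: Y u x w.
Proof. by rewrite -[c *: u]addr0 Y_linear Y0l addr0. Qed.

(** The coefficient of [z1^e1 z2^e2] in [(z1 - z2)^N Y(u, z1) Y(v, z2) w]. *)
Definition product N e1 e2 u v w : V :=
  nsum (fun m => sbinom N m *: Y u (e1 - N + m%:R) (Y v (e2 - m%:R) w)).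

(** The coefficient of [z0^(-1-N) z1^e1 z2^e2] in
    [z2^(-1) delta((z1 - z0)/z2) Y(Y(u, z0) v, z2) w]. *)
Definition iterate N e1 e2 u v w : V :=
  nsum (fun m => gbinom (- e1 - 1) m *:
    Y (Y u (- 1 - N - m%:R) v) (e1 + e2 + 1 + m%:R) w).

Lemma Y_trunc2 u v w x y (c : nat -> nat) :
  evz (fun m => Y u (x + (c m)%:R) (Y v (y - m%:R) w)).
Proof. by have [B wB] := Y_trunc v w y; exists B => m Bm; rewrite wB // linear0. Qed.

Lemma evz_creation i k u x w :
  evz (fun j => 'C(j, k)%:R *: a i (Negz j) (Y u (x - j%:R + k%:R) w)).
Proof.
have [b wb] := Y_trunc u w (x + k%:R); exists b => j bj.
by rewrite addrAC wb // linear0 ?scaler0.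
Qed.

Lemma evz_annihilation i (c : nat -> K) (y : nat -> K) u w :
  evz (fun j => c j *: Y u (y j) (a i (Posz j) w)).
Proof.
have [J wJ] := a_bound w; exists J => j Jj.
by rewrite wJ // linear0 ?scaler0.
Qed.

(** Expanding [Y(a^i(-k-1) u, z1)] and moving the annihilation modes to the right
    of [Y(v, z2)] leaves contractions with [v], which lower the exponent of
    [z1 - z2]. *)
Lemma product_left i k N e1 e2 u v w :
  product N e1 e2 (a i (Negz k) u) v w =
  normal_product i k (fun x => product N x e2 u v) e1 w +
  nsum (fun r => ((-1) ^+ k * 'C(k + r, r)%:R) *:
    product (N - 1 - k%:R - r%:R) e1 e2 u (a i (Posz r) v) w).
Proof.
have [R vR] := a_bound v; have [J wJ] := a_bound w.
pose A m j := (sbinom N m * 'C(j, k)%:R) *: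
  a i (Negz j) (Y u (e1 - N + m%:R - j%:R + k%:R) (Y v (e2 - m%:R) w)).
pose B m j := (sbinom N m * gbinom (- j%:R - 1) k) *:
  Y u (e1 - N + m%:R + j%:R + 1 + k%:R) (Y v (e2 - m%:R) (a i (Posz j) w)).
pose C r m j := (sbinom N m * (gbinom (- j%:R - 1) k * gbinom j%:R r)) *:
  Y u (e1 - N + m%:R + j%:R + 1 + k%:R)
      (Y (a i (Posz r) v) (e2 - m%:R - j%:R + r%:R) w).
have evA : evz2 A.
  have [b wb] := Y_trunc v w e2; split=> [|m].
    by exists b => m j bm; rewrite /A wb // !linear0 ?scaler0.
  have [c uc] := evz_creation i k u (e1 - N + m%:R) (Y v (e2 - m%:R) w).
  by exists c => j cj; rewrite /A -scalerA uc // scaler0.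
have evB : evz2 B.
  apply: evz2_sym; split=> [|j].
    by exists J => j m Jj; rewrite /B wJ // !linear0 ?scaler0.
  have [b wb] := Y_trunc v (a i (Posz j) w) e2.
  by exists b => m bm; rewrite /B wb // linear0 ?scaler0.
have evC r : evz2 (C r).
  have [b wb] := Y_trunc (a i (Posz r) v) w (e2 + r%:R).
  apply: (@evz2_add _ _ b) => m j bmj; rewrite /C.
  have -> : e2 - m%:R - j%:R + r%:R = e2 + r%:R - (m + j)%:R.
    by rewrite natrD; ring.
  by rewrite wb // linear0 ?scaler0.
have expand m : sbinom N m *: Y (a i (Negz k) u) (e1 - N + m%:R) (Y v (e2 - m%:R) w) =
    nsum (A m) + (nsum (B m) + \sum_(r < R) nsum (C r m)).
  rewrite Y_normal scalerDr -!nsumZ; [|exact: evz_annihilation|exact: evz_creation].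
  congr (_ + _); first by apply: eq_nsum => j; rewrite scalerA.
  rewrite -nsum_sum => [|r _]; last by case: (evC r) => _; apply.
  rewrite -nsumD; first last.
  - by apply: evz_sum => r _; case: (evC r) => _; apply.
  - by case: evB => _; apply.
  apply: eq_nsum => j; rewrite Y_comm linearD /= scalerDr scalerDr !scalerA.
  congr (_ + _); rewrite (@nsumE _ R) => [|r Rr]; last by rewrite vR // Y0l scaler0.
  rewrite linear_sum scaler_sumr; apply: eq_bigr => r _.
  by rewrite linearZ /= scalerA -mulrA.
rewrite /product (eq_nsum expand) nsumD; first last.
- apply: evzD; first exact: evz2_nsum.
  by apply: evz_sum => r _; apply: evz2_nsum.
- exact: evz2_nsum.
rewrite nsumD ?addrA; first last.
- by apply: evz_sum => r _; apply: evz2_nsum.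
- exact: evz2_nsum.
rewrite nsum_sum => [|r _]; last exact: evz2_nsum.
congr (_ + _ + _).
- rewrite nsum_exchange //; apply: eq_nsum => j.
  have evY x : evz (fun m => sbinom N m *: Y u (x + m%:R) (Y v (e2 - m%:R) w)).
    by apply: evzZ; apply: Y_trunc2.
  rewrite linear_nsum // -nsumZ; last exact: evz_linear.
  apply: eq_nsum => m; rewrite linearZ /= scalerA mulrC; congr (_ *: a _ _ (Y _ _ _)).
  ring.
- rewrite nsum_exchange //; apply: eq_nsum => j.
  rewrite -nsumZ; last by apply: evzZ; apply: Y_trunc2.
  apply: eq_nsum => m; rewrite scalerA mulrC; congr (_ *: (Y _ _ _)).
  ring.
rewrite (@nsumE _ R) => [|r Rr]; last first.
  by rewrite /product nsum0 ?scaler0 // => m; rewrite vR // Y0l linear0 ?scaler0.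
apply: eq_bigr => r _; rewrite /product.
have evY : evz (fun s => Y u (e1 - N + 1 + k%:R + r%:R + s%:R)
    (Y (a i (Posz r) v) (e2 - s%:R) w)) by apply: Y_trunc2.
transitivity (((-1) ^+ k * 'C(k + r, r)%:R) *: nsum (fun s =>
    sbinom (N + (- 1 - k%:R - r%:R)) s *: Y u (e1 - N + 1 + k%:R + r%:R + s%:R)
    (Y (a i (Posz r) v) (e2 - s%:R) w))); last first.
  congr (_ *: _); apply: eq_nsum => s; congr (sbinom _ _ *: Y _ _ _); ring.
rewrite -nsum_sbinom // -nsumZ; last first.
  apply: evz2_nsum; have [b wb] := evY; apply: (@evz2_add _ _ b) => m j bmj.
  by rewrite wb ?scaler0.
apply: eq_nsum => m; rewrite (@nsum_shift _ r) => [|j jr]; last first.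
  by rewrite /C gbinom_bin // bin_small // !mulr0 scale0r.
have [b wb] := evY.
rewrite -nsumZ; last by exists b => j bj; rewrite wb ?scaler0 // (leq_trans bj) ?leq_addl.
apply: eq_nsum => j; rewrite /C gbinom_kernel_ge0 // scalerA mulrCA natrD.
by congr (_ *: Y _ _ (Y _ _ _)); rewrite ?natrD; ring.
Qed.

(** Here the creation operators are moved to the left of [Y(u, z1)], which leaves
    contractions with [u]. *)
Lemma product_right i k N e1 e2 u v w :
  product N e1 e2 u (a i (Negz k) v) w =
  normal_product i k (fun x => product N e1 x u v) e2 w -
  nsum (fun r => ((-1) ^+ r * 'C(k + r, r)%:R) *:
    product (N - 1 - k%:R - r%:R) e1 e2 (a i (Posz r) u) v w).
Proof.
have [R uR] := a_bound u; have [J wJ] := a_bound w.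
have [b wb] := Y_trunc v w (e2 + k%:R).
have e2mj m j : e2 - m%:R - j%:R + k%:R = e2 + k%:R - (m + j)%:R.
  by rewrite natrD; ring.
pose A m j := (sbinom N m * 'C(j, k)%:R) *:
  a i (Negz j) (Y u (e1 - N + m%:R) (Y v (e2 - m%:R - j%:R + k%:R) w)).
pose B m j := (sbinom N m * gbinom (- j%:R - 1) k) *:
  Y u (e1 - N + m%:R) (Y v (e2 - m%:R + j%:R + 1 + k%:R) (a i (Posz j) w)).
pose C r m j := (sbinom N m * ('C(j, k)%:R * gbinom (- 1 - j%:R) r)) *:
  Y (a i (Posz r) u) (e1 - N + m%:R + 1 + j%:R + r%:R)
    (Y v (e2 - m%:R - j%:R + k%:R) w).
have evA : evz2 A.
  apply: (@evz2_add _ _ b) => m j bmj.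
  by rewrite /A e2mj wb // !linear0 ?scaler0.
have evB : evz2 B.
  apply: evz2_sym; split=> [|j].
    by exists J => j m Jj; rewrite /B wJ // !linear0 ?scaler0.
  have [c wc] := Y_trunc v (a i (Posz j) w) (e2 + j%:R + 1 + k%:R).
  exists c => m cm; rewrite /B.
  have -> : e2 - m%:R + j%:R + 1 + k%:R = e2 + j%:R + 1 + k%:R - m%:R by ring.
  by rewrite wc // linear0 ?scaler0.
have evC r : evz2 (C r).
  apply: (@evz2_add _ _ b) => m j bmj.
  by rewrite /C e2mj wb // !linear0 ?scaler0.
have expand m : sbinom N m *: Y u (e1 - N + m%:R) (Y (a i (Negz k) v) (e2 - m%:R) w) =
    nsum (A m) + nsum (B m) - \sum_(r < R) nsum (C r m).
  rewrite Y_normal linearD scalerDr [RHS]addrAC; congr (_ + _); last first.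
    rewrite linear_nsum; last exact: evz_annihilation.
    rewrite -nsumZ; last by apply: evz_linear; apply: evz_annihilation.
    by apply: eq_nsum => j; rewrite linearZ scalerA.
  rewrite linear_nsum; last exact: evz_creation.
  rewrite -nsumZ; last by apply: evz_linear; apply: evz_creation.
  rewrite -nsum_sum => [|r _]; last by case: (evC r) => _; apply.
  rewrite -nsumB; first last.
  - by apply: evz_sum => r _; case: (evC r) => _; apply.
  - by case: evA => _; apply.
  apply: eq_nsum => j; rewrite linearZ scalerA /A (Y_comm _ _ u) scalerDr.
  suff <- : ('C(j, k)%:R * sbinom N m) *: nsum (fun r => gbinom (Negz j)%:~R r *:
      Y (a i (Posz r) u) (e1 - N + m%:R - (Negz j)%:~R + r%:R)
        (Y v (e2 - m%:R - j%:R + k%:R) w)) = \sum_(r < R) C r m j.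
    by rewrite mulrC addrK.
  rewrite (@nsumE _ R) => [|r Rr]; last by rewrite uR // Y0l scaler0.
  rewrite scaler_sumr; apply: eq_bigr => r _.
  by rewrite scalerA /C intr_Negz; congr (_ *: Y _ _ _); ring.
rewrite /product (eq_nsum expand) nsumB; first last.
- by apply: evz_sum => r _; apply: evz2_nsum.
- by apply: evzD; apply: evz2_nsum.
rewrite nsumD; [|exact: evz2_nsum..].
rewrite nsum_sum => [|r _]; last exact: evz2_nsum.
congr (_ + _ - _).
- rewrite nsum_exchange //; apply: eq_nsum => j.
  have evY x : evz (fun m => sbinom N m *: Y u (e1 - N + m%:R) (Y v (x - m%:R) w)).
    by apply: evzZ; apply: Y_trunc2.
  rewrite linear_nsum // -nsumZ; last exact: evz_linear.
  apply: eq_nsum => m; rewrite linearZ /= scalerA mulrC.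
  congr (_ *: a _ _ (Y _ _ (Y _ _ _))); ring.
- rewrite nsum_exchange //; apply: eq_nsum => j.
  rewrite -nsumZ; last by apply: evzZ; apply: Y_trunc2.
  apply: eq_nsum => m; rewrite scalerA mulrC; congr (_ *: (Y _ _ (Y _ _ _))).
  ring.
rewrite (@nsumE _ R) => [|r Rr]; last first.
  by rewrite /product nsum0 ?scaler0 // => m; rewrite uR // Y0l scaler0.
apply: eq_bigr => r _; rewrite /product.
have evY : evz (fun s => Y (a i (Posz r) u) (e1 - N + 1 + k%:R + r%:R + s%:R)
    (Y v (e2 - s%:R) w)) by apply: Y_trunc2.
transitivity (((-1) ^+ r * 'C(k + r, r)%:R) *: nsum (fun s =>
    sbinom (N + (- 1 - k%:R - r%:R)) s *:
    Y (a i (Posz r) u) (e1 - N + 1 + k%:R + r%:R + s%:R) (Y v (e2 - s%:R) w))); last first.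
  congr (_ *: _); apply: eq_nsum => s; congr (sbinom _ _ *: Y _ _ _); ring.
rewrite -nsum_sbinom // -nsumZ; last first.
  apply: evz2_nsum; have [c wc] := evY; apply: (@evz2_add _ _ c) => m j cmj.
  by rewrite wc ?scaler0.
apply: eq_nsum => m; rewrite (@nsum_shift _ k) => [|j jk]; last first.
  by rewrite /C bin_small // mul0r mulr0 scale0r.
have [c wc] := evY.
rewrite -nsumZ; last by exists c => j cj; rewrite wc ?scaler0 // (leq_trans cj) ?leq_addl.
apply: eq_nsum => j; rewrite /C [(k + j)%N]addnC gbinom_kernel_lt0 // scalerA mulrCA natrD.
by congr (_ *: Y _ _ (Y _ _ _)); rewrite ?natrD; ring.
Qed.

(** Taylor's formula for the [k]-th divided derivative of [(z2 + z0)^x],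
    multiplied by [(z2 + z0)^y]. *)
Lemma nsum_taylor k x y (f : nat -> V) : evz f ->
  nsum (fun m => nsum (fun j => (gbinom y m * ('C(j, k)%:R * gbinom x j)) *:
    f (m + (j - k))%N)) =
  gbinom x k *: nsum (fun s => gbinom (y + (x - k%:R)) s *: f s).
Proof.
move=> evf; rewrite -nsum_gbinom // -nsumZ; last first.
  apply: evz2_nsum; have [b fb] := evf; apply: (@evz2_add _ _ b) => m j bmj.
  by rewrite fb ?scaler0.
apply: eq_nsum => m; rewrite (@nsum_shift _ k) => [|j jk]; last first.
  by rewrite bin_small // mul0r mulr0 scale0r.
have [b fb] := evf.
rewrite -nsumZ; last by exists b => j bj; rewrite fb ?scaler0 // (leq_trans bj) ?leq_addl.
apply: eq_nsum => j; rewrite addKn scalerA; congr (_ *: _).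
by rewrite [_%:R * _]mulrC gbinom_trinomial // mulrCA.
Qed.

(** In [Y(a^i(-k-1) u, z0) v] the annihilation part of the field [a^i(z0)] acts on
    [v], which gives the contractions with [v]. The creation part acts on
    [Y(u, z0) v]; its Taylor series in [z0] under [Y(_, z2)] sums to the normally
    ordered product in [z1 = z2 + z0]. *)
Lemma iterate_left i k N e1 e2 u v w :
  iterate N e1 e2 (a i (Negz k) u) v w =
  normal_product i k (fun x => iterate N x e2 u v) e1 w +
  nsum (fun r => ((-1) ^+ k * 'C(k + r, r)%:R) *:
    iterate (N - 1 - k%:R - r%:R) e1 e2 u (a i (Posz r) v) w).
Proof.
have [R vR] := a_bound v; have [J wJ] := a_bound w.
have [b vb] := Y_trunc u v (- 1 - N + k%:R).
have ymj m j : - 1 - N - m%:R - j%:R + k%:R = - 1 - N + k%:R - (m + j)%:R.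
  by rewrite natrD; ring.
pose X m j := Y u (- 1 - N - m%:R - j%:R + k%:R) v.
have X0 m j : (b <= m + j)%N -> X m j = 0 by move=> bmj; rewrite /X ymj vb.
pose A m j r := (gbinom (- e1 - 1) m * ('C(j, k)%:R * 'C(r, j)%:R)) *:
  a i (Negz r) (Y (X m j) (e1 + e2 + 1 + m%:R - r%:R + j%:R) w).
pose B m j r := (gbinom (- e1 - 1) m * ('C(j, k)%:R * gbinom (- r%:R - 1) j)) *:
  Y (X m j) (e1 + e2 + 1 + m%:R + r%:R + 1 + j%:R) (a i (Posz r) w).
pose C r m := (gbinom (- e1 - 1) m * gbinom (- r%:R - 1) k) *:
  Y (Y u (- 1 - N - m%:R + r%:R + 1 + k%:R) (a i (Posz r) v)) (e1 + e2 + 1 + m%:R) w.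
have A0 m j r : (b <= m + j)%N -> A m j r = 0.
  by move=> bmj; rewrite /A X0 // Y0l linear0 scaler0.
have B0 m j r : (b <= m + j)%N -> B m j r = 0.
  by move=> bmj; rewrite /B X0 // Y0l scaler0.
have evA m j : evz (A m j).
  have [c wc] := evz_creation i j (X m j) (e1 + e2 + 1 + m%:R) w.
  by exists c => r cr; rewrite /A mulrA -scalerA wc ?scaler0.
have evB m j : evz (B m j).
  exact: evz_annihilation.
have evC r : evz (C r).
  have [c vc] := Y_trunc u (a i (Posz r) v) (- 1 - N + r%:R + 1 + k%:R).
  exists c => m cm; rewrite /C.
  have -> : - 1 - N - m%:R + r%:R + 1 + k%:R = - 1 - N + r%:R + 1 + k%:R - m%:R.
    by ring.
  by rewrite vc // Y0l scaler0.
have evA2 : evz2 (fun m j => nsum (A m j)).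
  by apply: (@evz2_add _ _ b) => m j bmj; apply: nsum0 => r; rewrite A0.
have evB2 : evz2 (fun m j => nsum (B m j)).
  by apply: (@evz2_add _ _ b) => m j bmj; apply: nsum0 => r; rewrite B0.
have expand m : gbinom (- e1 - 1) m *:
    Y (Y (a i (Negz k) u) (- 1 - N - m%:R) v) (e1 + e2 + 1 + m%:R) w =
    nsum (fun j => nsum (A m j)) + nsum (fun j => nsum (B m j)) +
    \sum_(r < R) C r m.
  have linY x w' : linear (fun p => Y p x w') := Y_linear x w'.
  pose Yl := HB.pack_for {linear V -> V} (fun p => Y p (e1 + e2 + 1 + m%:R) w)
    (GRing.isLinear.Build K V V _ _ (linY (e1 + e2 + 1 + m%:R) w)).
  rewrite Y_normal -[Y (_ + _) _ _]/(Yl (_ + _)) linearD scalerDr; congr (_ + _).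
    rewrite linear_nsum; last exact: evz_creation.
    rewrite -nsumZ; last by apply: evz_linear; apply: evz_creation.
    rewrite -nsumD; [|by case: evA2 => _; apply|by case: evB2 => _; apply].
    apply: eq_nsum => j; rewrite linearZ /= Y_normal scalerA scalerDr.
    rewrite -!nsumZ; [|exact: evz_annihilation|exact: evz_creation].
    by congr (_ + _); apply: eq_nsum => r; rewrite scalerA -mulrA.
  rewrite (@nsumE _ R) => [|r Rr]; last by rewrite vR // linear0 scaler0.
  rewrite linear_sum scaler_sumr; apply: eq_bigr => r _.
  by rewrite linearZ /= scalerA.
rewrite /iterate (eq_nsum expand) nsumD; first last.
- exact: evz_sum.
- by apply: evzD; apply: evz2_nsum.
rewrite nsumD; [|exact: evz2_nsum..].
rewrite nsum_sum //; congr (_ + _ + _).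
- rewrite (nsum_exchange3 A0 evA); apply: eq_nsum => r.
  pose Z s := Y (Y u (- 1 - N - s%:R) v) (e1 + e2 + 1 - r%:R + k%:R + s%:R) w.
  have evZ : evz Z.
    by have [c vc] := Y_trunc u v (- 1 - N); exists c => s cs; rewrite /Z vc // Y0l.
  transitivity (a i (Negz r) (nsum (fun m => nsum (fun j =>
      (gbinom (- e1 - 1) m * ('C(j, k)%:R * gbinom r%:R j)) *: Z (m + (j - k))%N)))).
    have [c Zc] := evZ.
    have ev2 : evz2 (fun m j => (gbinom (- e1 - 1) m * ('C(j, k)%:R * gbinom r%:R j)) *:
        Z (m + (j - k))%N).
      apply: (@evz2_add _ _ (c + k)) => m j cmj; rewrite Zc ?scaler0 //; lia.
    rewrite linear_nsum; last exact: evz2_nsum.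
    apply: eq_nsum => m; rewrite linear_nsum; last by case: ev2 => _; apply.
    apply: eq_nsum => j; rewrite linearZ /= /A gbinom_bin //.
    have [jk|kj] := ltnP j k; first by rewrite bin_small // mul0r mulr0 !scale0r.
    rewrite /X /Z natrD natrB //; congr (_ *: a _ _ (Y (Y _ _ _) _ _)); ring.
  rewrite nsum_taylor // linearZ /= gbinom_bin //; congr (_ *: a _ _ _).
  by apply: eq_nsum => s; congr (gbinom _ _ *: Y _ _ _); ring.
- rewrite (nsum_exchange3 B0 evB); apply: eq_nsum => r.
  pose Z s := Y (Y u (- 1 - N - s%:R) v) (e1 + r%:R + 1 + k%:R + e2 + 1 + s%:R)
    (a i (Posz r) w).
  have evZ : evz Z.
    by have [c vc] := Y_trunc u v (- 1 - N); exists c => s cs; rewrite /Z vc // Y0l.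
  transitivity (nsum (fun m => nsum (fun j => (gbinom (- e1 - 1) m *
      ('C(j, k)%:R * gbinom (- r%:R - 1) j)) *: Z (m + (j - k))%N))).
    apply: eq_nsum => m; apply: eq_nsum => j; rewrite /B.
    have [jk|kj] := ltnP j k; first by rewrite bin_small // mul0r mulr0 !scale0r.
    rewrite /X /Z natrD natrB //; congr (_ *: (Y (Y _ _ _) _ _)); ring.
  rewrite nsum_taylor //; congr (_ *: _).
  by apply: eq_nsum => s; congr (gbinom _ _ *: _); ring.
rewrite (@nsumE _ R) => [|r Rr]; last first.
  by rewrite /iterate nsum0 ?scaler0 // => m; rewrite vR // linear0 Y0l scaler0.
apply: eq_bigr => r _; rewrite /iterate -nsumZ; last first.
  have [c vc] := Y_trunc u (a i (Posz r) v) (- 1 - (N - 1 - k%:R - r%:R)).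
  by exists c => m cm; rewrite vc // Y0l scaler0.
apply: eq_nsum => m; rewrite /C scalerA (gbinom_neg charK r%:R) -natrD gbinom_bin // mulrC.
have -> : 'C(r + k, k) = 'C(k + r, r) by rewrite addnC -bin_sub ?leq_addr // addKn.
by congr (_ *: Y (Y _ _ _) _ _); ring.
Qed.

(** Moving [a^i(-k-1)] to the left of [Y(u, z0)] by the commutator formula leaves
    contractions with [u]; on the left it gives the normally ordered product. *)
Lemma iterate_right i k N e1 e2 u v w :
  iterate N e1 e2 u (a i (Negz k) v) w =
  normal_product i k (fun x => iterate N e1 x u v) e2 w -
  nsum (fun r => ((-1) ^+ r * 'C(k + r, r)%:R) *:
    iterate (N - 1 - k%:R - r%:R) e1 e2 (a i (Posz r) u) v w).
Proof.
have [R uR] := a_bound u; have [J wJ] := a_bound w.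
have [b vb] := Y_trunc u v (- 1 - N).
pose X m := Y u (- 1 - N - m%:R) v.
have X0 m : (b <= m)%N -> X m = 0 by move=> bm; rewrite /X vb.
pose A m j := (gbinom (- e1 - 1) m * 'C(j, k)%:R) *:
  a i (Negz j) (Y (X m) (e1 + e2 + 1 + m%:R - j%:R + k%:R) w).
pose B m j := (gbinom (- e1 - 1) m * gbinom (- j%:R - 1) k) *:
  Y (X m) (e1 + e2 + 1 + m%:R + j%:R + 1 + k%:R) (a i (Posz j) w).
pose C r m := (gbinom (- e1 - 1) m * gbinom (- 1 - k%:R) r) *:
  Y (Y (a i (Posz r) u) (- 1 - N - m%:R + 1 + k%:R + r%:R) v) (e1 + e2 + 1 + m%:R) w.
have evA : evz2 A.
  split=> [|m]; first by exists b => m j bm; rewrite /A X0 // Y0l linear0 scaler0.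
  have [c wc] := evz_creation i k (X m) (e1 + e2 + 1 + m%:R) w.
  by exists c => j cj; rewrite /A -scalerA wc ?scaler0.
have evB : evz2 B.
  split=> [|m]; last exact: evz_annihilation.
  by exists b => m j bm; rewrite /B X0 // Y0l scaler0.
have evC r : evz (C r).
  have [c vc] := Y_trunc (a i (Posz r) u) v (- 1 - N + 1 + k%:R + r%:R).
  exists c => m cm; rewrite /C.
  have -> : - 1 - N - m%:R + 1 + k%:R + r%:R = - 1 - N + 1 + k%:R + r%:R - m%:R.
    by ring.
  by rewrite vc // Y0l scaler0.
have expand m : gbinom (- e1 - 1) m *:
    Y (Y u (- 1 - N - m%:R) (a i (Negz k) v)) (e1 + e2 + 1 + m%:R) w =
    nsum (A m) + nsum (B m) - \sum_(r < R) C r m.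
  pose Yl := HB.pack_for {linear V -> V} (fun p => Y p (e1 + e2 + 1 + m%:R) w)
    (GRing.isLinear.Build K V V _ _ (Y_linear (e1 + e2 + 1 + m%:R) w)).
  have -> : Y u (- 1 - N - m%:R) (a i (Negz k) v) = a i (Negz k) (X m) -
      \sum_(r < R) gbinom (- 1 - k%:R) r *:
        Y (a i (Posz r) u) (- 1 - N - m%:R + 1 + k%:R + r%:R) v.
    apply/eqP; rewrite eq_sym subr_eq; apply/eqP; rewrite /X Y_comm; congr (_ + _).
    rewrite (@nsumE _ R) => [|r Rr]; last by rewrite uR // Y0l scaler0.
    apply: eq_bigr => r _; rewrite intr_Negz; congr (_ *: Y _ _ _); ring.
  rewrite -[Y (_ - _) _ _]/(Yl (_ - _)) linearB scalerBr; congr (_ - _).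
    rewrite /= Y_normal scalerDr -!nsumZ; [|exact: evz_annihilation|exact: evz_creation].
    by congr (_ + _); apply: eq_nsum => j; rewrite scalerA.
  rewrite linear_sum scaler_sumr; apply: eq_bigr => r _.
  by rewrite linearZ /= scalerA.
rewrite /iterate (eq_nsum expand) nsumB; first last.
- exact: evz_sum.
- by apply: evzD; apply: evz2_nsum.
rewrite nsumD; [|exact: evz2_nsum..].
have evX x y w' : evz (fun m => gbinom x m *: Y (X m) (y + m%:R) w').
  by exists b => m bm; rewrite X0 // Y0l scaler0.
rewrite nsum_sum //; congr (_ + _ - _).
- rewrite nsum_exchange //; apply: eq_nsum => j.
  rewrite linear_nsum; last exact: evX.
  rewrite -nsumZ; last by apply: evz_linear; apply: evX.
  apply: eq_nsum => m; rewrite linearZ /= scalerA mulrC.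
  by congr (_ *: a _ _ (Y _ _ _)); ring.
- rewrite nsum_exchange //; apply: eq_nsum => j.
  rewrite -nsumZ; last exact: evX.
  by apply: eq_nsum => m; rewrite scalerA mulrC; congr (_ *: (Y _ _ _)); ring.
rewrite (@nsumE _ R) => [|r Rr]; last first.
  by rewrite /iterate nsum0 ?scaler0 // => m; rewrite uR // !Y0l scaler0.
apply: eq_bigr => r _; rewrite /iterate -nsumZ; last first.
  have [c vc] := Y_trunc (a i (Posz r) u) v (- 1 - (N - 1 - k%:R - r%:R)).
  by exists c => m cm; rewrite vc // Y0l scaler0.
apply: eq_nsum => m; rewrite /C scalerA mulrC.
have -> : - 1 - k%:R = - k%:R - 1 :> K by ring.
rewrite (gbinom_neg charK k%:R) -natrD gbinom_bin //.
by congr (_ *: Y (Y _ _ _) _ _); ring.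
Qed.

Lemma product_linear1 N e1 e2 v w : linear (fun u => product N e1 e2 u v w).
Proof.
move=> c u u'; rewrite /product -nsumZ -?nsumD; try by do ?apply: evzZ; apply: Y_trunc2.
by apply: eq_nsum => m; rewrite Y_linear scalerDr !scalerA mulrC.
Qed.

Lemma product_linear2 N e1 e2 u w : linear (fun v => product N e1 e2 u v w).
Proof.
move=> c v v'; rewrite /product -nsumZ -?nsumD; try by do ?apply: evzZ; apply: Y_trunc2.
by apply: eq_nsum => m; rewrite Y_linear linearP scalerDr !scalerA mulrC.
Qed.

Lemma product_linear3 N e1 e2 u v : linear (product N e1 e2 u v).
Proof.
move=> c w w'; rewrite /product -nsumZ -?nsumD; try by do ?apply: evzZ; apply: Y_trunc2.
by apply: eq_nsum => m; rewrite [Y v _ _]linearP [Y u _ _]linearP scalerDr !scalerA mulrC.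
Qed.

Lemma evz_iterate N e1 e2 u v w : evz (fun m => gbinom (- e1 - 1) m *:
  Y (Y u (- 1 - N - m%:R) v) (e1 + e2 + 1 + m%:R) w).
Proof.
have [b vb] := Y_trunc u v (- 1 - N); exists b => m bm.
by rewrite vb // Y0l scaler0.
Qed.

Lemma iterate_linear1 N e1 e2 v w : linear (fun u => iterate N e1 e2 u v w).
Proof.
move=> c u u'; rewrite /iterate -nsumZ -?nsumD; try by [exact: evz_iterate|apply: evzZ; exact: evz_iterate].
by apply: eq_nsum => m; rewrite !Y_linear scalerDr !scalerA mulrC.
Qed.

Lemma iterate_linear2 N e1 e2 u w : linear (fun v => iterate N e1 e2 u v w).
Proof.
move=> c v v'; rewrite /iterate -nsumZ -?nsumD; try by [exact: evz_iterate|apply: evzZ; exact: evz_iterate].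
by apply: eq_nsum => m; rewrite linearP Y_linear scalerDr !scalerA mulrC.
Qed.

Lemma iterate_linear3 N e1 e2 u v : linear (iterate N e1 e2 u v).
Proof.
move=> c w w'; rewrite /iterate -nsumZ -?nsumD; try by [exact: evz_iterate|apply: evzZ; exact: evz_iterate].
by apply: eq_nsum => m; rewrite linearP scalerDr !scalerA mulrC.
Qed.

Lemma product_trunc1 N e1 e2 u v w : evz (fun j => product N (e1 - j%:R) e2 u v w).
Proof.
have [b wb] := Y_trunc v w e2.
have ev m : evz (fun j => sbinom N m *: Y u (e1 - N + m%:R - j%:R) (Y v (e2 - m%:R) w)).
  by apply: evzZ; apply: Y_trunc.
have [c fc] := evz_sum (index_enum 'I_b) (P := xpredT) (fun m _ => ev (nat_of_ord m)).
exists c => j cj; rewrite /product (@nsumE _ b) => [|m bm]; last first.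
  by rewrite wb // linear0 scaler0.
rewrite -[RHS](fc j cj); apply: eq_bigr => m _; congr (_ *: Y _ _ _); ring.
Qed.

Lemma product_trunc2 N e1 e2 u v w : evz (fun j => product N e1 (e2 - j%:R) u v w).
Proof.
have [b wb] := Y_trunc v w e2; exists b => j bj; apply: nsum0 => m.
have -> : e2 - j%:R - m%:R = e2 - (j + m)%:R by rewrite natrD; ring.
by rewrite wb ?linear0 ?scaler0 // (leq_trans bj) ?leq_addr.
Qed.

Lemma iterate_trunc1 N e1 e2 u v w : evz (fun j => iterate N (e1 - j%:R) e2 u v w).
Proof.
have [b vb] := Y_trunc u v (- 1 - N).
have ev m : evz (fun j => gbinom (- (e1 - j%:R) - 1) m *: Y (Y u (- 1 - N - m%:R) v)
    (e1 + e2 + 1 + m%:R - j%:R) w) by apply: evzZ; apply: Y_trunc.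
have [c fc] := evz_sum (index_enum 'I_b) (P := xpredT) (fun m _ => ev (nat_of_ord m)).
exists c => j cj; rewrite /iterate (@nsumE _ b) => [|m bm]; last first.
  by rewrite vb // Y0l scaler0.
rewrite -[RHS](fc j cj); apply: eq_bigr => m _; congr (_ *: Y _ _ _); ring.
Qed.

Lemma iterate_trunc2 N e1 e2 u v w : evz (fun j => iterate N e1 (e2 - j%:R) u v w).
Proof.
have [b vb] := Y_trunc u v (- 1 - N).
have ev m : evz (fun j => gbinom (- e1 - 1) m *: Y (Y u (- 1 - N - m%:R) v)
    (e1 + e2 + 1 + m%:R - j%:R) w) by apply: evzZ; apply: Y_trunc.
have [c fc] := evz_sum (index_enum 'I_b) (P := xpredT) (fun m _ => ev (nat_of_ord m)).
exists c => j cj; rewrite /iterate (@nsumE _ b) => [|m bm]; last first.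
  by rewrite vb // Y0l scaler0.
rewrite -[RHS](fc j cj); apply: eq_bigr => m _; congr (_ *: Y _ _ _); ring.
Qed.

Lemma truncated_product1 N e2 u v : truncated (fun x => product N x e2 u v).
Proof. by split=> x *; [apply: product_linear3 | apply: product_trunc1]. Qed.

Lemma truncated_product2 N e1 u v : truncated (fun x => product N e1 x u v).
Proof. by split=> x *; [apply: product_linear3 | apply: product_trunc2]. Qed.

Lemma truncated_iterate1 N e2 u v : truncated (fun x => iterate N x e2 u v).
Proof. by split=> x *; [apply: iterate_linear3 | apply: iterate_trunc1]. Qed.

Lemma truncated_iterate2 N e1 u v : truncated (fun x => iterate N e1 x u v).
Proof. by split=> x *; [apply: iterate_linear3 | apply: iterate_trunc2]. Qed.

(** The coefficients of the Jacobi identity in the classes of exponents where they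
    may be nonzero: [de] is [al.ga], [ka] is [- al.be], [C] is the commutator factor
    and [G] is the set of vectors over [ga]. *)
Definition borcherds (de ka C : K) (G : V -> Prop) u v :=
  forall (n p : int) e2 w, G w ->
  product (ka + n%:~R) (de + p%:~R) e2 u v w =
  (C * (-1) ^ n) *: product (ka + n%:~R) e2 (de + p%:~R) v u w +
  iterate (ka + n%:~R) (de + p%:~R) e2 u v w.

Section Borcherds.
Variables (de ka C : K) (G : V -> Prop).
Hypothesis Ga : forall i j w, G w -> G (a i (Posz j) w).
Local Notation bor := (borcherds de ka C G).

Lemma borcherdsl c u u' v : bor u v -> bor u' v -> bor (c *: u + u') v.
Proof.
move=> H H' n p e2 w Gw.
rewrite (product_linear1 _ _ _ _ _ c) (product_linear2 _ _ _ _ _ c).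
rewrite (iterate_linear1 _ _ _ _ _ c) H // H' //.
by rewrite !scalerDr !scalerA [c * _]mulrC addrACA.
Qed.

Lemma borcherdsr c u v v' : bor u v -> bor u v' -> bor u (c *: v + v').
Proof.
move=> H H' n p e2 w Gw.
rewrite (product_linear2 _ _ _ _ _ c) (product_linear1 _ _ _ _ _ c).
rewrite (iterate_linear2 _ _ _ _ _ c) H // H' //.
by rewrite !scalerDr !scalerA [c * _]mulrC addrACA.
Qed.

Let shift_exponent (n : int) (k r : nat) :
  ka + n%:~R - 1 - k%:R - r%:R = ka + (n - 1 - k%:Z - r%:Z)%:~R.
Proof. by rewrite !rmorphB /= -!pmulrn; ring. Qed.

Let shift_sign (n : int) (k r : nat) :
  (-1) ^ (n - 1 - k%:Z - r%:Z) = - ((-1) ^ n * (-1) ^+ k * (-1) ^+ r) :> K.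
Proof.
have N1 : (-1 : K) != 0 by rewrite oppr_eq0 oner_eq0.
rewrite !expfzDr // -!invr_expz expr1z -!exprnP !invr_sign invrN1; ring.
Qed.

Let abel (P Q A B D : V) : A = D - B -> P + Q + A = P - B + (Q + D).
Proof. by move=> ->; rewrite [D - B]addrC addrACA. Qed.

(** By the three expansions, the normally ordered products match by the identity
    for [(u, v)], and the contractions by the one for [(u, a^i(r) v)]: there the
    exponent [n] is lowered by [1 + k + r], which accounts for the signs. *)
Lemma borcherds_left i k u v : bor u v ->
  (forall r : nat, bor u (a i r v)) -> bor (a i (Negz k) u) v.
Proof.
move=> H Hr n p e2 w Gw; rewrite product_left product_right iterate_left.
rewrite (@normal_product_eq _ _ _ _ a_bound i k (C * (-1) ^ n)
  (fun x => product (ka + n%:~R) x e2 u v) _ _ G (de + p%:~R) w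
  (truncated_product2 (ka + n%:~R) e2 v u)
  (truncated_iterate1 (ka + n%:~R) e2 u v) (Ga i) Gw); last first.
  by move=> q w' Gw'; rewrite -addrA -rmorphD; apply: H.
have [R vR] := a_bound v.
rewrite !(@nsumE _ R); first last.
- by move=> r Rr; rewrite vR // (linear0_of (product_linear2 _ _ _ _ _)) scaler0.
- by move=> r Rr; rewrite vR // (linear0_of (product_linear1 _ _ _ _ _)) scaler0.
- by move=> r Rr; rewrite vR // (linear0_of (iterate_linear2 _ _ _ _ _)) scaler0.
rewrite scalerBr; apply: abel; rewrite scaler_sumr -sumrB; apply: eq_bigr => r _.
rewrite shift_exponent Hr // shift_sign scalerDr addrC; congr (_ + _).
rewrite !scalerA -scaleNr; congr (_ *: _).
have := sqrr_sign K k; move: ((-1) ^+ k) ((-1) ^+ r) ((-1) ^ n) 'C(_, _)%:R => x y z c xx.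
by transitivity (- x ^+ 2 * (C * z * y * c)); [ring | rewrite xx; ring].
Qed.

Lemma borcherds_right i k u v : bor u v ->
  (forall r : nat, bor (a i r u) v) -> bor u (a i (Negz k) v).
Proof.
move=> H Hr n p e2 w Gw; rewrite product_left product_right iterate_right.
rewrite (@normal_product_eq _ _ _ _ a_bound i k (C * (-1) ^ n)
  (fun x => product (ka + n%:~R) (de + p%:~R) x u v) _ _ G e2 w
  (truncated_product1 (ka + n%:~R) (de + p%:~R) v u)
  (truncated_iterate2 (ka + n%:~R) (de + p%:~R) u v) (Ga i) Gw); last first.
  by move=> q w' Gw'; apply: H.
have [R uR] := a_bound u.
rewrite !(@nsumE _ R); first last.
- by move=> r Rr; rewrite uR // (linear0_of (product_linear1 _ _ _ _ _)) scaler0.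
- by move=> r Rr; rewrite uR // (linear0_of (product_linear2 _ _ _ _ _)) scaler0.
- by move=> r Rr; rewrite uR // (linear0_of (iterate_linear1 _ _ _ _ _)) scaler0.
have abel' (P Q A B D : V) : - A = B - D -> P + Q - A = P + B + (Q - D).
  by move=> ->; rewrite addrACA.
rewrite [_ *: (_ + \sum_(_ < _) _)]scalerDr; apply: abel'; rewrite scaler_sumr -sumrB -sumrN; apply: eq_bigr => r _.
rewrite shift_exponent Hr // shift_sign scalerDr opprD; congr (_ - _).
rewrite -scalerN -scaleNr !scalerA; congr (_ *: _).
have := sqrr_sign K r; move: ((-1) ^+ k) ((-1) ^+ r) ((-1) ^ n) 'C(_, _)%:R => x y z c yy.
by transitivity (y ^+ 2 * (C * z * x * c)); [ring | rewrite yy; ring].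
Qed.

End Borcherds.

(** Vectors on which the Heisenberg algebra acts as on [e^al] and [e^be]: the
    commutator formula has a single term, so that products and iterates are
    intertwined by [a^i(n)] up to the factor [mu_i z1^n + nu_i z2^n]. *)
Section ExponentialStates.
Variables (u v : V) (mu nu : 'I_l -> K).
Hypothesis u_zero : forall i, a i (Posz 0) u = mu i *: u.
Hypothesis u_pos : forall i (k : nat), a i (Posz k.+1) u = 0.
Hypothesis v_zero : forall i, a i (Posz 0) v = nu i *: v.
Hypothesis v_pos : forall i (k : nat), a i (Posz k.+1) v = 0.

Lemma exponential_comm u' la :
  (forall i, a i (Posz 0) u' = la i *: u') -> (forall i (k : nat), a i (Posz k.+1) u' = 0) ->
  forall i n x w, a i n (Y u' x w) = Y u' x (a i n w) + la i *: Y u' (x - n%:~R) w.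
Proof.
move=> zero pos i n x w; rewrite Y_comm (@nsum1 _ 0) => [|[//|k] _].
  by rewrite gbinom0 scale1r zero addr0 YZ.
by rewrite pos Y0l scaler0.
Qed.

Lemma product_comm i n N e1 e2 w : a i n (product N e1 e2 u v w) =
  product N e1 e2 u v (a i n w) + (mu i *: product N (e1 - n%:~R) e2 u v w +
  nu i *: product N e1 (e2 - n%:~R) u v w).
Proof.
have ev x y w' : evz (fun m => sbinom N m *: Y u (x + m%:R) (Y v (y - m%:R) w')).
  by apply: evzZ; apply: Y_trunc2.
rewrite /product linear_nsum // -!nsumZ // -!nsumD; try by
  [exact: evzZ|apply: evzD; exact: evzZ|exact: ev].
apply: eq_nsum => m; rewrite linearZ /= (exponential_comm u_zero u_pos).
rewrite (exponential_comm v_zero v_pos) [Y u _ (_ + _)]linearD [Y u _ (_ *: _)]linearZ /=.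
rewrite -addrA !scalerDr !scalerA [sbinom N m * nu i]mulrC [sbinom N m * mu i]mulrC.
congr (_ + _); rewrite addrC.
by congr (_ *: Y _ _ _ + _ *: Y _ _ (Y _ _ _)); ring.
Qed.

Lemma iterate_comm i n N e1 e2 w : a i n (iterate N e1 e2 u v w) =
  iterate N e1 e2 u v (a i n w) + (mu i *: iterate N (e1 - n%:~R) e2 u v w +
  nu i *: iterate N e1 (e2 - n%:~R) u v w).
Proof.
have [b vb] := Y_trunc u v (- 1 - N).
pose X m := Y u (- 1 - N - m%:R) v.
have X0 m : (b <= m)%N -> X m = 0 by move=> bm; rewrite /X vb.
pose F m k := (gbinom (- e1 - 1) m * gbinom n%:~R k) *:
  Y (X (m + k)%N) (e1 + e2 + 1 - n%:~R + (m + k)%:R) w.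
have evF : evz2 F.
  by apply: (@evz2_add _ _ b) => m k bmk; rewrite /F X0 // Y0l scaler0.
have ev x y w' : evz (fun m => gbinom x m *: Y (X m) (y + m%:R) w').
  by exists b => m bm; rewrite X0 // Y0l scaler0.
have evm y : evz (fun m => Y (X m) (y + m%:R) w).
  by exists b => m bm; rewrite X0 // Y0l.
have step m : a i n (gbinom (- e1 - 1) m *: Y (X m) (e1 + e2 + 1 + m%:R) w) =
    gbinom (- e1 - 1) m *: Y (X m) (e1 + e2 + 1 + m%:R) (a i n w) +
    (mu i *: nsum (F m) + nu i *:
    (gbinom (- e1 - 1) m *: Y (X m) (e1 + (e2 - n%:~R) + 1 + m%:R) w)).
  rewrite linearZ /= Y_comm scalerDr; congr (_ + _).
  pose G k := gbinom n%:~R k *: Y (Y u (- 1 - N - m%:R - k%:R) v)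
    (e1 + e2 + 1 + m%:R - n%:~R + k%:R) w.
  pose P k := gbinom n%:~R k *: Y (Y u (- 1 - N - m%:R) (a i (Posz k) v))
    (e1 + e2 + 1 + m%:R - n%:~R + k%:R) w.
  have evG : evz G.
    have [c vc] := Y_trunc u v (- 1 - N - m%:R).
    by exists c => k ck; rewrite /G vc // Y0l scaler0.
  have P0 k : k != 0%N -> P k = 0.
    by case: k => // k _; rewrite /P v_pos linear0 Y0l scaler0.
  have evP : evz P by exists 1%N => -[|k] // _; apply: P0.
  transitivity (gbinom (- e1 - 1) m *: (mu i *: nsum G + nsum P)).
    congr (_ *: _); rewrite -nsumZ // -nsumD //; last exact: evzZ.
    apply: eq_nsum => k; rewrite /X (exponential_comm u_zero u_pos) addrC.
    by rewrite Y_linear scalerDr scalerA mulrC -scalerA -pmulrn.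
  rewrite scalerDr scalerA mulrC -scalerA -nsumZ //; congr (_ *: _ + _).
    apply: eq_nsum => k; rewrite /G /F /X scalerA natrD; congr (_ *: Y (Y _ _ _) _ _); ring.
  rewrite (nsum1 P0) /P gbinom0 scale1r addr0 v_zero linearZ /=.
  rewrite YZ !scalerA mulrC.
  congr (_ *: Y _ _ _); ring.
rewrite {1}/iterate linear_nsum; last exact: evz_iterate.
rewrite (eq_nsum step) nsumD; first last.
- by apply: evzD; apply: evzZ; [apply: evz2_nsum | apply: ev].
- exact: ev.
rewrite nsumD; [|by apply: evzZ; apply: evz2_nsum|by apply: evzZ; apply: ev].
rewrite !nsumZ; [|exact: ev|exact: evz2_nsum].
congr (_ + (_ *: _ + _)).
have evZ : evz (fun s => Y (X s) (e1 + e2 + 1 - n%:~R + s%:R) w) by exact: evm.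
rewrite (nsum_gbinom charK (- e1 - 1) n%:~R evZ) /iterate.
by apply: eq_nsum => s; rewrite /X; congr (gbinom _ _ *: Y _ _ _); ring.
Qed.

End ExponentialStates.

End BorcherdsTerms.

(** * Exponentials of operators *)

Section OperatorSeries.
Variables (K : fieldType) (V : lmodType K) (I : choiceType) (d : I -> K).
Hypothesis d_inj : injective d.
Implicit Types (T : I -> V -> V) (w : V).

Lemma series_at T n w : series setT d T (d n) w = T n w.
Proof.
rewrite /series (_ : [set i | _] = [set n]) ?fsbig_set1 //.
by apply/seteqP; split=> [i [_ /d_inj]|i ->].
Qed.

Lemma series_out P T e w : (forall n, e <> d n) -> series P d T e w = 0.
Proof. by move=> de; apply: fsbig1 => n [_ dn]; case: (de n). Qed.

Lemma series_setT P T w e : (forall n w, ~ P n -> T n w = 0) ->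
  series P d T e w = series setT d T e w.
Proof.
move=> T0; rewrite /series; apply: fsbig_widen => [n [_ //]|n [[_ dn] /= nP]].
by apply: T0 => Pn; apply: nP.
Qed.

Lemma scomp_series T (B : K -> V -> V) e w : (forall n, T n 0 = 0) ->
  scomp (series setT d T) B e w = \sum_(n \in [set: I]) T n (B (e - d n) w).
Proof.
move=> T0; rewrite /scomp /cauchy (@fsum_inj _ _ _ (fun n => e - d n)).
- by apply: eq_fsbigr => n _; rewrite opprB addrCA subrr addr0 series_at.
- by move=> n m /addrI /oppr_inj /d_inj.
move=> y; have [[n en] _|no] := pselect (exists n, e - y = d n).
  by exists n; rewrite -en opprB addrCA subrr addr0.
by rewrite series_out ?eqxx // => n en; apply: no; exists n.
Qed.

End OperatorSeries.

Lemma sum_triangle_swap (V : zmodType) (F : nat -> nat -> nat -> V) s :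
  \sum_(j < s) \sum_(r < j) F (s - j)%N (j - r)%N r =
  \sum_(j < s) \sum_(r < j) F (j - r)%N (s - j)%N r.
Proof.
have tri (G : nat -> nat -> V) : \sum_(j < s) \sum_(r < j) G j r =
    \sum_(r < s) \sum_(r.+1 <= j < s) G j r.
  under eq_bigr => j _ do rewrite (big_ord_widen s (G j)) ?(ltnW (ltn_ord j)) //.
  rewrite (exchange_big_dep xpredT) //=; apply: eq_bigr => r _.
  by rewrite big_geq_mkord.
rewrite (tri (fun j r => F (s - j) (j - r) r))%N (tri (fun j r => F (j - r) (s - j) r))%N.
apply: eq_bigr => r _; rewrite big_nat_rev; apply: eq_big_nat => j /andP[rj js].
by congr F; lia.
Qed.

(** The exponential of [\sum_(n > 0) b n * z^n / n], for commuting operators. *)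
Section OperatorExponential.
Variables (K : fieldType) (V : lmodType K).
Hypothesis charK : [pchar K] =i pred0.
Variable b : nat -> {linear V -> V}.
Hypothesis b_comm : forall j k w, b j.+1 (b k.+1 w) = b k.+1 (b j.+1 w).

(** The coefficient of [z^s] in the [k]-th power of the exponent. *)
Fixpoint exp_power k s w : V := if k is k'.+1
  then \sum_(j < s) (s - j)%:R^-1 *: b (s - j)%N (exp_power k' j w)
  else if s == 0%N then w else 0.

Definition exp_coef s w : V := \sum_(k < s.+1) (k`!%:R)^-1 *: exp_power k s w.

Lemma exp_power_linear k s : linear (exp_power k s).
Proof.
elim: k s => [|k IH] s c w w' /=; first by case: eqP; rewrite ?scaler0 ?addr0.
rewrite scaler_sumr -big_split; apply: eq_bigr => j _ /=.
by rewrite IH linearP scalerDr !scalerA mulrC.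
Qed.

Lemma exp_coef_linear s : linear (exp_coef s).
Proof.
move=> c w w'; rewrite /exp_coef scaler_sumr -big_split; apply: eq_bigr => k _ /=.
by rewrite exp_power_linear scalerDr !scalerA mulrC.
Qed.
HB.instance Definition _ s :=
  GRing.isLinear.Build K V V _ (exp_coef s) (exp_coef_linear s).

Lemma exp_power_small k s w : (s < k)%N -> exp_power k s w = 0.
Proof.
elim: k s => [//|k IH] s sk /=; apply: big1 => j _.
by rewrite IH ?linear0 ?scaler0 // (leq_trans (ltn_ord j)).
Qed.

(** The derivation [z d/dz], applied to a power of the exponent. *)
Lemma exp_power_deriv k s w :
  s%:R *: exp_power k.+1 s w = k.+1%:R *: \sum_(j < s) b (s - j)%N (exp_power k j w).
Proof.
elim: k s => [|k IH] s.
  rewrite /= scale1r scaler_sumr; apply: eq_bigr => -[[|j] js] _ /=.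
    by rewrite subn0 scalerA mulfV ?scale1r // (pcharf0P K).1 // -lt0n.
  by rewrite !linear0 ?scaler0.
transitivity (\sum_(j < s) (b (s - j)%N (exp_power k.+1 j w) +
    (s - j)%:R^-1 *: b (s - j)%N (j%:R *: exp_power k.+1 j w))).
  rewrite [in LHS]/exp_power -/exp_power scaler_sumr; apply: eq_bigr => j _.
  rewrite [b _ (_ *: _)]linearZ /= !scalerA -[X in _ = X + _]scale1r -scalerDl.
  have sj : (s - j)%:R != 0 :> K by rewrite (pcharf0P K).1 // subn_eq0 -ltnNge.
  have sE : s%:R = (s - j)%:R + j%:R :> K by rewrite -natrD subnK // ltnW.
  by congr (_ *: _); rewrite sE mulrDl mulfV // [j%:R / _]mulrC.
rewrite big_split /= -[in RHS]natr1 scalerDl scale1r addrC; congr (_ + _).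
under eq_bigr => j _ do rewrite IH linearZ /= scalerA mulrC -scalerA linear_sum scaler_sumr /=.
rewrite -scaler_sumr; congr (_ *: _).
rewrite (sum_triangle_swap (fun x y r => x%:R^-1 *: b x (b y (exp_power k r w)))).
apply: eq_bigr => j _; rewrite linear_sum; apply: eq_bigr => r _ /=.
rewrite linearZ /=; congr (_ *: _).
by rewrite -(subnSK (ltn_ord r)) -(subnSK (ltn_ord j)) b_comm.
Qed.

Lemma exp_coef0 w : exp_coef 0 w = w.
Proof. by rewrite /exp_coef big_ord1 /= fact0 invr1 scale1r. Qed.

(** This is [z (d/dz) exp(B) = (z (d/dz) B) exp(B)]. It determines the
    exponential, and is how its properties are verified below. *)
Lemma exp_coef_rec s w :
  s%:R *: exp_coef s w = \sum_(j < s) b (s - j)%N (exp_coef j w).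
Proof.
rewrite /exp_coef big_ord_recl scalerDr scalerA [exp_power _ _ _]/= .
have -> : s%:R / 0`!%:R *: (if s == 0%N then w else 0) = 0.
  by case: eqP => [->|_]; rewrite ?mul0r ?scale0r ?scaler0.
rewrite add0r scaler_sumr.
under eq_bigr => k _ do rewrite scalerA mulrC -scalerA exp_power_deriv scalerA.
under [in RHS]eq_bigr => j _ do rewrite (big_ord_widen s
  (fun k => (k`!%:R)^-1 *: exp_power k j w)) ?ltn_ord // big_mkcond linear_sum /=.
rewrite exchange_big /=; apply: eq_bigr => k _; rewrite scaler_sumr.
apply: eq_bigr => j _; rewrite /bump leq0n add1n factS natrM invfM mulrAC.
rewrite mulVf ?natSr_neq0 // mul1r; case: ltnP => [|jk]; first by rewrite linearZ.
by rewrite exp_power_small // !linear0 ?scaler0.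
Qed.

Lemma exp_coef_uniq w (E : nat -> V) : E 0%N = w ->
  (forall s, s%:R *: E s = \sum_(j < s) b (s - j)%N (E j)) -> forall s, E s = exp_coef s w.
Proof.
move=> E0 ES; elim/ltn_ind=> -[|s] IH; first by rewrite exp_coef0.
apply: (scalerI (natSr_neq0 charK s)); rewrite ES exp_coef_rec.
by apply: eq_bigr => j _; rewrite IH.
Qed.

(** An operator whose commutator with the exponent is [ka * z^n] satisfies
    [[X, exp] = ka * z^n * exp]. *)
Lemma exp_coef_comm (X : {linear V -> V}) n ka : (0 < n)%N ->
  (forall j w, X (b j.+1 w) = b j.+1 (X w) + (n%:R * ka *+ (j.+1 == n)) *: w) ->
  forall s w, X (exp_coef s w) =
    exp_coef s (X w) + (if (n <= s)%N then ka *: exp_coef (s - n) w else 0).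
Proof.
move=> n0 Xb s w; elim/ltn_ind: s => -[|s] IH.
  by rewrite !exp_coef0 leqNgt n0 addr0.
apply: (scalerI (natSr_neq0 charK s)).
rewrite -linearZ /= exp_coef_rec linear_sum /= scalerDr exp_coef_rec.
under eq_bigr => j _ do rewrite -(subnSK (ltn_ord j)) Xb IH // linearD /= -addrA.
rewrite big_split /=; congr (_ + _); first by apply: eq_bigr => j _; rewrite subnSK.
rewrite big_split /=; case: leqP => ns; last first.
  rewrite scaler0 big1 => [|j _]; last by rewrite leqNgt (ltn_trans (ltn_ord j)) // linear0.
  rewrite add0r big1 // => j _; rewrite subnSK //.
  by rewrite ltn_eqF ?scale0r // (leq_ltn_trans _ ns) // leq_subr.
have sn : (s.+1 - n < s.+1)%N by rewrite ltn_subrL n0.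
rewrite [X in _ + X](bigD1 (Ordinal sn)) //= subnSK // subKn // eqxx mulr1n.
rewrite [X in _ + (_ + X)]big1 => [|j jn]; last first.
  rewrite subnSK //; case: eqP => [E|_]; last by rewrite scale0r.
  by case/eqP: jn; apply: val_inj => /=; rewrite -E subKn // ltnW.
rewrite addr0 scalerA.
have -> : \sum_(j < s.+1) b (s - j).+1 (if (n <= j)%N then ka *: exp_coef (j - n) w else 0) =
    ka *: ((s.+1 - n)%:R *: exp_coef (s.+1 - n) w).
  rewrite exp_coef_rec scaler_sumr.
  have E j : (j < s.+1)%N -> (s - j).+1 = (s.+1 - j)%N by move=> js; rewrite subSn.
  under eq_bigr => j _ do rewrite E //.
  move: {E sn} (s.+1 - n)%N (subnKC ns) => m <-; rewrite big_split_ord /= big1 => [|j _].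
    rewrite add0r; apply: eq_bigr => j _; rewrite leq_addr addKn linearZ /=.
    by rewrite subnDl.
  by rewrite leqNgt ltn_ord linear0.
rewrite scalerA -scalerDl natrB //; congr (_ *: _); ring.
Qed.

Lemma exp_coef_commutes (X : {linear V -> V}) :
  (forall j w, X (b j.+1 w) = b j.+1 (X w)) ->
  forall s w, X (exp_coef s w) = exp_coef s (X w).
Proof.
move=> Xb s w; rewrite (@exp_coef_comm X 1 0) // => [|j w'].
  by rewrite scale0r if_same addr0.
by rewrite mulr0 mul0rn scale0r addr0.
Qed.

Lemma exp_coef_vac w : (forall j, b j.+1 w = 0) -> forall s, exp_coef s w = w *+ (s == 0%N).
Proof.
move=> bw s; rewrite -(exp_coef_uniq (E := fun s => w *+ (s == 0%N))) // => -[|t].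
  by rewrite big_ord0 scale0r.
rewrite scaler0 big_ord_recl big1 => [|j _]; last by rewrite linear0.
by rewrite addr0 subn0 bw.
Qed.

Section Series.
Variable sg : K.
Hypothesis sg_neq0 : sg != 0.
Let d (n : nat) : K := sg * n%:R.

Let d_inj : injective d.
Proof. by move=> n m /(mulfI sg_neq0)/eqP; rewrite natr_eq // => /eqP. Qed.

(** For the exponent to have exponents [n], the sign is [1]; for [-n] it is [-1].
    The sum over the powers [k] is finite by [exp_power_small]. *)
Lemma sexp_series e w :
  sexp (series [set n | (0 < n)%N] d (fun n w => n%:R^-1 *: b n w)) e w =
  series setT d exp_coef e w.
Proof.
pose T n w := n%:R^-1 *: b n w.
have dD m n : d (m + n)%N = d m + d n by rewrite /d natrD mulrDr.
have pow k e' w' : iter k (scomp (series [set n | (0 < n)%N] d T)) (sconst id) e' w' =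
    series setT d (exp_power k) e' w'.
  elim: k e' => [|k IH] e'.
    have d0 : d 0 = 0 by rewrite /d mulr0.
    rewrite /= /sconst; have [->|e0] := eqVneq e' 0.
      by rewrite -[in RHS]d0 series_at.
    have [[n en]|no] := pselect (exists n, e' = d n); last first.
      by rewrite series_out // => n en; apply: no; exists n.
    rewrite en series_at //; case: n en => // en.
    by rewrite en d0 eqxx in e0.
  rewrite iterS; transitivity (scomp (series setT d T)
      (iter k (scomp (series [set n | (0 < n)%N] d T)) (sconst id)) e' w').
    apply: eq_fsbigr => y _; apply: series_setT => n x /negP; rewrite -eqn0Ngt => /eqP ->.
    by rewrite /T invr0 scale0r.
  rewrite scomp_series //; last by move=> n; rewrite /T linear0 scaler0.
  under eq_fsbigr => n _ do rewrite IH.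
  have [[s es]|no] := pselect (exists s, e' = d s); last first.
    rewrite series_out => [|n en]; last by apply: no; exists n.
    apply: fsbig1 => n _; rewrite series_out ?/T ?linear0 ?scaler0 // => m em.
    by apply: no; exists (m + n)%N; rewrite dD -em subrK.
  rewrite es series_at //= -/(nsum _) (@nsumE _ s.+1) => [|n sn]; last first.
    rewrite series_out ?/T ?linear0 ?scaler0 // => m /eqP.
    rewrite subr_eq -dD => /eqP /d_inj E.
    by move: sn; rewrite E ltnNge leq_addl.
  rewrite big_ord_recl {1}/T invr0 scale0r add0r (reindex_inj rev_ord_inj) /=.
  apply: eq_bigr => j _; rewrite /bump leq0n add1n subnSK //.
  have -> : d s - d (s - j)%N = d j.
    by rewrite -[in d s](subnKC (ltnW (ltn_ord j))) dD addrK.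
  by rewrite series_at.
rewrite /sexp; under eq_fsbigr => k _ do rewrite pow.
have [[s ->]|no] := pselect (exists s, e = d s); last first.
  rewrite series_out => [|n en]; last by apply: no; exists n.
  apply: fsbig1 => k _; rewrite series_out ?scaler0 // => n en.
  by apply: no; exists n.
rewrite series_at // -/(nsum _) (@nsumE _ s.+1) => [|k sk].
  by apply: eq_bigr => k _; rewrite series_at.
by rewrite series_at // exp_power_small ?scaler0.
Qed.

End Series.

End OperatorExponential.

(** * Fields of monomials *)

Lemma fsum_int (V : zmodType) (G : int -> V) :
  evz (fun s => G (Negz s)) -> evz (fun s => G (Posz s)) ->
  \sum_(j \in [set: int]) G j = nsum (fun s => G (Negz s)) + nsum (fun s => G (Posz s)).
Proof.
move=> [B GB] [C GC]; rewrite (@nsumE _ B) // (@nsumE _ C) //.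
rewrite (@fsum_subset _ _ ([seq Negz i | i <- iota 0 B] ++ [seq Posz i | i <- iota 0 C])).
- rewrite big_cat !big_map -(big_mkord xpredT (fun s => G (Negz s))).
  by rewrite -(big_mkord xpredT (fun s => G (Posz s))) /index_iota !subn0.
- rewrite cat_uniq !map_inj_uniq ?iota_uniq ?andbT //=; first last.
  + by move=> s t [].
  + by move=> s t [].
  by apply/hasPn => _ /mapP[s _ ->]; apply/mapP => -[].
move=> [s|s]; rewrite mem_cat negb_or => /andP[sB sC].
  apply: GC; rewrite leqNgt; apply: contra sC => sC.
  by rewrite mem_map ?mem_iota // => ? ? [].
apply: GB; rewrite leqNgt; apply: contra sB => sB.
by rewrite mem_map ?mem_iota // => ? ? [].
Qed.

Lemma intr_inj_char0 (K : fieldType) : [pchar K] =i pred0 ->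
  injective (fun n : int => n%:~R : K).
Proof.
move=> charK n m /eqP; rewrite -subr_eq0 -rmorphB /= => E; apply/eqP.
rewrite -subr_eq0; case: (n - m) E => k.
  by rewrite -pmulrn (pcharf0P K).1.
by rewrite NegzE mulrNz oppr_eq0 -pmulrn (pcharf0P K).1.
Qed.

Section MonomialFields.
Variables (K : fieldType) (l : nat) (V : lmodType K).
Hypothesis charK : [pchar K] =i pred0.
Variable a : 'I_l -> int -> {linear V -> V}.
Hypothesis a_bound : forall w, exists B, forall i (k : nat), (B <= k)%N -> a i k w = 0.
Hypothesis a_comm : forall i j n m w, a i n (a j m w) =
  a j m (a i n w) + (n%:~R *+ ((n == - m) && (i == j))) *: w.
Local Notation np x := (normal_product a x.1 x.2).
Implicit Types (x y : oscillator l) (m : {cmonom (oscillator l)}) (s : seq (oscillator l)).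

Lemma npC x y A : truncated A -> np x (np y A) = np y (np x A).
Proof. by move=> At; apply/funext => e; apply/funext => w; apply: normal_productC. Qed.

Definition ordered_field s m : K -> V -> V :=
  foldr (fun x A => iter (m x) (np x) A) (sconst id) s.

Lemma truncated_vacuum : truncated (sconst id : K -> V -> V).
Proof.
split=> [e c w w'|e w]; rewrite /sconst; first by case: eqP => _; rewrite ?scaler0 ?addr0.
have [[b eb]|nb] := pselect (exists b : nat, e = b%:R); last first.
  exists 0%N => t _; case: eqP => // /eqP; rewrite subr_eq0 => /eqP et.
  by case: nb; exists t.
exists b.+1 => t bt; rewrite eb subr_eq0 natr_eq //.
by rewrite ltn_eqF.
Qed.

Lemma truncated_iter x k A : truncated A -> truncated (iter k (np x) A).
Proof. by move=> At; elim: k => //= k IH; apply: truncated_normal. Qed.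

Lemma truncated_ordered s m : truncated (ordered_field s m).
Proof.
elim: s => [|x s IH]; first exact: truncated_vacuum.
exact: truncated_iter.
Qed.

Lemma ordered_fieldM s x m : uniq s -> x \in s ->
  ordered_field s (mmul (ucm x) m) = np x (ordered_field s m).
Proof.
elim: s => // y s IH /= /andP[ys us]; rewrite in_cons => /predU1P[xy|xs].
  rewrite -xy in ys *; rewrite cmM cmUU add1n iterS; congr (np x (iter _ _ _)).
  elim: s ys {IH us} => //= z s IH; rewrite in_cons negb_or => /andP[xz xs].
  by rewrite cmM cmU (negPf xz) IH.
have xy : x != y by apply: contraNneq ys => <-.
rewrite cmM cmU (negPf xy) add0n IH //; have := truncated_ordered s m.
elim: (m y) (ordered_field s m) => //= k IHk A At.
by rewrite IHk // npC //; apply: truncated_iter.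
Qed.

(** Along any list of factors, multiplying the monomial by a variable has the same
    effect on the field, by [ordered_fieldM]. *)
Lemma ordered_field_uniq m s s' : uniq s -> uniq s' ->
  {subset finsupp m <= s} -> {subset finsupp m <= s'} ->
  ordered_field s m = ordered_field s' m.
Proof.
have field1 t : ordered_field t mone = sconst id.
  by elim: t => //= y t ->; rewrite cm1.
elim/cm_ind: m => [|x m IH] us us' ms ms'; first by rewrite !field1.
have xm : x \in finsupp (mmul (ucm x) m) by rewrite mdomD mdomU inE inE eqxx.
have sub y : y \in finsupp m -> y \in finsupp (mmul (ucm x) m).
  by move=> ym; rewrite mdomD inE ym orbT.
by rewrite !ordered_fieldM ?ms ?ms' // IH // => y /sub; [apply: ms | apply: ms'].
Qed.

(** The order of the factors in [finsupp m] is immaterial, by [npC]. *)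
Definition monomial_field m := ordered_field (finsupp m) m.

Lemma monomial_field1 : monomial_field mone = sconst id.
Proof. by rewrite /monomial_field mdom1. Qed.

Lemma monomial_fieldM x m : monomial_field (mmul (ucm x) m) = np x (monomial_field m).
Proof.
rewrite /monomial_field ordered_fieldM ?fset_uniq //; last first.
  by rewrite mdomD mdomU inE inE eqxx.
congr (np x _); apply: ordered_field_uniq; rewrite ?fset_uniq //.
by move=> y ym; rewrite mdomD inE ym orbT.
Qed.

(** The same normally ordered products in the indexing of modes,
    [B(z) = \sum_n B(n) z^(-n-1)]. *)
Definition nmul x (B : int -> V -> V) : int -> V -> V :=
  fun n w => \sum_(j \in [set: int]) gbinom (- j - 1)%:~R x.2 *:
    (let p := n - j - x.2.+1%:Z in
     if j < 0 then a x.1 j (B p w) else B p (a x.1 j w)).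

Definition mode_exponent (n : int) : K := (- n - 1)%:~R.

Definition of_modes (B : int -> V -> V) : K -> V -> V := series setT mode_exponent B.

Lemma mode_exponent_inj : injective mode_exponent.
Proof.
by move=> n m /(intr_inj_char0 charK) /addIr /oppr_inj.
Qed.

Lemma of_modesE B n w : of_modes B (mode_exponent n) w = B n w.
Proof. exact: (series_at mode_exponent_inj). Qed.

Lemma of_modes_nmul x B : truncated (of_modes B) -> of_modes (nmul x B) = np x (of_modes B).
Proof.
case: x => i k At; have [Al Ab] := At; apply/funext => e; apply/funext => w.
have E (j n : int) : mode_exponent (n - j - k.+1%:Z) = mode_exponent n + j%:~R + k.+1%:R.
  by rewrite /mode_exponent !rmorphB !rmorphN !rmorphB /= -!pmulrn; ring.
have [[n ->]|no] := pselect (exists n, e = mode_exponent n); last first.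
  rewrite /of_modes series_out => [|n en]; last by apply: no; exists n.
  have out (q : int) w' : series setT mode_exponent B (e + q%:~R) w' = 0.
    apply: series_out => n en; apply: no; exists (n + q).
    apply: (addIr q%:~R); rewrite en /mode_exponent -rmorphD /=.
    by congr _%:~R; ring.
  rewrite /normal_product !nsum0 ?addr0 // => t.
    have -> : e + t%:R + 1 + k%:R = e + (t%:Z + 1 + k%:Z)%:~R.
      by rewrite !rmorphD /= -!pmulrn; ring.
    by rewrite out scaler0.
  have -> : e - t%:R + k%:R = e + (k%:Z - t%:Z)%:~R.
    by rewrite rmorphB /= -!pmulrn; ring.
  by rewrite out linear0 scaler0.
rewrite of_modesE /nmul /=.
have creation (t : nat) : gbinom (- Negz t - 1)%:~R k *:
    (if Negz t < 0 then a i (Negz t) (B (n - Negz t - k.+1%:Z) w)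
     else B (n - Negz t - k.+1%:Z) (a i (Negz t) w)) =
    'C(t, k)%:R *: a i (Negz t) (of_modes B (mode_exponent n - t%:R + k%:R) w).
  rewrite -of_modesE E intr_Negz; congr (_ *: a _ _ (of_modes _ _ _)).
    rewrite NegzE opprK -addn1 PoszD addrK -pmulrn gbinom_bin //.
  by rewrite -natr1; ring.
have annihilation (t : nat) : gbinom (- t%:Z - 1)%:~R k *:
    (if t%:Z < 0 then a i t (B (n - t%:Z - k.+1%:Z) w)
     else B (n - t%:Z - k.+1%:Z) (a i t w)) =
    gbinom (- t%:R - 1) k *: of_modes B (mode_exponent n + t%:R + 1 + k%:R) (a i t w).
  rewrite ltz_nat ltn0 -of_modesE E -pmulrn; congr (gbinom _ _ *: of_modes _ _ _).
    by rewrite rmorphB rmorphN /= -pmulrn.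
  by rewrite -natr1; ring.
rewrite fsum_int; first by congr (_ + _); apply: eq_nsum => t.
  by apply: evz_ext creation _; apply: evz_np1.
by apply: evz_ext annihilation _; apply: evz_np2.
Qed.

Definition ordered_modes s m : int -> V -> V :=
  foldr (fun x B => iter (m x) (nmul x) B) (fun n w => if n == -1 then w else 0) s.

Lemma of_modes_ordered s m : of_modes (ordered_modes s m) = ordered_field s m.
Proof.
elim: s => [|x s IH] /=; last first.
  elim: (m x) => [//|k IHk] /=; rewrite of_modes_nmul IHk //.
  by apply: truncated_iter; apply: truncated_ordered.
apply/funext => e; apply/funext => w; rewrite /sconst.
have e0 : mode_exponent (-1) = 0 by rewrite /mode_exponent opprK subrr.
have [->|ne] := eqVneq e 0; first by rewrite -e0 of_modesE.
have [[n en]|no] := pselect (exists n, e = mode_exponent n); last first.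
  by rewrite /of_modes series_out // => n en; apply: no; exists n.
by rewrite en of_modesE; case: eqP => // n1; rewrite en n1 e0 eqxx in ne.
Qed.

End MonomialFields.

(** * Fields of states *)

Section StateFields.
Variables (K : fieldType) (l : nat) (V : lmodType K).
Variable a : 'I_l -> int -> {linear V -> V}.
Hypothesis a_bound : forall w, exists B, forall i (k : nat), (B <= k)%N -> a i k w = 0.
Hypothesis charK : [pchar K] =i pred0.
Hypothesis a_comm : forall i j n m w, a i n (a j m w) =
  a j m (a i n w) + (n%:~R *+ ((n == - m) && (i == j))) *: w.
Implicit Types (u : fock K l) (w : V).

Lemma msum_widen (G : zmodType) (I : choiceType) (f : I -> G -> V)
    (u : {malg G[I]}) (d : {fset I}) : (forall i, f i 0 = 0) -> (msupp u `<=` d)%fset ->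
  \sum_(i <- msupp u) f i u@_i = \sum_(i <- d) f i u@_i.
Proof.
move=> f0 ud; apply: big_fset_incl => // i _ iu.
by rewrite mcoeff_outdom.
Qed.

(** Enlarging the three supports to a common one reduces linearity in the
    coefficients to that of the summands. *)
Lemma msum_linear (G : zmodType) (I : choiceType) (f : I -> G -> V)
    (u v w : {malg G[I]}) (c : K) : (forall i, f i 0 = 0) ->
  (forall i, f i w@_i = c *: f i u@_i + f i v@_i) ->
  \sum_(i <- msupp w) f i w@_i =
  c *: \sum_(i <- msupp u) f i u@_i + \sum_(i <- msupp v) f i v@_i.
Proof.
move=> f0 fw; pose d := (msupp u `|` msupp v `|` msupp w)%fset.
rewrite !(@msum_widen _ _ _ _ d) // ?fsubsetUr // /d; first last.
- by rewrite -fsetUA fsubsetUl.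
- by rewrite fsetUAC fsubsetUr.
by rewrite scaler_sumr -big_split; apply: eq_bigr => i _; rewrite fw.
Qed.

Definition state_field u (e : K) w : V :=
  \sum_(m <- msupp u) u@_m *: monomial_field a m e w.

Lemma state_field_linear e w : linear (fun u => state_field u e w).
Proof.
move=> c u v; apply: (msum_linear (f := fun m x => x *: monomial_field a m e w)).
  by move=> m; rewrite scale0r.
by move=> m; rewrite fockD fockZ scalerDl scalerA.
Qed.

Lemma state_field_monomial m e w : state_field << m >> e w = monomial_field a m e w.
Proof. by rewrite /state_field msuppU1 big_seq_fset1 mcoeffUU scale1r. Qed.

Lemma truncated_state u : truncated (state_field u).
Proof.
split=> [e c w w'|e w].
  rewrite /state_field scaler_sumr -big_split; apply: eq_bigr => m _.
  have [ml _] := truncated_ordered charK a_bound (finsupp m) m.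
  by rewrite /monomial_field ml scalerDr !scalerA mulrC.
apply: evz_sum => m _; apply: evzZ.
by have [_] := truncated_ordered charK a_bound (finsupp m) m; apply.
Qed.

Lemma state_field1 : state_field 1 = sconst id.
Proof.
apply/funext => e; apply/funext => w.
by rewrite (state_field_monomial mone) monomial_field1.
Qed.

Lemma fock_linear_ext (f g : fock K l -> V) : linear f -> linear g ->
  (forall m, f << m >> = g << m >>) -> forall u, f u = g u.
Proof.
move=> fl gl fg u; rewrite (monalgE u); apply: (big_ind (fun u => f u = g u)).
- by rewrite (linear0_of fl) (linear0_of gl).
- by move=> x y fx fy; rewrite -[x]scale1r fl gl fx fy.
move=> m _; rewrite monomialZ -[_ *: _]addr0 fl gl fg.
by rewrite (linear0_of fl) (linear0_of gl).
Qed.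

Lemma state_field_var x u :
  state_field (var K x * u) = normal_product a x.1 x.2 (state_field u).
Proof.
apply/funext => e; apply/funext => w; move: u.
apply: (@fock_linear_ext (fun u => state_field (var K x * u) e w)
  (fun u => normal_product a x.1 x.2 (state_field u) e w)).
- move=> c u v; rewrite -(state_field_linear e w c); congr (state_field _ e w).
  have mulDZ (A : algType K) (p q r : A) : p * (c *: q + r) = c *: (p * q) + p * r.
    by rewrite mulrDr scalerAr.
  exact: mulDZ.
- move=> c u v; apply: (@normal_product_eq _ _ _ _ a_bound _ _ _ _ _ _ (fun _ => True)) => //.
  + exact: truncated_state.
  + exact: truncated_state.
  + by move=> p w' _; apply: state_field_linear.
move=> m; rewrite -var_monomial state_field_monomial monomial_fieldM //.
congr (normal_product _ _ _ _ e w); apply/funext => e'; apply/funext => w'.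
by rewrite state_field_monomial.
Qed.

End StateFields.

(** Conjugating fields by creation operators [E] on the left and annihilation
    operators [Z] on the right. *)
Section DressedFields.
Variables (K : fieldType) (l : nat) (V : lmodType K).
Hypothesis charK : [pchar K] =i pred0.
Variable a : 'I_l -> int -> {linear V -> V}.
Hypothesis a_bound : forall w, exists B, forall i (k : nat), (B <= k)%N -> a i k w = 0.
Variables (L : {linear V -> V}) (E : nat -> {linear V -> V}) (Z : K -> {linear V -> V}).
Hypothesis L_creation : forall i (t : nat) w, L (a i (Negz t) w) = a i (Negz t) (L w).
Hypothesis E_creation : forall s i (t : nat) w, E s (a i (Negz t) w) = a i (Negz t) (E s w).
Hypothesis Z_annihilation : forall y i (t : nat) w, Z y (a i (Posz t) w) = a i (Posz t) (Z y w).
Hypothesis Z_finite : forall w, exists r : seq K, forall y, y \notin r -> Z y w = 0.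
Implicit Types (F : K -> V -> V) (e : K) (w : V).

Definition right_dressed F e w : V := \sum_(y \in [set: K]) F (e - y) (Z y w).

Definition dressed F e w : V := L (nsum (fun s => E s (right_dressed F (e - s%:R) w))).

Lemma Z_support w : exists2 r : seq K, uniq r & forall y, y \notin r -> Z y w = 0.
Proof.
have [r Zr] := Z_finite w; exists (undup r); first exact: undup_uniq.
by move=> y; rewrite mem_undup; apply: Zr.
Qed.

Lemma right_dressedE F e w r : (forall x, linear (F x)) -> uniq r ->
  (forall y, y \notin r -> Z y w = 0) ->
  right_dressed F e w = \sum_(y <- r) F (e - y) (Z y w).
Proof.
move=> Fl ur Zr; apply: fsum_subset => // y yr.
by rewrite Zr // (linear0_of (Fl _)).
Qed.

Lemma truncated_right_dressed F : truncated F -> truncated (right_dressed F).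
Proof.
move=> [Fl Ft]; split=> [e c w w'|e w].
  have [r ur Zr] := Z_support w; have [r' ur' Zr'] := Z_support w'.
  pose q := undup (r ++ r').
  have uq : uniq q := undup_uniq _.
  have Zq y : y \notin q -> Z y w = 0 /\ Z y w' = 0.
    by rewrite mem_undup mem_cat negb_or => /andP[/Zr -> /Zr' ->].
  rewrite !(right_dressedE e Fl uq) => [|y /Zq[//]|y /Zq[//]|y /Zq[H H']]; last first.
    by rewrite linearP H H' scaler0 addr0.
  rewrite scaler_sumr -big_split; apply: eq_bigr => y _ /=.
  by rewrite linearP Fl.
have [r ur Zr] := Z_support w.
apply: evz_ext (fun m => right_dressedE (e - m%:R) Fl ur Zr) _.
apply: evz_sum => y _; apply: evz_ext _ (Ft (e - y) (Z y w)) => m.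
by congr F; ring.
Qed.

Lemma right_dressed_normal i k F : truncated F ->
  right_dressed (normal_product a i k F) = normal_product a i k (right_dressed F).
Proof.
move=> Ft; apply/funext => e; apply/funext => w.
have [Fl _] := Ft; have [r ur Zr] := Z_support w.
have [nl _] := truncated_normal a_bound i k Ft.
rewrite (right_dressedE e nl ur Zr) /normal_product big_split; congr (_ + _).
  rewrite -nsum_sum => [|y _]; last exact: evz_np1.
  apply: eq_nsum => t; rewrite (right_dressedE _ Fl ur Zr) linear_sum scaler_sumr.
  by apply: eq_bigr => y _; congr (_ *: a _ _ (F _ _)); ring.
rewrite -nsum_sum => [|y _]; last exact: (evz_np2 a_bound).
apply: eq_nsum => t; rewrite (right_dressedE _ Fl ur) => [|y yr]; last first.
  by rewrite Z_annihilation Zr // linear0.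
rewrite scaler_sumr; apply: eq_bigr => y _; rewrite Z_annihilation.
by congr (_ *: F _ _); ring.
Qed.

Lemma evz_dressed F e w : truncated F ->
  evz (fun s => E s (right_dressed F (e - s%:R) w)).
Proof.
move=> /truncated_right_dressed[_ Ft]; have [b wb] := Ft e w.
by exists b => s bs; rewrite wb // linear0.
Qed.

Lemma truncated_dressed F : truncated F -> truncated (dressed F).
Proof.
move=> Ft; have [Rl Rt] := truncated_right_dressed Ft; split=> [e c w w'|e w].
  rewrite /dressed -linearP -nsumZ; last exact: evz_dressed.
  rewrite -nsumD; [|by apply: evzZ; apply: evz_dressed|exact: evz_dressed].
  by congr (L _); apply: eq_nsum => s; rewrite Rl linearP.
have [b wb] := Rt e w; exists b => m bm; rewrite /dressed nsum0 ?linear0 // => s.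
have -> : e - m%:R - s%:R = e - (m + s)%:R by rewrite natrD; ring.
by rewrite wb ?linear0 // (leq_trans bm) ?leq_addr.
Qed.

Lemma dressed_sconst e w :
  dressed (sconst id) e w = L (nsum (fun s => E s (Z (e - s%:R) w))).
Proof.
congr (L _); apply: eq_nsum => s; congr (E s _); rewrite /right_dressed.
rewrite (@fsum1 _ _ (e - s%:R)) ?subrr /sconst ?eqxx // => y yes.
by rewrite subr_eq0 eq_sym (negPf yes).
Qed.

Lemma dressed_lin c F G H : truncated F -> truncated G -> truncated H ->
  (forall e w, H e w = c *: F e w + G e w) ->
  forall e w, dressed H e w = c *: dressed F e w + dressed G e w.
Proof.
move=> Ft Gt Ht HFG e w; rewrite /dressed -linearP; congr (L _).
rewrite -nsumZ; last exact: evz_dressed.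
rewrite -nsumD; [|by apply: evzZ; apply: evz_dressed|exact: evz_dressed].
apply: eq_nsum => s; rewrite -linearP; congr (E s _).
have [[Fl _] [Gl _] [Hl _]] := And3 Ft Gt Ht.
have [r ur zr] := Z_support w.
rewrite (right_dressedE _ Fl ur zr) (right_dressedE _ Gl ur zr) (right_dressedE _ Hl ur zr).
by rewrite scaler_sumr -big_split; apply: eq_bigr => y _; apply: HFG.
Qed.

(** In a normally ordered product the creation operators stand on the left and
    the annihilation operators on the right, so both can be moved outside. *)
Lemma dressed_normal i k F : truncated F ->
  dressed (normal_product a i k F) = normal_product a i k (dressed F).
Proof.
move=> Ft; apply/funext => e; apply/funext => w.
have Rt := truncated_right_dressed Ft; have [Rl Rb] := Rt.
rewrite /dressed (right_dressed_normal i k Ft).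
pose A s t := 'C(t, k)%:R *:
  E s (a i (Negz t) (right_dressed F (e - s%:R - t%:R + k%:R) w)).
pose B s t := gbinom (- t%:R - 1) k *:
  E s (right_dressed F (e - s%:R + t%:R + 1 + k%:R) (a i (Posz t) w)).
have evA : evz2 A.
  have [b wb] := Rb (e + k%:R) w; apply: (@evz2_add _ _ b) => s t bst; rewrite /A.
  have -> : e - s%:R - t%:R + k%:R = e + k%:R - (s + t)%:R by rewrite natrD; ring.
  by rewrite wb // !linear0 ?scaler0.
have evB : evz2 B.
  have [J wJ] := a_bound w; apply: evz2_sym; split=> [|t].
    by exists J => t s Jt; rewrite /B wJ // (linear0_of (Rl _)) linear0 scaler0.
  have [b wb] := Rb (e + t%:R + 1 + k%:R) (a i (Posz t) w).
  exists b => s bs; rewrite /B.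
  have -> : e - s%:R + t%:R + 1 + k%:R = e + t%:R + 1 + k%:R - s%:R by ring.
  by rewrite wb // linear0 scaler0.
have -> : nsum (fun s => E s (normal_product a i k (right_dressed F) (e - s%:R) w)) =
    nsum (fun t => nsum (fun s => A s t)) + nsum (fun t => nsum (fun s => B s t)).
  rewrite -(nsum_exchange evA) -(nsum_exchange evB) -nsumD; [|exact: evz2_nsum..].
  apply: eq_nsum => s; rewrite linearD; congr (_ + _).
    rewrite linear_nsum; last exact: evz_np1.
    by apply: eq_nsum => t; rewrite linearZ.
  rewrite linear_nsum; last exact: (evz_np2 a_bound).
  by apply: eq_nsum => t; rewrite linearZ.
rewrite linearD; congr (_ + _).
  rewrite linear_nsum; last exact: (evz2_nsum (evz2_sym evA)).
  apply: eq_nsum => t; rewrite nsumZ; last first.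
    have [b wb] := Rb (e - t%:R + k%:R) w; exists b => s bs.
    have -> : e - s%:R - t%:R + k%:R = e - t%:R + k%:R - s%:R by ring.
    by rewrite wb // !linear0.
  rewrite linearZ /=; congr (_ *: _); rewrite -L_creation.
  rewrite (linear_nsum (a i (Negz t))); last exact: evz_dressed.
  congr (L _); apply: eq_nsum => s; rewrite E_creation.
  by congr (a _ _ (E _ (right_dressed _ _ _))); ring.
rewrite linear_nsum; last exact: (evz2_nsum (evz2_sym evB)).
apply: eq_nsum => t; rewrite nsumZ; last first.
  have [b wb] := Rb (e + t%:R + 1 + k%:R) (a i (Posz t) w); exists b => s bs.
  have -> : e - s%:R + t%:R + 1 + k%:R = e + t%:R + 1 + k%:R - s%:R by ring.
  by rewrite wb // !linear0.
rewrite linearZ /=; congr (_ *: L _); apply: eq_nsum => s.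
by congr (E _ (right_dressed _ _ _)); ring.
Qed.

End DressedFields.

(** * The commutator formula *)

(** Creation operators preserve the commutator formula, so that it follows for all
    states from the case of lowest weight vectors. *)
Section CommutatorFormula.
Variables (K : fieldType) (l : nat) (V : lmodType K).
Hypothesis charK : [pchar K] =i pred0.
Variables (a : 'I_l -> int -> {linear V -> V}) (Y : V -> K -> {linear V -> V}).
Hypothesis Y_linear : forall x w, linear (fun u => Y u x w).
Hypothesis a_bound : forall w, exists B, forall i (k : nat), (B <= k)%N -> a i k w = 0.
Hypothesis a_comm : forall i j n m w, a i n (a j m w) =
  a j m (a i n w) + (n%:~R *+ ((n == - m) && (i == j))) *: w.
Hypothesis Y_trunc : forall u w x, evz (fun m : nat => Y u (x - m%:R) w).
Hypothesis Y_normal : forall i k u x w,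
  Y (a i (Negz k) u) x w = normal_product a i k (Y u) x w.
Implicit Types (u v w : V) (i : 'I_l) (x : K) (n : int).

Definition commutator_formula u := forall i n x w, a i n (Y u x w) = Y u x (a i n w) +
  nsum (fun k => gbinom n%:~R k *: Y (a i (Posz k) u) (x - n%:~R + k%:R) w).

Let Y0l x w : Y 0 x w = 0.
Proof. exact: (linear0_of (Y_linear x w)). Qed.

Let evz_formula i n x u w :
  evz (fun k => gbinom n%:~R k *: Y (a i (Posz k) u) (x - n%:~R + k%:R) w).
Proof.
by have [R uR] := a_bound u; exists R => r Rr; rewrite uR // Y0l scaler0.
Qed.

Lemma commutator_formulal c u v : commutator_formula u -> commutator_formula v ->
  commutator_formula (c *: u + v).
Proof.
move=> Hu Hv i n x w; rewrite !Y_linear linearP Hu Hv scalerDr addrACA; congr (_ + _).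
rewrite -nsumZ; last exact: evz_formula.
rewrite -nsumD; [|by apply: evzZ; apply: evz_formula|exact: evz_formula].
by apply: eq_nsum => k; rewrite linearP Y_linear scalerDr !scalerA mulrC.
Qed.

Lemma commutator_formula_exponential u (la : 'I_l -> K) :
  (forall i, a i (Posz 0) u = la i *: u) -> (forall i (k : nat), a i (Posz k.+1) u = 0) ->
  (forall i n x w, a i n (Y u x w) = Y u x (a i n w) + la i *: Y u (x - n%:~R) w) ->
  commutator_formula u.
Proof.
move=> zero pos H i n x w; rewrite H (@nsum1 _ 0) => [|[//|k] _].
  rewrite gbinom0 scale1r zero addr0.
  by rewrite -[la i *: u]addr0 Y_linear Y0l addr0.
by rewrite pos Y0l scaler0.
Qed.

(** The contribution of [[a^i(n), a^j(m)] = n] to the commutator with a normally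
    ordered product. *)
Lemma contraction i j n k x u w :
  nsum (fun s => ('C(s, k)%:R * (n%:~R *+ ((n == - Negz s) && (i == j)))) *:
    Y u (x - s%:R + k%:R) w) +
  nsum (fun s => (gbinom (- s%:R - 1) k * (n%:~R *+ ((n == - Posz s) && (i == j)))) *:
    Y u (x + s%:R + 1 + k%:R) w) =
  ((n%:~R * gbinom (n%:~R - 1) k) *+ (i == j)) *: Y u (x - n%:~R + k%:R + 1) w.
Proof.
case: (i == j); last first.
  by rewrite !nsum0 ?addr0 ?mulr0n ?scale0r // => s; rewrite andbF mulr0 scale0r.
case: n => [[|n]|n].
- by rewrite !nsum0 ?addr0 ?mul0r ?mul0rn ?scale0r // => s; rewrite mul0rn mulr0 scale0r.
- rewrite (@nsum1 _ n) => [|s sn]; last first.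
    rewrite NegzE opprK eqz_nat eqSS eq_sym (negPf sn) /=.
    by rewrite mulr0 scale0r.
  rewrite [X in _ + X]nsum0 => [|[|s]]; last 2 first.
  + by rewrite mulr0 scale0r.
  + by rewrite mulr0 scale0r.
  rewrite NegzE opprK eqxx !mulr1n addr0 -pmulrn -[in RHS](natr1 n) addrK gbinom_bin //.
  by rewrite mulrC natr1; congr (_ *: Y _ _ _); rewrite -natr1; ring.
rewrite nsum0 => [|s]; last first.
  by rewrite (_ : (Negz n == - Negz s) = false) // mulr0 scale0r.
rewrite (@nsum1 _ n.+1) => [|s sn]; last first.
  rewrite NegzE eqr_opp eqz_nat eq_sym (negPf sn) /=.
  by rewrite mulr0 scale0r.
have -> : Negz n == - Posz n.+1 by rewrite NegzE.
rewrite add0r !mulr1n mulrC intr_Negz -natr1.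
by congr ((_ * gbinom _ _) *: Y _ _ _); ring.
Qed.

(** The commutator of [a^i(n)] with the normally ordered product has a part from
    [u], which is the formula for [u], and the contraction with [a^j]; these are the
    two parts of [a^i(r) a^j(-k-1) u]. *)
Lemma commutator_formula_creation j k u :
  commutator_formula u -> commutator_formula (a j (Negz k) u).
Proof.
move=> H i n x w; have [R uR] := a_bound u.
have Yt v : truncated (Y v) by split=> [y|y w']; [exact: linearP | exact: Y_trunc].
pose q r : K := gbinom n%:~R r.
pose c m : K := n%:~R *+ ((n == - m) && (i == j)).
pose v r := a i (Posz r) u.
have expand y w' : a i n (Y u y w') =
    Y u y (a i n w') + \sum_(r < R) q r *: Y (v r) (y - n%:~R + r%:R) w'.
  rewrite H (@nsumE _ R) // => r Rr.
  by rewrite uR // Y0l scaler0.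
pose A1 v' y w' s := 'C(s, k)%:R *: a j (Negz s) (Y v' (y - s%:R + k%:R) w').
pose A2 v' y w' s := gbinom (- s%:R - 1) k *: Y v' (y + s%:R + 1 + k%:R) (a j (Posz s) w').
pose C1 s := ('C(s, k)%:R * c (Negz s)) *: Y u (x - s%:R + k%:R) w.
pose C2 s := (gbinom (- s%:R - 1) k * c (Posz s)) *: Y u (x + s%:R + 1 + k%:R) w.
have evA1 v' y w' : evz (A1 v' y w').
  exact: (@evz_np1 _ _ _ a (Y v')).
have evA2 v' y w' : evz (A2 v' y w').
  exact: (@evz_np2 _ _ _ a a_bound (Y v')).
have npE v' y w' : normal_product a j k (Y v') y w' = nsum (A1 v' y w') + nsum (A2 v' y w').
  by [].
have evC1 : evz C1.
  have [b wb] := Y_trunc u w (x + k%:R); exists b => s bs.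
  by rewrite /C1 addrAC wb ?scaler0.
have evC2 : evz C2.
  exists `|n|.+1 => s ns; rewrite /C2 /c.
  rewrite (_ : (n == - Posz s) = false) ?mulr0 ?scale0r //.
  by apply/eqP => E; move: ns; rewrite E abszN ltnn.
pose y r : K := x - n%:~R + r%:R.
have step1 s : a i n (A1 u x w s) = A1 u x (a i n w) s +
    \sum_(r < R) q r *: A1 (v r) (y r) w s + C1 s.
  rewrite /A1 linearZ /= a_comm scalerDr scalerA -/(c (Negz s)); congr (_ + _).
  rewrite expand linearD scalerDr linear_sum scaler_sumr; congr (_ + _).
  apply: eq_bigr => r _; rewrite [a _ _ (_ *: _)]linearZ /= !scalerA mulrC.
  by congr (_ *: a _ _ (Y _ _ _)); rewrite /y; ring.
have step2 s : a i n (A2 u x w s) = A2 u x (a i n w) s +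
    \sum_(r < R) q r *: A2 (v r) (y r) w s + C2 s.
  rewrite /A2 linearZ /= expand (a_comm i j n (Posz s)) [Y u _ (_ + _)]linearD.
  rewrite [Y u _ (_ *: _)]linearZ /= [X in _ *: X]addrAC 2!scalerDr scalerA -/(c (Posz s)); congr (_ + _ + _).
  rewrite scaler_sumr; apply: eq_bigr => r _; rewrite !scalerA mulrC.
  by congr (_ *: Y _ _ _); rewrite /y; ring.
have evB (A : V -> K -> V -> nat -> V) : (forall v' y' w', evz (A v' y' w')) ->
    evz (fun s => \sum_(r < R) q r *: A (v r) (y r) w s).
  by move=> evA; apply: evz_sum => r _; apply: evzZ.
rewrite Y_normal npE linearD !(linear_nsum (a i n)) //.
rewrite (eq_nsum step1) (eq_nsum step2).
rewrite !nsumD; try by [|apply: evB|apply: evzD; first by []; apply: evB].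
rewrite !nsum_sum; try by move=> r _; apply: evzZ.
have ctr : nsum C1 + nsum C2 = _ := contraction i j n k x u w.
rewrite addrACA ctr.
rewrite addrACA -npE -Y_normal -addrA; congr (_ + _).
have -> : \sum_(r < R) nsum (fun s => q r *: A1 (v r) (y r) w s) +
    \sum_(r < R) nsum (fun s => q r *: A2 (v r) (y r) w s) =
    nsum (fun r => q r *: Y (a j (Negz k) (v r)) (y r) w).
  rewrite (@nsumE _ R) => [|r Rr]; last by rewrite /v uR // linear0 Y0l scaler0.
  rewrite -big_split; apply: eq_bigr => r _ /=.
  by rewrite !nsumZ // -scalerDr -npE -Y_normal.
have evE : evz (fun r => q r *: Y (a j (Negz k) (v r)) (y r) w).
  by exists R => r Rr; rewrite /v uR // linear0 Y0l scaler0.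
pose D r : V := (q r * (r%:R *+ ((r == k.+1) && (i == j)))) *: Y u (y r) w.
have D0 r : r != k.+1 -> D r = 0.
  by move=> /negPf rk; rewrite /D rk mulr0 scale0r.
have <- : nsum D = (n%:~R * gbinom (n%:~R - 1) k *+ (i == j)) *: Y u (x - n%:~R + k%:R + 1) w.
  rewrite (nsum1 D0) /D eqxx /= -gbinom_absorb // /y -natr1 addrA.
  by congr (_ *: _); rewrite /q mulrnAr mulrC natr1.
rewrite -nsumD //; last by exists k.+2 => r kr; apply: D0; rewrite gtn_eqF.
apply: eq_nsum => r; rewrite a_comm [a j _ _ + _]addrC Y_linear scalerDr scalerA.
by rewrite /D NegzE opprK eqz_nat -pmulrn [RHS]addrC.
Qed.

End CommutatorFormula.

(** * The factors of the vertex operators *)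

Section TwistedOperators.
Variables (K : fieldType) (l : nat) (V : lmodType K).
Variable a : 'I_l -> int -> {linear V -> V}.
Local Notation D := (dsum V 'rV[K]_l).
Local Notation mode := (twisted_mode a).
Implicit Types (v : V) (w : D) (ga : 'rV[K]_l) (i : 'I_l) (n : int).

(** The coefficients of [z^(al(0))] are of this form. *)
Definition scalars (c : 'rV[K]_l -> K) : D -> D := blockw (fun ga v => c ga *: v).

Lemma mcoeff_scalars c w ga : (scalars c w)@_ga = c ga *: w@_ga.
Proof. by rewrite mcoeff_blockw // scaler0. Qed.

Lemma scalars_linear c : linear (scalars c).
Proof. by apply: blockw_linear => ga b u v; rewrite scalerDr !scalerA mulrC. Qed.

Lemma scalars_single c v ga : scalars c (single v ga) = c ga *: single v ga.
Proof. by rewrite /scalars blockw_single ?scaler0 // singleZ. Qed.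

Lemma scalars_mode c i n w : scalars c (mode i n w) = mode i n (scalars c w).
Proof.
apply: dsumP => ga; rewrite mcoeff_scalars !mcoeff_twisted mcoeff_scalars.
have tl := twist_linear a n i ga.
by rewrite -[c ga *: w@_ga]addr0 tl twist0 addr0.
Qed.

Lemma scalars_finite (f : 'rV[K]_l -> K) w : exists r : seq K,
  forall e, e \notin r -> scalars (fun ga => (e == f ga)%:R) w = 0.
Proof.
exists [seq f ga | ga <- msupp w] => e er; apply: dsumP => ga.
rewrite mcoeff_scalars mcoeff0; case: eqP => [ef|_]; last by rewrite scale0r.
rewrite mcoeff_outdom ?scaler0 //; apply: contra er => gw.
by rewrite ef; apply: map_f.
Qed.

(** The operator [e^al] is of this form, with weights [eps al]. *)
Fact sealed_shift : {s : 'rV[K]_l -> ('rV[K]_l -> K) -> D -> D | forall al c w,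
  \sum_(ga <- msupp w) c ga *: single w@_ga (al + ga) = s al c w}.
Proof. by exists (fun al c w => \sum_(ga <- msupp w) c ga *: single w@_ga (al + ga)). Qed.
Definition shift : 'rV[K]_l -> ('rV[K]_l -> K) -> D -> D := sval sealed_shift.

Lemma shiftE al c w : \sum_(ga <- msupp w) c ga *: single w@_ga (al + ga) = shift al c w.
Proof. exact: (svalP sealed_shift). Qed.

Lemma mcoeff_shift al c w ga : (shift al c w)@_ga = c (ga - al) *: w@_(ga - al).
Proof.
rewrite -shiftE raddf_sum /=.
have E be : (c be *: single w@_be (al + be))@_ga = c be *: w@_be *+ (be == ga - al).
  rewrite dsum_scaleE mcoeff_single [be == _]eq_sym subr_eq [be + al]addrC [ga == _]eq_sym.
  by case: eqP => // _; rewrite !mulr0n scaler0.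
under eq_bigr do rewrite E.
case: (msuppP w (ga - al)) => gw; last first.
  rewrite scaler0 big1_seq // => be /andP[_ bw]; case: eqP => // bg.
  by rewrite -bg bw in gw.
rewrite (big_fsetD1 (ga - al)) //= eqxx big1_seq ?addr0 // => be /andP[_].
by rewrite in_fsetD1 => /andP[/negPf -> _].
Qed.

Lemma shift_linear al c : linear (shift al c).
Proof.
move=> b w w'; apply: dsumP => ga.
rewrite mcoeff_shift mcoeff_dsumD dsum_scaleE [RHS]mcoeff_dsumD dsum_scaleE !mcoeff_shift.
by rewrite scalerDr !scalerA mulrC.
Qed.

Lemma shift_single al c v ga : shift al c (single v ga) = c ga *: single v (al + ga).
Proof.
apply: dsumP => be; rewrite mcoeff_shift dsum_scaleE !mcoeff_single.
rewrite [ga == _]eq_sym subr_eq [ga + al]addrC eq_sym; case: eqP => [<-|_].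
  by rewrite addrAC subrr add0r.
by rewrite !mulr0n !scaler0.
Qed.

Lemma shift_mode al c i n w : n != 0 -> shift al c (mode i n w) = mode i n (shift al c w).
Proof.
move=> n0; apply: dsumP => ga.
rewrite mcoeff_shift !mcoeff_twisted mcoeff_shift /twist (negPf n0).
by rewrite linearZ.
Qed.

Lemma shift_mode0 al c i w :
  mode i 0 (shift al c w) = shift al c (mode i 0 w) + al 0 i *: shift al c w.
Proof.
apply: dsumP => ga; rewrite mcoeff_dsumD dsum_scaleE mcoeff_twisted !mcoeff_shift mcoeff_twisted.
rewrite /twist eqxx !scalerA -scalerDl; congr (_ *: _).
rewrite !mxE; ring.
Qed.

End TwistedOperators.

(** The coefficients of [Y_-(al, z)] and of [Y_+(al, z)]. *)
Section ExponentialOperators.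
Variables (K : fieldType) (l : nat) (V : lmodType K) (I : Type) (vac : I -> V).
Hypothesis charK : [pchar K] =i pred0.
Variable a : 'I_l -> int -> {linear V -> V}.
Hypothesis a_comm : forall i j n m w, a i n (a j m w) =
  a j m (a i n w) + (n%:~R *+ ((n == - m) && (i == j))) *: w.
Hypothesis a_vac : forall i (k : nat) g, a i (Posz k.+1) (vac g) = 0.
Hypothesis a_ind : forall P : V -> Prop,
  (forall g, P (vac g)) -> (forall v v', P v -> P v' -> P (v + v')) ->
  (forall c v, P v -> P (c *: v)) ->
  (forall i k v, P v -> P (a i (Negz k) v)) -> forall v, P v.
Variable al : 'rV[K]_l.
Implicit Types (w : V) (i : 'I_l) (n m : int) (s t k : nat).

Definition lmode n w : V := \sum_i al 0 i *: a i n w.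

Lemma lmode_linear n : linear (lmode n).
Proof.
move=> c w w'; rewrite /lmode scaler_sumr -big_split; apply: eq_bigr => i _ /=.
by rewrite linearP scalerDr !scalerA mulrC.
Qed.
HB.instance Definition _ n := GRing.isLinear.Build K V V _ (lmode n) (lmode_linear n).

Lemma mode_lmode i n m w : a i n (lmode m w) =
  lmode m (a i n w) + (al 0 i * (n%:~R *+ (n == - m))) *: w.
Proof.
rewrite /lmode linear_sum /=.
under eq_bigr do rewrite linearZ /= a_comm scalerDr scalerA.
rewrite big_split /= -scaler_suml; congr (_ + _ *: _).
rewrite (bigD1 i) //= eqxx andbT big1 ?addr0 // => j /negPf ji.
by rewrite [i == j]eq_sym ji andbF mulr0.
Qed.

Lemma lmodeC n m w : n != - m -> lmode n (lmode m w) = lmode m (lmode n w).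
Proof.
move=> /negPf nm; rewrite {1}/lmode.
under eq_bigr do rewrite mode_lmode nm mulr0n mulr0 scale0r addr0.
by rewrite [lmode n w]/lmode linear_sum; apply: eq_bigr => i _; rewrite linearZ.
Qed.

Definition opp_lmode n w : V := - lmode n w.

Fact opp_lmode_linear n : linear (opp_lmode n).
Proof. by move=> c w w'; rewrite /opp_lmode linearP opprD scalerN. Qed.
HB.instance Definition _ n :=
  GRing.isLinear.Build K V V _ (opp_lmode n) (opp_lmode_linear n).

Definition minus_exponent (j : nat) : {linear V -> V} := lmode (- j%:Z).
Definition plus_exponent (j : nat) : {linear V -> V} := opp_lmode j%:Z.

Lemma minus_exponentC j k w :
  minus_exponent j.+1 (minus_exponent k.+1 w) = minus_exponent k.+1 (minus_exponent j.+1 w).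
Proof. by apply: lmodeC; rewrite opprK. Qed.

Lemma plus_exponentC j k w :
  plus_exponent j.+1 (plus_exponent k.+1 w) = plus_exponent k.+1 (plus_exponent j.+1 w).
Proof.
rewrite /plus_exponent /= /opp_lmode !linearN; congr (- - _).
exact: lmodeC.
Qed.

Definition minus_coef s : {linear V -> V} := exp_coef minus_exponent s.
Definition plus_coef t : {linear V -> V} := exp_coef plus_exponent t.

Lemma minus_creation s i t w : minus_coef s (a i (Negz t) w) = a i (Negz t) (minus_coef s w).
Proof.
apply/esym; apply: (exp_coef_commutes charK minus_exponentC) => // j w'.
rewrite /minus_exponent /= mode_lmode (_ : (Negz t == - - Posz j.+1) = false).
  by rewrite mulr0n mulr0 scale0r addr0.
by rewrite opprK.
Qed.

Lemma minus_zero s i w : minus_coef s (a i (Posz 0) w) = a i (Posz 0) (minus_coef s w).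
Proof.
apply/esym; apply: (exp_coef_commutes charK minus_exponentC) => // j w'.
by rewrite /minus_exponent /= mode_lmode mul0rn mulr0 scale0r addr0.
Qed.

Lemma minus_annihilation s i k w : a i (Posz k.+1) (minus_coef s w) =
  minus_coef s (a i (Posz k.+1) w) +
  (if (k < s)%N then al 0 i *: minus_coef (s - k.+1)%N w else 0).
Proof.
apply: (exp_coef_comm charK minus_exponentC) => // j w'; rewrite /minus_exponent /= mode_lmode opprK eqz_nat.
by rewrite [j.+1 == _]eq_sym -pmulrn mulrnAr mulrC.
Qed.

Lemma plus_annihilation t i k w : plus_coef t (a i (Posz k) w) = a i (Posz k) (plus_coef t w).
Proof.
apply/esym; apply: (exp_coef_commutes charK plus_exponentC) => // j w'.
rewrite /plus_exponent /= /opp_lmode linearN /= mode_lmode; case: k => [|k].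
  by rewrite mul0rn mulr0 scale0r addr0.
by rewrite mulr0 scale0r addr0.
Qed.

Lemma plus_creation t i k w : a i (Negz k) (plus_coef t w) =
  plus_coef t (a i (Negz k) w) +
  (if (k < t)%N then al 0 i *: plus_coef (t - k.+1)%N w else 0).
Proof.
apply: (exp_coef_comm charK plus_exponentC) => // j w'; rewrite /plus_exponent /= /opp_lmode linearN /= mode_lmode.
rewrite opprD -scaleNr NegzE eqr_opp eqz_nat [j.+1 == _]eq_sym; congr (_ + _ *: _).
by rewrite mulrNz -pmulrn mulNrn mulrN opprK mulrnAr mulrC.
Qed.

Lemma plus_vac t g : plus_coef t (vac g) = vac g *+ (t == 0%N).
Proof.
apply: (exp_coef_vac charK plus_exponentC) => // j; rewrite /plus_exponent /= /opp_lmode /lmode big1 ?oppr0 // => i _.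
by rewrite a_vac scaler0.
Qed.

(** By induction on the creation operators that produce [w]; by [plus_creation]
    each of them raises the bound. *)
Lemma evz_plus w : evz (fun t => plus_coef t w).
Proof.
elim/a_ind: w => [g|v v' ev ev'|c v ev|i k v [b vb]].
- by exists 1%N => -[|t] // _; rewrite plus_vac.
- by apply: evz_ext (fun t => linearD (plus_coef t) v v') _; apply: evzD.
- by apply: evz_ext (fun t => linearZ_LR (plus_coef t) c v) _; apply: evzZ.
exists (b + k.+1)%N => t bt.
have [kt bt' tb] : [/\ (k < t)%N, (b <= t - k.+1)%N & (b <= t)%N] by split; lia.
have := plus_creation t i k v; rewrite vb // linear0 kt vb // scaler0 addr0.
by move=> <-.
Qed.

End ExponentialOperators.

(** * Vertex operators *)

(** The Fock space [V] in the summands is kept abstract, being used only through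
    its modes; [u] ranges over polynomials in the oscillators. *)
Section VertexOperators.
Variables (K : fieldType) (l : nat) (V : lmodType K) (vac : V).
Hypothesis charK : [pchar K] =i pred0.
Variable a0 : 'I_l -> int -> {linear V -> V}.
Hypothesis a0_comm : forall i j n m v, a0 i n (a0 j m v) =
  a0 j m (a0 i n v) + (n%:~R *+ ((n == - m) && (i == j))) *: v.
Hypothesis a0_vac : forall i (k : nat), a0 i k vac = 0.
Hypothesis a0_ind : forall P : V -> Prop,
  P vac -> (forall v v', P v -> P v' -> P (v + v')) ->
  (forall c v, P v -> P (c *: v)) ->
  (forall i k v, P v -> P (a0 i (Negz k) v)) -> forall v, P v.
Local Notation D := (dsum V 'rV[K]_l).
Implicit Types (u : fock K l) (v : V) (w : D) (al ga : 'rV[K]_l) (i : 'I_l) (e y : K).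

Definition dmode i n : {linear D -> D} := twisted_mode a0 i n.

Lemma dmode_comm i j n m w : dmode i n (dmode j m w) =
  dmode j m (dmode i n w) + (n%:~R *+ ((n == - m) && (i == j))) *: w.
Proof. exact: twisted_comm. Qed.

Lemma dmode_bound w : exists B, forall i (k : nat), (B <= k)%N -> dmode i k w = 0.
Proof. exact: (twisted_bound a0_comm a0_vac a0_ind). Qed.

Lemma dmode_vac i (k : nat) ga : dmode i (Posz k.+1) (single vac ga) = 0.
Proof.
apply: etrans (twisted_single _ _ _ _ _) _; rewrite /twist /= a0_vac.
exact: single0.
Qed.

Lemma dmode_ind (P : D -> Prop) :
  (forall ga, P (single vac ga)) -> (forall w w', P w -> P w' -> P (w + w')) ->
  (forall c w, P w -> P (c *: w)) ->
  (forall i k w, P w -> P (dmode i (Negz k) w)) -> forall w, P w.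
Proof. exact: (twisted_ind a0_ind). Qed.

(** The coefficients of [z^(al(0))]. *)
Definition zpow al e : D -> D := scalars (fun ga => (e == dotp al ga)%:R).

Lemma zpow_linear al e : linear (zpow al e).
Proof. exact: scalars_linear. Qed.
HB.instance Definition _ al e := GRing.isLinear.Build K D D _ (zpow al e) (zpow_linear al e).

Lemma zpow_mode al e i n w : zpow al e (dmode i n w) = dmode i n (zpow al e w).
Proof. exact: scalars_mode. Qed.

Lemma zpow_finite al w : exists r : seq K, forall e, e \notin r -> zpow al e w = 0.
Proof. exact: scalars_finite. Qed.

Local Notation plus al := (plus_coef dmode al).
Local Notation minus al := (minus_coef dmode al).

Let evz_plus al w : evz (fun t => plus al t w).
Proof. exact: (evz_plus charK dmode_comm dmode_vac dmode_ind). Qed.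

Lemma plus_zpow_bound al w : exists B, forall t e, (B <= t)%N -> plus al t (zpow al e w) = 0.
Proof.
have [r zr] := zpow_finite al w.
have [B wB] : exists B, forall t e, (B <= t)%N -> e \in r -> plus al t (zpow al e w) = 0.
  elim: r {zr} => [|e r [B IH]]; first by exists 0%N.
  have [C wC] := evz_plus al (zpow al e w); exists (maxn B C) => t x.
  rewrite geq_max in_cons => /andP[Bt Ct] /predU1P[->|]; [exact: wC | exact: IH].
exists B => t e Bt; have [er|er] := boolP (e \in r); first exact: wB.
by rewrite zr // linear0.
Qed.

(** The coefficients of [Y_+(al, z) z^(al(0))]. *)
Definition right_factor al y w : D := nsum (fun t => plus al t (zpow al (y + t%:R) w)).

Lemma evz_right al y w : evz (fun t => plus al t (zpow al (y + t%:R) w)).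
Proof. by have [B wB] := plus_zpow_bound al w; exists B => t Bt; apply: wB. Qed.

Lemma right_factor_linear al y : linear (right_factor al y).
Proof.
move=> c w w'; rewrite /right_factor -nsumZ; last exact: evz_right.
rewrite -nsumD; [|by apply: evzZ; apply: evz_right|exact: evz_right].
by apply: eq_nsum => t; rewrite zpow_linear linearP.
Qed.
Definition right_op al y : {linear D -> D} := HB.pack_for {linear D -> D}
  (right_factor al y) (GRing.isLinear.Build K D D _ _ (right_factor_linear al y)).

(** Only finitely many exponents occur in [z^(al(0)) w], and [Y_+(al, z)] raises
    them by integers that are bounded on each vector. *)
Lemma right_factor_finite al w :
  exists r : seq K, forall y, y \notin r -> right_op al y w = 0.
Proof.
have [r zr] := zpow_finite al w; have [B wB] := plus_zpow_bound al w.
exists [seq e - t%:R | e <- r, t <- iota 0 B] => y yr; apply: nsum0 => t.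
have [Bt|tB] := leqP B t; first exact: wB.
rewrite zr ?linear0 //; apply: contra yr => yr; apply/allpairsP.
by exists (y + t%:R, t); rewrite yr mem_iota tB addrK.
Qed.

Lemma right_annihilation al y i (k : nat) w :
  right_op al y (dmode i k w) = dmode i k (right_op al y w).
Proof.
rewrite /right_op /= /right_factor (linear_nsum (dmode i k)); last exact: evz_right.
by apply: eq_nsum => t; rewrite zpow_mode (plus_annihilation charK dmode_comm).
Qed.

Lemma right_creation al y i k w : dmode i (Negz k) (right_op al y w) =
  right_op al y (dmode i (Negz k) w) + al 0 i *: right_op al (y + k.+1%:R) w.
Proof.
rewrite /right_op /= /right_factor linear_nsum; last exact: evz_right.
pose F t := if (k < t)%N then al 0 i *: plus al (t - k.+1)%N (zpow al (y + t%:R) w) else 0.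
have [B wB] := plus_zpow_bound al w.
have evF : evz F.
  exists (B + k.+1)%N => t Bt; rewrite /F; case: ifP => // _.
  by rewrite wB ?scaler0 //; lia.
transitivity (nsum (fun t => plus al t (zpow al (y + t%:R) (dmode i (Negz k) w)) + F t)).
  by apply: eq_nsum => t; rewrite zpow_mode (plus_creation charK dmode_comm).
rewrite nsumD //; last exact: evz_right.
congr (_ + _); rewrite (@nsum_shift _ k.+1) => [|t tk]; last by rewrite /F leqNgt tk.
rewrite -nsumZ; last exact: evz_right.
by apply: eq_nsum => t; rewrite /F leq_addr addKn natrD addrA.
Qed.

Variable eps : 'rV[K]_l -> 'rV[K]_l -> K.

Definition left_factor al : D -> D := shift al (eps al).
HB.instance Definition _ al :=
  GRing.isLinear.Build K D D _ (left_factor al) (shift_linear al (eps al)).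

(** The coefficients of [e^al Y_-(al, z) Y(u, z) Y_+(al, z) z^(al(0))]. *)
Definition vop al u : K -> D -> D :=
  dressed (left_factor al) (minus al) (right_op al) (state_field dmode u).

Let state_truncated u : truncated (state_field dmode u).
Proof. exact: (truncated_state dmode_bound charK). Qed.

Lemma truncated_vop al u : truncated (vop al u).
Proof. exact: (truncated_dressed (left_factor al) (minus al) (right_factor_finite al)). Qed.

Lemma vop_linear1 al e w : linear (fun u => vop al u e w).
Proof.
move=> c u u'; apply: (dressed_lin _ _ (right_factor_finite al)); try exact: state_truncated.
by move=> x w'; apply: state_field_linear.
Qed.

Lemma vop_var al x u : vop al (var K x * u) = normal_product dmode x.1 x.2 (vop al u).
Proof.
rewrite /vop (state_field_var dmode_bound charK dmode_comm).
apply: (dressed_normal dmode_bound) => //.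
- by move=> i t w; apply: shift_mode.
- by move=> s i t w; apply: (minus_creation charK dmode_comm).
- by move=> y i t w; apply: right_annihilation.
- exact: right_factor_finite.
Qed.

Lemma vop1E al e w : vop al 1 e w =
  left_factor al (nsum (fun s => minus al s (right_op al (e - s%:R) w))).
Proof.
have S : state_field dmode (1 : fock K l) = sconst id := state_field1 _.
by rewrite /vop S; exact: dressed_sconst.
Qed.

Lemma evz_vop1 al e w : evz (fun s => minus al s (right_op al (e - s%:R) w)).
Proof.
have [r zr] := right_factor_finite al w.
have [B rB] : exists B : nat, forall s : nat, (B <= s)%N -> e - s%:R \notin r.
  elim: r {zr} => [|x r [B IH]]; first by exists 0%N.
  have [[b xb]|no] := pselect (exists b : nat, e - b%:R = x).
    exists (maxn B b.+1) => s; rewrite geq_max => /andP[Bs bs].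
    rewrite in_cons negb_or IH // andbT -xb (inj_eq (addrI _)) eqr_opp natr_eq //.
    by rewrite gtn_eqF.
  exists B => s Bs; rewrite in_cons negb_or IH // andbT.
  by apply/eqP => es; apply: no; exists s.
by exists B => s Bs; rewrite zr ?linear0 // rB.
Qed.

(** The factor that fails to commute with [a^i(n)] is [e^al] for [n = 0],
    [Y_-(al, z)] for [n > 0] and [Y_+(al, z)] for [n < 0]. *)
Lemma vop1_comm al i n e w : dmode i n (vop al 1 e w) =
  vop al 1 e (dmode i n w) + al 0 i *: vop al 1 (e - n%:~R) w.
Proof.
rewrite !vop1E; case: n => [[|k]|k].
- rewrite [LHS](shift_mode0 a0) subr0; congr (_ + _).
  congr (left_factor al _); apply: etrans (linear_nsum (dmode i 0) _) _.
    exact: evz_vop1.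
  apply: eq_nsum => s; rewrite right_annihilation.
  by apply/esym; apply: (minus_zero charK dmode_comm).
- apply: etrans (esym (shift_mode a0 _ _ _ _ _)) _ => //.
  rewrite -[X in _ = _ + X]linearZ -linearD; congr (left_factor al _).
  apply: etrans (linear_nsum (dmode i k.+1) _) _; first exact: evz_vop1.
  pose F s := if (k < s)%N
    then al 0 i *: minus al (s - k.+1)%N (right_op al (e - s%:R) w) else 0.
  have FE s : F (k.+1 + s)%N =
      al 0 i *: minus al s (right_op al (e - k.+1%:R - s%:R) w).
    by rewrite /F leq_addr addKn natrD opprD addrA.
  have evF : evz F.
    have [B wB] := evz_vop1 al (e - k.+1%:R) w; exists (k.+1 + B)%N => s ks.
    by rewrite -(subnKC (leq_trans (leq_addr _ _) ks)) FE wB ?scaler0 //; lia.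
  transitivity (nsum (fun s => minus al s (right_op al (e - s%:R) (dmode i k.+1 w)) + F s)).
    apply: eq_nsum => s; rewrite (right_annihilation al _ i k.+1).
    exact: (minus_annihilation charK dmode_comm).
  rewrite nsumD //; last exact: evz_vop1.
  congr (_ + _); rewrite (@nsum_shift _ k.+1) => [|s sk]; last by rewrite /F leqNgt sk.
  rewrite -nsumZ; last exact: evz_vop1.
  by apply: eq_nsum => s; rewrite FE -pmulrn.
apply: etrans (esym (shift_mode a0 _ _ _ _ _)) _ => //.
rewrite -[X in _ = _ + X]linearZ -linearD; congr (left_factor al _).
apply: etrans (linear_nsum (dmode i (Negz k)) _) _; first exact: evz_vop1.
rewrite -nsumZ; last exact: evz_vop1.
rewrite -nsumD; [|exact: evz_vop1|by apply: evzZ; apply: evz_vop1].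
apply: eq_nsum => s; rewrite -(minus_creation charK dmode_comm) right_creation.
apply: etrans (linearD (minus al s) _ _) _; apply: (congr1 (+%R _)).
apply: etrans (linearZ_LR (minus al s) _ _) _.
apply: (congr1 (fun x => al 0 i *: minus al s (right_op al x w))).
by rewrite intr_Negz -natr1; ring.
Qed.

End VertexOperators.

(** * The Jacobi identity for the states [e^al] *)

Section BinomialIdentities.
Variable K : fieldType.
Hypothesis charK : [pchar K] =i pred0.

Lemma sbinomS (x : K) m : m.+1%:R * sbinom x m.+1 = (m%:R - x) * sbinom x m.
Proof.
rewrite /sbinom exprS mulrCA gbinomS //; ring.
Qed.

Lemma sbinom_sum (x : K) t : - x * \sum_(j < t) sbinom x j = t%:R * sbinom x t.
Proof.
elim: t => [|t IH]; first by rewrite big_ord0 mulr0 mul0r.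
by rewrite big_ord_recr /= mulrDr IH sbinomS //; ring.
Qed.

(** The coefficient of [t^p] in [(1 - t)^x]. *)
Definition zbinom (x : K) (p : int) : K := if p is Posz p then sbinom x p else 0.

(** The difference of the expansions of [(z1 - z2)^n] in powers of [z2 / z1] and
    of [z1 / z2] is zero for [n >= 0], and for [n = -1 - s] it is the [s]-th divided
    derivative of a delta function, whose coefficients are the last term. *)
Lemma jacobi_constant (n p : int) : zbinom n%:~R (n - p) =
  (-1) ^ n * zbinom n%:~R p + (if n is Negz s then gbinom (- p%:~R - 1) s else 0).
Proof.
case: n => [n|s]; case: p => [p|p].
- rewrite addr0 -!pmulrn; have [pn|np] := leqP p n.
    rewrite subzn //= /sbinom !gbinom_bin // bin_sub // mulrA -exprnP -exprD.
    rewrite -signr_odd -[in RHS]signr_odd oddB // oddD.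
    by rewrite [in LHS]addbC [in RHS]addbC.
  have -> : n%:Z - p%:Z = Negz (p - n.+1) by lia.
  by rewrite /= /sbinom gbinom_bin // bin_small // !mulr0.
- rewrite [zbinom _ (Negz p)]/= mulr0 !addr0 -!pmulrn.
  have -> : n%:Z - Negz p = (n + p.+1)%N by lia.
  by rewrite /= /sbinom gbinom_bin // bin_small ?mulr0 //; lia.
- have -> : Negz s - p%:Z = Negz (s + p) by lia.
  rewrite /= intr_Negz -[- 1 - s%:R]addrC sbinom_negn // -pmulrn gbinom_neg //.
  have -> : (-1) ^ Negz s = - (-1) ^+ s :> K by rewrite /exprz -exprVn invrN1 exprS mulN1r.
  rewrite -natrD gbinom_bin // mulNr -bin_sub ?leq_addl // addnK addnC.
  by rewrite addNr.
rewrite [zbinom _ (Negz p)]/= mulr0 add0r !intr_Negz.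
have -> : - (- 1 - p%:R) - 1 = p%:R :> K by ring.
rewrite gbinom_bin //; have [sp|ps] := leqP s p.
  have -> : Negz s - Negz p = (p - s)%N by lia.
  rewrite /= (addrC (- 1) (- s%:R)) sbinom_negn //.
  by rewrite subnKC // bin_sub.
have -> : Negz s - Negz p = Negz (s - p.+1) by lia.
by rewrite bin_small.
Qed.

End BinomialIdentities.

Section ModuleIdentities.
Variables (K : fieldType) (l : nat) (V : lmodType K).

Lemma linearD_of (f : V -> V) u v : linear f -> f (u + v) = f u + f v.
Proof. by move=> fl; rewrite -[u]scale1r fl !scale1r. Qed.

Lemma linearZ_of (f : V -> V) c u : linear f -> f (c *: u) = c *: f u.
Proof. by move=> fl; rewrite -[c *: u]addr0 fl (linear0_of fl) addr0. Qed.
Hypothesis charK : [pchar K] =i pred0.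
Implicit Types (w : V) (al be : 'rV[K]_l) (b : bool).

Lemma opp_dotp_sum al be w b :
  - (\sum_i al 0 i *: (if b then be 0 i *: w else 0)) = if b then - dotp al be *: w else 0.
Proof.
case: b; last by rewrite big1 ?oppr0 // => i _; rewrite scaler0.
rewrite scaleNr /dotp scaler_suml; congr (- _).
by apply: eq_bigr => i _; rewrite scalerA.
Qed.

Lemma sbinom_sum_if (x : K) t b w : t%:R *: (if b then sbinom x t *: w else 0) =
  \sum_(j < t) (if b then (- x * sbinom x j) *: w else 0).
Proof.
case: b; last by rewrite scaler0 big1.
by rewrite scalerA -sbinom_sum // -scaler_suml mulr_sumr.
Qed.

Lemma scale_if b (c c' : K) w :
  c *: (if b then c' *: w else 0) = if b then (c' * c) *: w else 0.
Proof. by case: b; rewrite ?scaler0 // scalerA mulrC. Qed.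

Lemma linear_defect (f : {linear V -> V}) (c a b : K) (P P0 P1 P2 Q Q0 Q1 Q2 R R0 R1 R2 : V) :
  f P0 = P + (a *: P1 + b *: P2) -> f Q0 = Q + (b *: Q2 + a *: Q1) ->
  f R0 = R + (a *: R1 + b *: R2) -> f (P0 - (c *: Q0 + R0)) =
  P - (c *: Q + R) + (a *: (P1 - (c *: Q1 + R1)) + b *: (P2 - (c *: Q2 + R2))).
Proof.
move=> fP fQ fR; rewrite linearB linearD linearZ_LR fP fQ fR.
rewrite scalerDr (addrACA (c *: Q)) opprD addrACA; congr (_ + _).
rewrite scalerDr !scalerA [c * b]mulrC [c * a]mulrC [_ *: Q2 + _]addrC addrACA opprD addrACA.
by rewrite !scalerBr !scalerDr !scalerA.
Qed.
Lemma defect_linear_eq (b c : K) (P P1 P2 Q Q1 Q2 R R1 R2 : V) :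
  P = c *: P1 + P2 -> Q = c *: Q1 + Q2 -> R = c *: R1 + R2 ->
  P - (b *: Q + R) = c *: (P1 - (b *: Q1 + R1)) + (P2 - (b *: Q2 + R2)).
Proof.
move=> -> -> ->; rewrite [b *: (_ + _)]scalerDr !scalerA [b * c]mulrC.
by rewrite (addrACA _ (b *: Q2)) opprD addrACA scalerBr scalerDr scalerA.
Qed.

Lemma mcoeff_combination (I : choiceType) (a b : K) (x y : dsum V I) i :
  (a *: x + b *: y)@_i = a *: x@_i + b *: y@_i.
Proof. by rewrite mcoeff_dsumD !dsum_scaleE. Qed.

End ModuleIdentities.

Section ExponentialJacobi.
Variables (K : fieldType) (l : nat) (V : lmodType K) (vac : V).
Hypothesis charK : [pchar K] =i pred0.
Variable a0 : 'I_l -> int -> {linear V -> V}.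
Hypothesis a0_comm : forall i j n m v, a0 i n (a0 j m v) =
  a0 j m (a0 i n v) + (n%:~R *+ ((n == - m) && (i == j))) *: v.
Hypothesis a0_vac : forall i (k : nat), a0 i k vac = 0.
Hypothesis a0_ind : forall P : V -> Prop,
  P vac -> (forall v v', P v -> P v' -> P (v + v')) ->
  (forall c v, P v -> P (c *: v)) ->
  (forall i k v, P v -> P (a0 i (Negz k) v)) -> forall v, P v.
(** The coefficient of the vacuum. For polynomials the last hypothesis expresses
    that a family closed under derivations is determined by its constant terms. *)
Variable ct : {linear V -> K^o}.
Hypothesis ct_vac : ct vac = 1.
Hypothesis ct_creation : forall i k v, ct (a0 i (Negz k) v) = 0.
Hypothesis ct_detect : forall (X : Type) (T : X -> V),
  (forall x i (k : nat), exists x1 x2 c1 c2,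
    a0 i (Posz k.+1) (T x) = c1 *: T x1 + c2 *: T x2) ->
  (forall x, ct (T x) = 0) -> forall x, T x = 0.

Local Notation D := (dsum V 'rV[K]_l).
Local Notation mode := (dmode a0).
Local Notation minus al := (minus_coef mode al).
Local Notation plus al := (plus_coef mode al).
Local Notation ket := (single vac).
Variable eps : 'rV[K]_l -> 'rV[K]_l -> K.
Implicit Types (v : V) (u w : D) (al be ga de : 'rV[K]_l) (i : 'I_l) (e x y : K).

Variable Y : D -> K -> {linear D -> D}.
Hypothesis Y_linear : forall x w, linear (fun u => Y u x w).
Hypothesis Y_trunc : forall u w x, evz (fun m : nat => Y u (x - m%:R) w).
Hypothesis Y_comm : forall i n u x w, mode i n (Y u x w) = Y u x (mode i n w) +
  nsum (fun k => gbinom n%:~R k *: Y (mode i (Posz k) u) (x - n%:~R + k%:R) w).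
Hypothesis Y_normal : forall i k u x w,
  Y (mode i (Negz k) u) x w = normal_product mode i k (Y u) x w.
Hypothesis Y_ket : forall al e w, Y (ket al) e w = left_factor eps al
  (nsum (fun s => minus al s (right_factor a0 al (e - s%:R) w))).

Let mode_comm := dmode_comm a0_comm.
Let mode_bound := dmode_bound a0_comm a0_vac a0_ind.

Lemma mode_ket i (k : nat) ga : mode i (Posz k.+1) (ket ga) = 0.
Proof. exact: dmode_vac. Qed.

Lemma mode_ket0 i ga : mode i (Posz 0) (ket ga) = ga 0 i *: ket ga.
Proof. by apply: etrans (twisted_single _ _ _ _ _) _; exact: singleZ. Qed.

Lemma minus_exponentE al (j : nat) w :
  minus_exponent mode al j w = \sum_i al 0 i *: mode i (- j%:Z) w.
Proof. by []. Qed.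

Lemma plus_exponentE al (j : nat) w :
  plus_exponent mode al j w = - \sum_i al 0 i *: mode i j w.
Proof. by []. Qed.

(** The coefficient of [e^de], a vacuum expectation value. *)
Definition vev de (w : D) : K^o := ct w@_de.

Fact vev_linear de : linear (vev de).
Proof. by move=> c w w'; rewrite /vev mcoeff_dsumD dsum_scaleE linearP. Qed.
HB.instance Definition _ de := GRing.isLinear.Build K D K^o _ (vev de) (vev_linear de).

Lemma vevD de w w' : vev de (w + w') = vev de w + vev de w'.
Proof. exact: linearD. Qed.

Lemma vevZ de c w : vev de (c *: w) = c * vev de w.
Proof. exact: linearZ_LR. Qed.

Lemma vev_sum de I (r : seq I) F : vev de (\sum_(i <- r) F i) = \sum_(i <- r) vev de (F i).
Proof. exact: linear_sum. Qed.

Lemma vev_combination de c w1 w2 w3 :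
  vev de (w1 - (c *: w2 + w3)) = vev de w1 - (c * vev de w2 + vev de w3).
Proof.
apply: etrans (linearB (vev de) w1 (c *: w2 + w3)) _.
apply: (congr1 (fun x => vev de w1 - x)); apply: etrans (vevD de (c *: w2) w3) _.
by rewrite vevZ.
Qed.

Lemma vev_nsum de F : evz F -> vev de (nsum F) = nsum (fun m => vev de (F m)).
Proof. exact: linear_nsum. Qed.

Lemma vev_creation de i k w : vev de (mode i (Negz k) w) = 0.
Proof. by rewrite /vev mcoeff_twisted; exact: ct_creation. Qed.

Lemma vev_ket de ga : vev de (ket ga) = (ga == de)%:R.
Proof.
rewrite /vev mcoeff_single; case: eqP => _; first exact: ct_vac.
by rewrite mulr0n linear0.
Qed.

Lemma vev_shift de al c w : vev de (shift al c w) = c (de - al) * vev (de - al) w.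
Proof. by rewrite /vev mcoeff_shift linearZ_LR. Qed.

Lemma vev_minus de al s w : vev de (minus al s w) = vev de w *+ (s == 0%N).
Proof.
case: s => [|s]; first by rewrite /minus_coef /= exp_coef0.
apply: (mulfI (natSr_neq0 charK s)).
have := congr1 (vev de) (exp_coef_rec charK (minus_exponentC mode_comm al) s.+1 w).
rewrite vevZ => ->; rewrite mulr0n mulr0 vev_sum big1 // => j _.
rewrite minus_exponentE vev_sum big1 // => i _.
have -> : - (s.+1 - j)%:Z = Negz (s - j) by rewrite subSn // -ltnS ltn_ord.
by rewrite vevZ vev_creation mulr0.
Qed.

Lemma shift_minus be c al s w :
  shift be c (minus al s w) = minus al s (shift be c w).
Proof.
pose X : {linear D -> D} := HB.pack_for {linear D -> D} (shift be c : D -> D)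
  (GRing.isLinear.Build K D D _ _ (shift_linear be c)).
apply: (exp_coef_commutes charK (minus_exponentC mode_comm al) (X := X)) => j w'.
rewrite !minus_exponentE linear_sum; apply: eq_bigr => i _.
by rewrite linearZ; congr (_ *: _); apply: shift_mode.
Qed.

Lemma zpow_minus be y al s w :
  zpow be y (minus al s w) = minus al s (zpow be y w).
Proof.
apply: (exp_coef_commutes charK (minus_exponentC mode_comm al) (X := zpow be y)) => j w'.
rewrite !minus_exponentE linear_sum; apply: eq_bigr => i _.
by rewrite linearZ; congr (_ *: _); apply: zpow_mode.
Qed.

Lemma zpow_ket al e ga : zpow al e (ket ga) = (e == dotp al ga)%:R *: ket ga.
Proof. exact: scalars_single. Qed.

Lemma right_ket al y ga : right_factor a0 al y (ket ga) = (y == dotp al ga)%:R *: ket ga.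
Proof.
rewrite /right_factor (@nsum1 _ 0%N) => [|t /negPf t0].
  by rewrite addr0 zpow_ket linearZ /= (plus_vac charK mode_comm mode_ket).
by rewrite zpow_ket linearZ /= (plus_vac charK mode_comm mode_ket) t0 mulr0n scaler0.
Qed.

(** The contraction of [Y_+(al, z1)] with [Y_-(be, z2)] is [(1 - z2/z1)^(al.be)]:
    the right side satisfies the recursion of the exponential. *)
Lemma plus_minus_ket al be t q ga : plus al t (minus be q (ket ga)) =
  if (t <= q)%N then sbinom (dotp al be) t *: minus be (q - t)%N (ket ga) else 0.
Proof.
pose E t := if (t <= q)%N then sbinom (dotp al be) t *: minus be (q - t)%N (ket ga) else 0.
apply/esym; move: t; apply: (exp_coef_uniq charK (plus_exponentC mode_comm al) (E := E)) => [|t].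
  by rewrite /E leq0n sbinom0 scale1r subn0.
have lE j s : plus_exponent mode al j.+1 (minus be s (ket ga)) =
    if (j < s)%N then - dotp al be *: minus be (s - j.+1)%N (ket ga) else 0.
  rewrite plus_exponentE.
  under eq_bigr do rewrite (minus_annihilation charK mode_comm) mode_ket linear0 add0r.
  exact: opp_dotp_sum.
transitivity (\sum_(j < t) (if (t <= q)%N
    then (- dotp al be * sbinom (dotp al be) j) *: minus be (q - t)%N (ket ga) else 0)).
  exact: sbinom_sum_if.
apply: eq_bigr => -[j jt] _ /=; rewrite /E.
have [jq|qj] := leqP j q; last first.
  by rewrite linear0 leqNgt (ltn_trans qj jt).
rewrite linearZ_LR -(subnSK jt) lE.
have -> : (t - j.+1 < q - j)%N = (t <= q)%N by lia.
have -> : (q - j - (t - j.+1).+1)%N = (q - t)%N by lia.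
exact: (esym (scale_if _ _ _ _)).
Qed.

(** On [e^ga] the factor [Y_+(al, z) z^(al(0))] is the scalar [z^(al.ga)]. *)
Lemma Y_ket_at al ga q : Y (ket al) (dotp al ga + q%:R) (ket ga) =
  eps al ga *: minus al q (ket (al + ga)).
Proof.
rewrite Y_ket (@nsum1 _ q) => [|s sq].
  by rewrite addrK right_ket eqxx scale1r /left_factor shift_minus shift_single linearZ_LR.
rewrite right_ket; case: eqP => [/eqP|_]; last by rewrite scale0r linear0.
by rewrite -addrA eq_sym addrC -subr_eq subrr eq_sym subr_eq0 natr_eq // eq_sym (negPf sq).
Qed.

Lemma Y_ket_out al ga y : (forall q, y != dotp al ga + q%:R) -> Y (ket al) y (ket ga) = 0.
Proof.
move=> yq; rewrite Y_ket nsum0 => [|s]; first exact: (linear0 (left_factor eps al)).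
by rewrite right_ket subr_eq (negPf (yq s)) scale0r linear0.
Qed.

Lemma vev_Y_minus de al be ga x q :
  vev de (Y (ket al) x (minus be q (ket ga))) =
  ((x + q%:R == dotp al ga) && (al + ga == de))%:R * (eps al ga * sbinom (dotp al be) q).
Proof.
rewrite Y_ket; set F := fun s => _; have evF : evz F.
  exact: (@evz_vop1 _ _ _ _ charK _ a0_comm a0_vac a0_ind).
rewrite /left_factor vev_shift vev_nsum // (@nsum1 _ 0%N) => [|s /negPf s0]; last first.
  by rewrite /F vev_minus s0.
rewrite /F vev_minus mulr0n subr0 /right_factor vev_nsum; last first.
  exact: (@evz_right _ _ _ _ charK _ a0_comm a0_vac a0_ind).
have E t : vev (de - al) (plus al t (zpow al (x + t%:R) (minus be q (ket ga)))) =
    ((x + t%:R == dotp al ga) && (al + ga == de))%:R * sbinom (dotp al be) t *+ (t == q).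
  rewrite zpow_minus zpow_ket [minus be q _]linearZ_LR [plus al t _]linearZ_LR vevZ.
  rewrite plus_minus_ket; case: (ltngtP t q) => tq.
  - by rewrite vevZ vev_minus subn_eq0 leqNgt tq mulr0n !mulr0.
  - by rewrite linear0 mulr0.
  rewrite vevZ vev_minus tq subnn vev_ket (_ : (ga == de - al) = (al + ga == de)); last first.
    by rewrite eq_sym subr_eq eq_sym addrC.
  by rewrite mulr1n mulrA mulrAC -natrM mulnb.
rewrite (@nsum1 _ q) => [|t /negPf tq]; last by rewrite E tq.
rewrite E eqxx mulr1n; case: (al + ga =P de) => [<-|_]; last by rewrite andbF !mul0r mulr0.
by have -> : al + ga - al = ga by [rewrite addrAC subrr add0r]; rewrite mulrCA.
Qed.

Let Yl x w : {linear D -> D} := HB.pack_for {linear D -> D} (fun u => Y u x w)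
  (GRing.isLinear.Build K D D _ _ (Y_linear x w)).

Lemma vev_Y_creation de i k u y ga : vev de (Y (mode i (Negz k) u) y (ket ga)) =
  (-1) ^+ k * ga 0 i * vev de (Y u (y + k.+1%:R) (ket ga)).
Proof.
have Yt : truncated (fun x => Y u x).
  by split=> [x|x w]; [apply: linearP | apply: Y_trunc].
have ev1 := @evz_np1 _ _ _ mode (fun x => Y u x) i k y (ket ga) Yt.
rewrite Y_normal; apply: etrans (vevD _ _ _) _.
apply: etrans (congr1 (+%R^~ _) (vev_nsum de ev1)) _.
rewrite nsum0 => [|j]; last by rewrite vevZ vev_creation mulr0.
rewrite add0r (@nsum1 _ 0%N) => [|[//|j] _]; last by rewrite mode_ket linear0 scaler0.
rewrite mode_ket0 [Y u _ _]linearZ_LR !vevZ mulrA; congr (_ * _ * vev de (Y u _ _)).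
  by rewrite gbinom_neg // add0r gbinom_bin // binn mulr1.
by rewrite addr0 -natr1; ring.
Qed.

(** The states here are the coefficients of [Y_-(al, z0) e^be], so this is the
    expansion of [(1 + z0/z2)^(al.ga)] times the expectation value of [Y(e^be, z2)].
    It follows from the recursion for [Y_-], because creation operators in the state
    act on [e^ga] through their zero modes only ([vev_Y_creation]). *)
Lemma vev_Y_minus_state de al be ga r y :
  vev de (Y (minus al r (ket be)) y (ket ga)) =
  ((y + r%:R == dotp be ga) && (be + ga == de))%:R * (eps be ga * gbinom (dotp al ga) r).
Proof.
move: r y; elim/ltn_ind=> -[|r] IH y.
  have := vev_Y_minus de be be ga y 0.
  by rewrite /minus_coef /= !exp_coef0 sbinom0 gbinom0.
apply: (mulfI (natSr_neq0 charK r)).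
have := congr1 (fun u => vev de (Y u y (ket ga)))
  (exp_coef_rec charK (minus_exponentC mode_comm al) r.+1 (ket be)).
rewrite -[Y (_ *: _) y _]/(Yl y (ket ga) _) linearZ_LR vevZ => ->.
rewrite -[Y (\sum_(j < _) _) y _]/(Yl y (ket ga) _) linear_sum vev_sum.
have E (j : 'I_r.+1) : vev de (Yl y (ket ga) (minus_exponent mode al (r.+1 - j) (minus al j (ket be)))) =
    ((y + r.+1%:R == dotp be ga) && (be + ga == de))%:R *
    (eps be ga * ((-1) ^+ r * (dotp al ga * sbinom (dotp al ga) j))).
  have jr : (j <= r)%N by rewrite -ltnS.
  rewrite minus_exponentE linear_sum vev_sum.
  have -> : - (r.+1 - j)%:Z = Negz (r - j) by rewrite subSn.
  under eq_bigr do rewrite linearZ_LR vevZ [Yl _ _ _]/(Y _ _ _) vev_Y_creation IH //.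
  have -> : y + (r - j).+1%:R + j%:R = y + r.+1%:R.
    by rewrite -addrA -natrD addSn subnK.
  set A := _%:R; transitivity (A * eps be ga * (-1) ^+ (r - j) * gbinom (dotp al ga) j *
      dotp al ga).
    by rewrite /dotp mulr_sumr; apply: eq_bigr => i _; ring.
  have -> : (-1) ^+ r = (-1) ^+ (r - j) * (-1) ^+ j :> K by rewrite -exprD subnK.
  rewrite /sbinom; set S := (-1) ^+ j.
  have SS : S * S = 1 by rewrite -expr2 sqrr_sign.
  by ring: SS.
under eq_bigr do rewrite E.
rewrite -mulr_sumr -!mulr_sumr.
have := sbinom_sum charK (dotp al ga) r.+1; rewrite mulNr => /(canRL opprK) ->.
rewrite /sbinom exprS; set S := (-1) ^+ r.
have SS : S * S = 1 by rewrite -expr2 sqrr_sign.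
by ring: SS.
Qed.

Local Notation product := (product Y).
Local Notation iterate := (iterate Y).

Lemma dotpDr al be ga : dotp al (be + ga) = dotp al be + dotp al ga.
Proof. by rewrite /dotp -big_split; apply: eq_bigr => i _; rewrite mxE mulrDr. Qed.

Lemma dotpC al be : dotp al be = dotp be al.
Proof. by apply: eq_bigr => i _; rewrite mulrC. Qed.

Lemma evz_product N x y u u' w :
  evz (fun m => sbinom N m *: Y u (x + m%:R) (Y u' (y - m%:R) w)).
Proof. by have [B wB] := Y_trunc u' w y; exists B => m Bm; rewrite wB // linear0 scaler0. Qed.

(** The exponents are restricted to those of total degree [al.be + al.ga + be.ga]
    after division by [(z1 - z2)^N]; otherwise [vev_product_out] applies. The power
    of [z1 - z2] and the contraction multiply to [(z1 - z2)^(N + al.be)]. *)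
Lemma vev_product_at de N (t : int) e1 al be ga :
  e1 = N + dotp al ga + dotp al be - t%:~R ->
  vev de (product N e1 (dotp be ga + t%:~R) (ket al) (ket be) (ket ga)) =
  (al + (be + ga) == de)%:R * (eps be ga * eps al (be + ga)) * zbinom (N + dotp al be) t.
Proof.
move=> e1E; rewrite /product vev_nsum; last exact: evz_product.
case: t e1E => [t|t] e1E; last first.
  rewrite mulr0 nsum0 // => m; rewrite Y_ket_out ?linear0 ?scaler0 // => q.
  rewrite -addrA (inj_eq (addrI _)) intr_Negz -subr_eq0.
  have -> : - 1 - t%:R - m%:R - q%:R = - (t + m + q).+1%:R :> K.
    by rewrite -natr1 !natrD; ring.
  by rewrite oppr_eq0 natSr_neq0.
rewrite (@nsumE _ t.+1) => [|m tm]; last first.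
  rewrite Y_ket_out ?linear0 ?scaler0 // => q.
  rewrite -addrA (inj_eq (addrI _)) -pmulrn subr_eq -natrD natr_eq //; lia.
rewrite [zbinom _ _]/= -sbinom_vandermonde // mulr_sumr; apply: eq_bigr => -[m mt] _ /=.
have -> : dotp be ga + t%:~R - m%:R = dotp be ga + (t - m)%N%:R.
  by rewrite -pmulrn natrB ?addrA.
rewrite Y_ket_at vevZ [Y _ _ _]linearZ_LR vevZ vev_Y_minus.
have -> : e1 - N + m%:R + (t - m)%N%:R = dotp al (be + ga).
  by rewrite e1E -pmulrn natrB // dotpDr; ring.
by rewrite eqxx; ring.
Qed.

Lemma vev_product_out de N e1 e2 al be ga :
  e1 + e2 - N != dotp al ga + dotp be ga + dotp al be ->
  vev de (product N e1 e2 (ket al) (ket be) (ket ga)) = 0.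
Proof.
move=> e12; rewrite /product vev_nsum; last exact: evz_product.
apply: nsum0 => m; have [[q e2q]|no] := pselect (exists q : nat, e2 - m%:R = dotp be ga + q%:R).
  rewrite e2q Y_ket_at vevZ [Y _ _ _]linearZ_LR vevZ vev_Y_minus.
  have -> : (e1 - N + m%:R + q%:R == dotp al (be + ga)) = false.
    apply: contra_neqF e12 => /eqP E.
    have -> : e1 + e2 - N = e1 - N + m%:R + (e2 - m%:R) by ring.
    rewrite e2q; have -> : e1 - N + m%:R + (dotp be ga + q%:R) =
      e1 - N + m%:R + q%:R + dotp be ga by ring.
    by rewrite E dotpDr; ring.
  by rewrite mul0r !mulr0.
rewrite Y_ket_out ?linear0 ?scaler0 ?linear0 // => q.
by apply/eqP => qE; apply: no; exists q.
Qed.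

Lemma vev_iterate de (n : int) e1 e2 al be ga :
  vev de (iterate (- dotp al be + n%:~R) e1 e2 (ket al) (ket be) (ket ga)) =
  ((e1 + e2 == dotp al ga + dotp be ga + n%:~R) && (al + be + ga == de))%:R *
  (eps al be * eps (al + be) ga) *
  (if n is Negz s then gbinom (dotp al ga - e1 - 1) s else 0).
Proof.
rewrite /iterate vev_nsum; last exact: evz_iterate.
case: n => [n|s].
  rewrite mulr0 nsum0 // => m; rewrite Y_ket_out => [|q].
    by rewrite -[Y 0 _ _]/(Yl _ _ 0) !linear0.
  rewrite -pmulrn; have -> : - 1 - (- dotp al be + n%:R) - m%:R = dotp al be - (n + m).+1%:R.
    by rewrite -natr1 natrD; ring.
  by rewrite (inj_eq (addrI _)) -subr_eq0 -opprD oppr_eq0 -natrD addSn natSr_neq0.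
rewrite (@nsumE _ s.+1) => [|m sm]; last first.
  rewrite Y_ket_out => [|q]; first by rewrite -[Y 0 _ _]/(Yl _ _ 0) !linear0.
  have -> : - 1 - (- dotp al be + (Negz s)%:~R) - m%:R = dotp al be + (s%:R - m%:R).
    by rewrite intr_Negz; ring.
  by rewrite (inj_eq (addrI _)) subr_eq -natrD natr_eq //; lia.
have -> : dotp al ga - e1 - 1 = - e1 - 1 + dotp al ga by ring.
rewrite -gbinom_vandermonde // mulr_sumr; apply: eq_bigr => -[m ms] _ /=.
have -> : - 1 - (- dotp al be + (Negz s)%:~R) - m%:R = dotp al be + (s - m)%N%:R.
  by rewrite intr_Negz natrB //; ring.
rewrite Y_ket_at vevZ -[Y (_ *: _) _ _]/(Yl _ _ (_ *: _)) linearZ_LR vevZ [Yl _ _ _]/(Y _ _ _).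
rewrite vev_Y_minus_state.
have -> : (e1 + e2 + 1 + m%:R + (s - m)%N%:R == dotp (al + be) ga) =
    (e1 + e2 == dotp al ga + dotp be ga + (Negz s)%:~R).
  rewrite intr_Negz natrB // [dotp (al + be) ga]dotpC dotpDr ![dotp ga _]dotpC.
  rewrite -subr_eq0 -[RHS]subr_eq0; congr (_ == 0); ring.
ring.
Qed.

Hypothesis eps_neq0 : forall al be, eps al be != 0.
Hypothesis eps_cocycle : forall al be ga,
  eps be ga * eps al (be + ga) = eps al be * eps (al + be) ga.

(** The difference of the two sides of the Jacobi identity. *)
Definition defect al be g (n p : int) e2 w : D :=
  product (- dotp al be + n%:~R) (g + p%:~R) e2 (ket al) (ket be) w -
  ((commutator eps al be * (-1) ^ n) *:
    product (- dotp al be + n%:~R) e2 (g + p%:~R) (ket be) (ket al) w +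
   iterate (- dotp al be + n%:~R) (g + p%:~R) e2 (ket al) (ket be) w).

Let vev_defectE de al be g n p e2 w X1 X2 X3 :
  vev de (product (- dotp al be + n%:~R) (g + p%:~R) e2 (ket al) (ket be) w) = X1 ->
  vev de (product (- dotp al be + n%:~R) e2 (g + p%:~R) (ket be) (ket al) w) = X2 ->
  vev de (iterate (- dotp al be + n%:~R) (g + p%:~R) e2 (ket al) (ket be) w) = X3 ->
  vev de (defect al be g n p e2 w) = X1 - (commutator eps al be * (-1) ^ n * X2 + X3).
Proof. by move=> <- <- <-; exact: vev_combination. Qed.

Lemma vev_defect de al be ga (n p : int) e2 :
  vev de (defect al be (dotp al ga) n p e2 (ket ga)) = 0.
Proof.
have iter := vev_iterate de n (dotp al ga + p%:~R) e2 al be ga.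
have [e2E|e2n] := eqVneq e2 (dotp be ga + (n - p)%:~R); last first.
  have e2n' : (dotp al ga + p%:~R + e2 == dotp al ga + dotp be ga + n%:~R) = false.
    apply: contra_neqF e2n => /eqP E; apply: (addrI (dotp al ga + p%:~R)).
    by rewrite E rmorphB /=; ring.
  have out1 : dotp al ga + p%:~R + e2 - (- dotp al be + n%:~R) !=
      dotp al ga + dotp be ga + dotp al be.
    apply: contraFneq e2n' => E; rewrite -subr_eq0; apply/eqP.
    by rewrite -(subrr (dotp al ga + dotp be ga + dotp al be)) -{1}E; ring.
  have out2 : e2 + (dotp al ga + p%:~R) - (- dotp al be + n%:~R) !=
      dotp be ga + dotp al ga + dotp be al.
    by rewrite [e2 + _]addrC [dotp be ga + _]addrC [dotp be al]dotpC.
  rewrite (vev_defectE (vev_product_out de out1) (vev_product_out de out2) iter) e2n'.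
  by rewrite mul0r mul0r mulr0 addr0 subr0.
have at1 : dotp al ga + p%:~R =
    - dotp al be + n%:~R + dotp al ga + dotp al be - (n - p)%:~R.
  by rewrite rmorphB /=; ring.
have at2 : e2 = - dotp al be + n%:~R + dotp be ga + dotp be al - p%:~R.
  by rewrite e2E rmorphB /= [dotp be al]dotpC; ring.
have prod1 := vev_product_at de at1; rewrite -e2E in prod1.
rewrite (vev_defectE prod1 (vev_product_at de at2) iter) e2E.
rewrite [dotp be al]dotpC addrAC addNr add0r jacobi_constant //.
have -> : dotp al ga + p%:~R + (dotp be ga + (n - p)%:~R) =
    dotp al ga + dotp be ga + n%:~R by rewrite rmorphB /=; ring.
have -> : dotp al ga - (dotp al ga + p%:~R) - 1 = - p%:~R - 1 by ring.
rewrite eqxx !addrA [be + al]addrC.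
set A := (_ == de)%:R; set B := (if n is Negz _ then _ else _).
have C : commutator eps al be * (eps al ga * eps be (al + ga)) = eps be ga * eps al (be + ga).
  by rewrite /commutator !eps_cocycle [be + al]addrC; field; apply: eps_neq0.
rewrite -eps_cocycle -C; ring.
Qed.

Lemma mode_defect al be g n p e2 i (m : int) w :
  mode i m (defect al be g n p e2 w) = defect al be g n p e2 (mode i m w) +
  (al 0 i *: defect al be g n (p - m) e2 w + be 0 i *: defect al be g n p (e2 - m%:~R) w).
Proof.
have E : g + (p - m)%:~R = g + p%:~R - m%:~R by rewrite rmorphB /= addrA.
rewrite /defect E; apply: linear_defect.
- exact: (product_comm Y_linear Y_trunc Y_comm (mu := al 0) (nu := be 0)
    (mode_ket0^~ al) (fun i k => mode_ket i k al) (mode_ket0^~ be)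
    (fun i k => mode_ket i k be)).
- exact: (product_comm Y_linear Y_trunc Y_comm (mu := be 0) (nu := al 0)
    (mode_ket0^~ be) (fun i k => mode_ket i k be) (mode_ket0^~ al)
    (fun i k => mode_ket i k al)).
exact: (iterate_comm charK Y_linear Y_trunc Y_comm (mu := al 0) (nu := be 0)
    (mode_ket0^~ al) (fun i k => mode_ket i k al) (mode_ket0^~ be)
    (fun i k => mode_ket i k be)).
Qed.

Lemma defect_linear al be g n p e2 : linear (defect al be g n p e2).
Proof.
move=> c w w'; rewrite /defect.
have P1 := product_linear3 Y_trunc (- dotp al be + n%:~R) (g + p%:~R) e2 (ket al) (ket be) c w w'.
have P2 := product_linear3 Y_trunc (- dotp al be + n%:~R) e2 (g + p%:~R) (ket be) (ket al) c w w'.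
have I := iterate_linear3 Y_linear Y_trunc (- dotp al be + n%:~R) (g + p%:~R) e2
  (ket al) (ket be) c w w'.
exact: (defect_linear_eq _ P1 P2 I).
Qed.

(** By [mode_defect] and since annihilation operators kill [e^ga], the defects at
    all exponents are closed under annihilation operators. *)
Lemma defect_ket al be ga n p e2 : defect al be (dotp al ga) n p e2 (ket ga) = 0.
Proof.
apply: dsumP => d; rewrite mcoeff0; set g := dotp al ga.
pose T (x : int * K) := (defect al be g n x.1 x.2 (ket ga))@_d.
apply: (ct_detect (T := T) _ _ (p, e2)) => [[q x] i k|[q x]]; last exact: vev_defect.
exists (q - k.+1%:Z, x), (q, x - k.+1%:Z%:~R), (al 0 i), (be 0 i).
have M := mode_defect al be g n q x i k.+1 (ket ga).
rewrite mode_ket (linear0_of (defect_linear al be g n q x)) add0r in M.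
apply: etrans (esym (mcoeff_twisted a0 i k.+1 _ d)) _.
exact: (etrans (congr1 (mcoeff d) M) (mcoeff_combination _ _ _ _ _)).
Qed.

(** Creation operators carry the statement from [e^ga] to all vectors over it. *)
Lemma defect_single al be ga n p e2 v : defect al be (dotp al ga) n p e2 (single v ga) = 0.
Proof.
set g := dotp al ga; have lin m q x := defect_linear al be g m q x.
elim/a0_ind: v p e2 => [|v v' IH IH'|c v IH|i k v IH] p e2.
- exact: defect_ket.
- rewrite singleD; apply: etrans (linearD_of _ _ (lin n p e2)) _.
  by apply: etrans (congr2 +%R (IH p e2) (IH' p e2)) _; apply: addr0.
- rewrite singleZ; apply: etrans (linearZ_of _ _ (lin n p e2)) _.
  by apply: etrans (congr1 ( *:%R c) (IH p e2)) _; apply: scaler0.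
have -> : single (a0 i (Negz k) v) ga = mode i (Negz k) (single v ga).
  by apply/esym; apply: twisted_single.
have := mode_defect al be g n p e2 i (Negz k) (single v ga).
by rewrite !IH linear0 !scaler0 !addr0.
Qed.

Definition weight_space ga w := exists v, w = single v ga.

Lemma weight_space_mode ga i (j : int) w :
  weight_space ga w -> weight_space ga (mode i j w).
Proof. by move=> [v ->]; exists (twist a0 j i ga v); apply: twisted_single. Qed.

Local Notation bor al be ga := (borcherds Y (dotp al ga) (- dotp al be)
  (commutator eps al be) (weight_space ga)).

Lemma borcherds_ket al be ga : bor al be ga (ket al) (ket be).
Proof.
move=> n p e2 w [v ->]; apply: subr0_eq.
exact: (defect_single al be ga n p e2 v).
Qed.

Let borZ al be ga c u u' : bor al be ga u u' -> bor al be ga (c *: u) u'.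
Proof.
move=> H; have -> : c *: u = (c - 1) *: u + u by rewrite -[X in _ + X]scale1r -scalerDl subrK.
exact: (borcherdsl Y_linear Y_trunc).
Qed.

Let borZr al be ga c u u' : bor al be ga u u' -> bor al be ga u (c *: u').
Proof.
move=> H; have -> : c *: u' = (c - 1) *: u' + u'.
  by rewrite -[X in _ + X]scale1r -scalerDl subrK.
exact: (borcherdsr Y_linear Y_trunc).
Qed.

Let borD al be ga u u' u2 : bor al be ga u u2 -> bor al be ga u' u2 -> bor al be ga (u + u') u2.
Proof. by move=> H H'; rewrite -[u]scale1r; apply: (borcherdsl Y_linear Y_trunc). Qed.

Let borDr al be ga u u' u2 : bor al be ga u u' -> bor al be ga u u2 -> bor al be ga u (u' + u2).
Proof. by move=> H H'; rewrite -[u']scale1r; apply: (borcherdsr Y_linear Y_trunc). Qed.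

Let creation_single i k v ga : single (a0 i (Negz k) v) ga = mode i (Negz k) (single v ga).
Proof. by apply/esym; apply: twisted_single. Qed.

Lemma borcherds_ketl al be ga v : bor al be ga (ket al) (single v be).
Proof.
elim/a0_ind: v => [|v v' IH IH'|c v IH|i k v IH].
- exact: borcherds_ket.
- by rewrite singleD; exact: (borDr IH IH').
- by rewrite singleZ; exact: borZr.
rewrite creation_single.
apply: (borcherds_right charK Y_linear mode_bound Y_trunc Y_comm Y_normal
  (@weight_space_mode ga) k IH).
case=> [|r]; first by rewrite mode_ket0; apply: borZ.
by rewrite mode_ket -(scale0r (ket al)); apply: borZ.
Qed.

Theorem borcherds_identity al be ga v v' : bor al be ga (single v al) (single v' be).
Proof.
elim/a0_ind: v v' => [|v v2 IH IH2|c v IH|i k v IH] v'.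
- exact: borcherds_ketl.
- by rewrite singleD; exact: (borD (IH v') (IH2 v')).
- by rewrite singleZ; exact: (borZ _ (IH v')).
rewrite creation_single.
apply: (borcherds_left charK Y_linear mode_bound Y_trunc Y_comm Y_normal
  (@weight_space_mode ga) k (IH v')).
move=> r; have [v2 ->] : weight_space be (mode i r (single v' be)); last exact: IH.
by apply: weight_space_mode; exists v'.
Qed.

Lemma weight0 ga : weight_space ga 0.
Proof. by exists 0; rewrite single0. Qed.

Lemma weightZ ga c w : weight_space ga w -> weight_space ga (c *: w).
Proof. by move=> [v ->]; exists (c *: v); rewrite singleZ. Qed.

Lemma weightD ga w w' : weight_space ga w -> weight_space ga w' -> weight_space ga (w + w').
Proof. by move=> [v ->] [v' ->]; exists (v + v'); rewrite singleD. Qed.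

Lemma weight_sum ga n (f : 'I_n -> D) :
  (forall j, weight_space ga (f j)) -> weight_space ga (\sum_j f j).
Proof.
move=> fw; apply: (big_ind (weight_space ga)) => [|w w'|j _]; last exact: fw.
  exact: weight0.
exact: weightD.
Qed.

Lemma weight_nsum ga (f : nat -> D) : evz f ->
  (forall m, weight_space ga (f m)) -> weight_space ga (nsum f).
Proof. by move=> [B fB] fw; rewrite (nsumE fB); apply: weight_sum. Qed.

Lemma weight_exp ga (b : nat -> {linear D -> D}) :
  (forall j k w, b j.+1 (b k.+1 w) = b k.+1 (b j.+1 w)) ->
  (forall j w, weight_space ga w -> weight_space ga (b j w)) ->
  forall s w, weight_space ga w -> weight_space ga (exp_coef b s w).
Proof.
move=> bC bw s w ww; elim/ltn_ind: s => -[|s] IH; first by rewrite exp_coef0.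
have [v vE] : weight_space ga (s.+1%:R *: exp_coef b s.+1 w).
  by rewrite (exp_coef_rec charK bC); apply: weight_sum => j; apply: bw; exact: IH.
exists (s.+1%:R^-1 *: v); rewrite singleZ -vE.
by apply/esym; apply: etrans (scalerA _ _ _) _; rewrite mulVf ?natSr_neq0 // scale1r.
Qed.

Lemma weight_lmode ga al n w : weight_space ga w -> weight_space ga (lmode mode al n w).
Proof.
by move=> ww; apply: weight_sum => i; apply: weightZ; exact: weight_space_mode.
Qed.

Lemma weight_minus ga al s w : weight_space ga w -> weight_space ga (minus al s w).
Proof.
apply: (weight_exp (minus_exponentC mode_comm al)) => j w'.
exact: weight_lmode.
Qed.

Lemma weight_plus ga al t w : weight_space ga w -> weight_space ga (plus al t w).
Proof.
apply: (weight_exp (plus_exponentC mode_comm al)) => j w' /(weight_lmode al j)[v vE].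
by exists (- v); rewrite -scaleN1r singleZ scaleN1r -vE.
Qed.

Let evz_right_factor al y w := evz_right charK a0_comm a0_vac a0_ind al y w.

Lemma weight_right ga al y w : weight_space ga w -> weight_space ga (right_factor a0 al y w).
Proof.
move=> [v ->]; apply: weight_nsum => [|t]; first exact: evz_right_factor.
apply: weight_plus; exists ((y + t%:R == dotp al ga)%:R *: v); rewrite singleZ.
exact: scalars_single.
Qed.

Lemma right_out ga al y w : weight_space ga w ->
  (forall n : int, y != dotp al ga + n%:~R) -> right_factor a0 al y w = 0.
Proof.
move=> [v ->] yn; apply: nsum0 => t.
have E : zpow al (y + t%:R) (single v ga) = (y + t%:R == dotp al ga)%:R *: single v ga.
  exact: scalars_single.
rewrite E (negPf (_ : y + t%:R != _)) ?scale0r ?linear0 //.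
apply: contra (yn (- t%:Z)) => /eqP <-.
by rewrite mulrNz -pmulrn addrK.
Qed.

Let Y_truncated u : truncated (fun x => Y u x).
Proof. by split=> [x|x w]; [apply: linearP | apply: Y_trunc]. Qed.

(** Together with [Y_out], this makes the coefficients of the Jacobi identity
    vanish outside the classes of exponents considered so far. *)
Lemma weight_Y al be x v w :
  weight_space be w -> weight_space (al + be) (Y (single v al) x w).
Proof.
elim/a0_ind: v x w => [|u u' IH IH'|c u IH|i k u IH] x w ww.
- rewrite Y_ket; have [v ->] : weight_space be
      (nsum (fun s => minus al s (right_factor a0 al (x - s%:R) w))).
    apply: weight_nsum => [|s]; first exact: (evz_vop1 charK a0_comm a0_vac a0_ind).
    by apply: weight_minus; exact: weight_right.
  exists (eps al be *: v); rewrite singleZ; exact: shift_single.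
- rewrite singleD; have -> := linearD_of (single u al) (single u' al) (Y_linear x w).
  by apply: weightD; [exact: IH | exact: IH'].
- rewrite singleZ; have -> := linearZ_of c (single u al) (Y_linear x w).
  by apply: weightZ; exact: IH.
rewrite creation_single Y_normal; apply: weightD.
  apply: weight_nsum => [|j]; first exact: (@evz_np1 _ _ _ mode (fun x => Y (single u al) x) _ _ _ _ (Y_truncated _)).
  by apply: weightZ; apply: weight_space_mode; exact: IH.
apply: weight_nsum => [|j].
  exact: (@evz_np2 _ _ _ mode mode_bound (fun x => Y (single u al) x) _ _ _ _ (Y_truncated _)).
by apply: weightZ; apply: IH; exact: weight_space_mode.
Qed.

Lemma Y_out al be x v w : weight_space be w ->
  (forall n : int, x != dotp al be + n%:~R) -> Y (single v al) x w = 0.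
Proof.
elim/a0_ind: v x w => [|u u' IH IH'|c u IH|i k u IH] x w ww xn.
- rewrite Y_ket nsum0 => [|s]; first exact: (linear0 (left_factor eps al)).
  rewrite (right_out ww) ?linear0 // => n; apply: contra (xn (n + s%:Z)) => /eqP E.
  by rewrite rmorphD /= addrA -E -pmulrn subrK.
- rewrite singleD; have -> := linearD_of (single u al) (single u' al) (Y_linear x w).
  by apply: etrans (congr2 +%R (IH x w ww xn) (IH' x w ww xn)) _; exact: addr0.
- rewrite singleZ; have -> := linearZ_of c (single u al) (Y_linear x w).
  by apply: etrans (congr1 ( *:%R c) (IH x w ww xn)) _; exact: scaler0.
rewrite creation_single Y_normal; apply: etrans (congr2 +%R (nsum0 _) (nsum0 _)) (addr0 _) => j.
  rewrite IH ?linear0 ?scaler0 // => n; apply: contra (xn (n + j%:Z - k%:Z)) => /eqP E.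
  by rewrite rmorphB rmorphD /= !addrA -E -!pmulrn; apply/eqP; ring.
rewrite IH ?scaler0 //; first exact: weight_space_mode.
move=> n; apply: contra (xn (n - j%:Z - 1 - k%:Z)) => /eqP E.
by rewrite !rmorphB /= !addrA -E -!pmulrn; apply/eqP; ring.
Qed.

End ExponentialJacobi.

(** * The vertex operators on the sum of the modules [M_ga] *)

Lemma scomp_sconst (K : fieldType) (V : lmodType K) (T : V -> V) (B : K -> V -> V) e w :
  T 0 = 0 -> scomp (sconst T) B e w = T (B e w).
Proof.
move=> T0; rewrite /scomp /cauchy (@fsum1 _ _ e) => [|x xe].
  by rewrite /sconst subrr eqxx.
by rewrite /sconst subr_eq0 eq_sym (negPf xe).
Qed.

Lemma normal_product0 (K : fieldType) (l : nat) (V : lmodType K)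
  (a : 'I_l -> int -> {linear V -> V}) i k (A : K -> V -> V) x w :
  (forall y w, A y w = 0) -> normal_product a i k A x w = 0.
Proof.
move=> A0; rewrite /normal_product nsum0 => [|j]; last by rewrite A0 linear0 scaler0.
by rewrite add0r nsum0 // => j; rewrite A0 scaler0.
Qed.

Section Vertex.
Variables (K : fieldType) (l : nat).
Hypothesis charK : [pchar K] =i pred0.
Local Notation M := (fock K l).
Local Notation MM := (heis_sum K l).
Local Notation fm := (@fmodes K l).
Local Notation mode := (dmode fm).
Implicit Types (u v : M) (w : MM) (al be ga : 'rV[K]_l) (i : 'I_l) (e x y : K).

Let fmodes_comm i j n m v : fm i n (fm j m v) =
  fm j m (fm i n v) + (n%:~R *+ ((n == - m) && (i == j))) *: v.
Proof. exact: fmode_comm. Qed.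

Let fmodes_vac i (k : nat) : fm i k (1 : M) = 0.
Proof. exact: fmode_vac. Qed.

Let fmodes_ind (P : M -> Prop) :
  P 1 -> (forall v v', P v -> P v' -> P (v + v')) ->
  (forall c v, P v -> P (c *: v)) ->
  (forall i k v, P v -> P (fm i (Negz k) v)) -> forall v, P v.
Proof. exact: fmode_ind. Qed.

Let mode_comm := dmode_comm fmodes_comm.
Let mode_bound := dmode_bound fmodes_comm fmodes_vac fmodes_ind.

Lemma amode_dmode : @amode K l = fun i n => (mode i n : MM -> MM).
Proof.
apply/funext => i; apply/funext => n; apply/funext => w.
exact: amodeE.
Qed.

Lemma lin_modeE al n w : lin_mode al n w = lmode mode al n w.
Proof. by rewrite /lin_mode amode_dmode. Qed.

Lemma zpow0E al e w : zpow0 al e w = zpow al e w.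
Proof. exact: blockwE. Qed.

Lemma eopE eps al w : eop eps al w = left_factor eps al w.
Proof. exact: shiftE. Qed.

Lemma YminusE al e w : Yminus al e w =
  series setT (fun n : nat => 1 * n%:R) (minus_coef mode al) e w.
Proof.
apply: etrans _ (sexp_series charK (minus_exponent mode al) (oner_neq0 K) e w).
have dE : (fun n : nat => 1 * n%:R : K) = (fun n : nat => n%:R).
  by apply/funext => n; rewrite mul1r.
have TE : (fun (n : nat) w => n%:R^-1 *: lin_mode al (- n%:Z) w) =
    (fun n w => n%:R^-1 *: minus_exponent mode al n w).
  apply/funext => n; apply/funext => w'.
  exact: (congr1 ( *:%R n%:R^-1) (lin_modeE al (- n%:Z) w')).
rewrite dE -TE; exact: erefl.
Qed.

Lemma YplusE al e w : Yplus al e w =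
  series setT (fun n : nat => -1 * n%:R) (plus_coef mode al) e w.
Proof.
have sg : -1 != 0 :> K by rewrite oppr_eq0 oner_eq0.
apply: etrans _ (sexp_series charK (plus_exponent mode al) sg e w).
have dE : (fun n : nat => -1 * n%:R : K) = (fun n : nat => - n%:R).
  by apply/funext => n; rewrite mulN1r.
have TE : (fun (n : nat) w => - (n%:R^-1 *: lin_mode al n%:Z w)) =
    (fun n w => n%:R^-1 *: plus_exponent mode al n w).
  apply/funext => n; apply/funext => w'; apply: etrans (esym (scalerN _ _)) _.
  exact: (congr1 (fun w => n%:R^-1 *: - w) (lin_modeE al n%:Z w')).
rewrite dE -TE; exact: erefl.
Qed.

Lemma monomial_modesE m :
  monomial_modes m = ordered_modes mode (finsupp m) m.
Proof.
by rewrite /monomial_modes /normal_mul amode_dmode.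
Qed.

Lemma YfieldE u e w : Yfield u e w = state_field mode u e w.
Proof.
rewrite /Yfield /state_field.
have E m : monomial_field mode m = of_modes (monomial_modes m).
  by rewrite monomial_modesE (of_modes_ordered charK mode_bound).
have [[n ->]|no] := pselect (exists n, e = mode_exponent K n).
  apply: etrans (series_at (mode_exponent_inj charK) _ _ _) _.
  apply: eq_bigr => m _; rewrite E; congr (_ *: _).
  by apply/esym; apply: of_modesE.
have en n : e <> mode_exponent K n by move=> en; apply: no; exists n.
apply: etrans (series_out _ _ _ en) _; apply/esym/big1 => m _.
rewrite E; apply: etrans (congr1 ( *:%R _) (series_out _ _ _ en)) _; exact: scaler0.
Qed.

Variable eps : 'rV[K]_l -> 'rV[K]_l -> K.
Local Notation vop al u := (vop charK fmodes_comm fmodes_vac fmodes_ind eps al u).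

Lemma vertex_tens_vop u al e w : vertex_tens eps u al e w = vop al u e w.
Proof.
have sgP : injective (fun n : nat => 1 * n%:R : K).
  by move=> n m /(mulfI (oner_neq0 K)) /eqP; rewrite natr_eq // => /eqP.
have sgN : injective (fun n : nat => -1 * n%:R : K).
  by move=> n m; rewrite !mulN1r => /oppr_inj /eqP; rewrite natr_eq // => /eqP.
have eopF : eop eps al = left_factor eps al by apply/funext => w'; exact: eopE.
rewrite /vertex_tens eopF.
apply: etrans (scomp_sconst _ _ _ (linear0 (left_factor eps al))) _.
apply: (congr1 (left_factor eps al)).
have -> : Yminus al = series setT (fun n : nat => 1 * n%:R) (minus_coef mode al).
  by apply/funext => x; apply/funext => w'; exact: YminusE.
apply: etrans (scomp_series sgP _ _ _ (fun n => linear0 (minus_coef mode al n))) _.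
apply: eq_nsum => s; rewrite mul1r; apply: (congr1 (minus_coef mode al s)).
apply: eq_fsbigr => y _; apply: etrans (YfieldE _ _ _) _.
apply: (congr1 (state_field mode u (e - s%:R - y))).
have -> : Yplus al = series setT (fun n : nat => -1 * n%:R) (plus_coef mode al).
  by apply/funext => x; apply/funext => w'; exact: YplusE.
apply: etrans (scomp_series sgN _ _ _ (fun n => linear0 (plus_coef mode al n))) _.
apply: eq_nsum => t; rewrite mulN1r opprK; apply: (congr1 (plus_coef mode al t)).
exact: zpow0E.
Qed.

Let vop0 al e w : vop al 0 e w = 0.
Proof. exact: (linear0_of (vop_linear1 charK fmodes_comm fmodes_vac fmodes_ind eps al e w)). Qed.

Lemma vertex_vop U e w : vertex eps U e w = \sum_(al <- msupp U) vop al U@_al e w.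
Proof. by apply: eq_bigr => al _; exact: vertex_tens_vop. Qed.

Lemma vertex_single u al e w : vertex eps (single u al) e w = vop al u e w.
Proof. by apply: etrans (vertex_tensE _ _ _ _ _) _; exact: vertex_tens_vop. Qed.

Lemma vertex_linear2 U e : linear (vertex eps U e).
Proof.
move=> c w w'; apply: etrans (vertex_vop _ _ _) _.
rewrite (vertex_vop U e w) (vertex_vop U e w').
rewrite scaler_sumr -big_split; apply: eq_bigr => al _.
exact: (proj1 (truncated_vop charK fmodes_comm fmodes_vac fmodes_ind eps al U@_al)).
Qed.

Lemma vertex_linear1 e w : linear (fun U => vertex eps U e w).
Proof.
move=> c U U'; apply: etrans (vertex_vop _ _ _) _.
rewrite (vertex_vop U e w) (vertex_vop U' e w).
apply: (msum_linear (f := fun al u => vop al u e w)) => [al|al]; first exact: vop0.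
apply: etrans _ (vop_linear1 charK fmodes_comm fmodes_vac fmodes_ind eps al e w c _ _).
apply: (congr1 (fun u => vop al u e w)).
by apply: etrans (mcoeff_dsumD _ _ _) _; apply: (congr1 (+%R^~ _)); exact: dsum_scaleE.
Qed.

Definition vertex_op U e : {linear MM -> MM} := HB.pack_for {linear MM -> MM}
  (vertex eps U e) (GRing.isLinear.Build K MM MM _ _ (vertex_linear2 U e)).

Lemma vertex_trunc U w x : evz (fun m : nat => vertex_op U (x - m%:R) w).
Proof.
apply: evz_ext (fun m => vertex_vop U (x - m%:R) w) _; apply: evz_sum => al _.
exact: (proj2 (truncated_vop charK fmodes_comm fmodes_vac fmodes_ind eps al U@_al)).
Qed.

Let vertexD U U' e w : vertex_op (U + U') e w = vertex_op U e w + vertex_op U' e w.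
Proof. exact: (linearD_of _ _ (vertex_linear1 e w)). Qed.

Let truncated_vertex U : truncated (fun x => vertex_op U x).
Proof. by split=> [x|x w]; [exact: vertex_linear2 | exact: vertex_trunc]. Qed.

Lemma vertex_normal i k U x w :
  vertex_op (mode i (Negz k) U) x w = normal_product mode i k (vertex_op U) x w.
Proof.
elim/dsum_ind: U x w => [U U' IH IH'||u al] x w.
- apply: etrans (congr1 (fun U => vertex_op U x w) (linearD (mode i (Negz k)) U U')) _.
  apply: etrans (vertexD _ _ _ _) _.
  apply: etrans (congr2 +%R (IH x w) (IH' x w)) _; rewrite -[X in X + _]scale1r; apply/esym.
  apply: (@normal_product_eq _ _ _ _ mode_bound i k 1 _ _ _ (fun _ => True)) => //.
  + exact: (truncated_vertex U).
  + exact: (truncated_vertex U').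
  by move=> p w' _; apply: etrans (vertexD _ _ _ _) _; rewrite scale1r.
- apply: etrans (congr1 (fun U => vertex_op U x w) (linear0 (mode i (Negz k)))) _.
  have Z y w' : vertex_op 0 y w' = 0 by exact: (linear0_of (vertex_linear1 y w')).
  by apply: etrans (Z x w) _; apply/esym; exact: normal_product0.
have E : mode i (Negz k) (single u al) = single (var K (i, k) * u) al.
  apply: etrans (twisted_single fm i (Negz k) u al) _.
  exact: (congr1 (fun u' : M => single u' al) (fmode_neg i k u)).
apply: etrans (congr1 (fun U => vertex_op U x w) E) _.
apply: etrans (vertex_single _ _ _ _) _.
rewrite (vop_var charK fmodes_comm fmodes_vac fmodes_ind eps al (i, k) u).
apply: (congr1 (fun F => normal_product mode i k F x w)).
by apply/funext => y; apply/funext => w'; apply/esym; exact: vertex_single.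
Qed.

Local Notation ket := (single (1 : M)).

Let vertex_op_linear1 x w : linear (fun U => vertex_op U x w).
Proof. exact: vertex_linear1. Qed.

Lemma vertex_ket al e w : vertex_op (ket al) e w = left_factor eps al
  (nsum (fun s => minus_coef mode al s (right_factor fm al (e - s%:R) w))).
Proof.
apply: etrans (vertex_single _ _ _ _) _.
exact: (vop1E charK fmodes_comm fmodes_vac fmodes_ind).
Qed.

Let ket_comm al i n e w : mode i n (vertex_op (ket al) e w) =
  vertex_op (ket al) e (mode i n w) + al 0 i *: vertex_op (ket al) (e - n%:~R) w.
Proof.
have E y w' : vertex_op (ket al) y w' = vop al 1 y w' by exact: vertex_single.
rewrite !E; exact: (vop1_comm charK fmodes_comm fmodes_vac fmodes_ind).
Qed.

(** Induction on [U]: lowest weight vectors by [vop1_comm], creation operators by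
    the normally ordered products. *)
Lemma vertex_comm i n U x w : mode i n (vertex_op U x w) = vertex_op U x (mode i n w) +
  nsum (fun k => gbinom n%:~R k *: vertex_op (mode i (Posz k) U) (x - n%:~R + k%:R) w).
Proof.
move: i n x w; rewrite -/(commutator_formula mode vertex_op U).
elim/(dmode_ind fmodes_ind): U => [al|U U' IH IH'|c U IH|j k U IH].
- apply: (commutator_formula_exponential vertex_op_linear1 (la := al 0)).
  + by move=> i; exact: (mode_ket0 _ fm).
  + by move=> i k; exact: (mode_ket fmodes_vac).
  + exact: ket_comm.
- have := commutator_formulal vertex_op_linear1 mode_bound 1 IH IH'.
  by rewrite scale1r.
- have := commutator_formulal vertex_op_linear1 mode_bound (c - 1) IH IH.
  by rewrite scalerBl scale1r subrK.
exact: (commutator_formula_creation charK vertex_op_linear1 mode_bound mode_comm vertex_trunc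
  vertex_normal).
Qed.

Definition vacuum_coef (u : M) : K^o := u@_mone.

Fact vacuum_coef_linear : linear vacuum_coef.
Proof. by move=> c u v; rewrite /vacuum_coef fockD fockZ. Qed.
HB.instance Definition _ := GRing.isLinear.Build K M K^o _ vacuum_coef vacuum_coef_linear.

Lemma vacuum_coef1 : vacuum_coef 1 = 1.
Proof. by rewrite /vacuum_coef mcoeff1 eqxx. Qed.

Lemma vacuum_coef_creation i k u : vacuum_coef (fm i (Negz k) u) = 0.
Proof.
apply: etrans (congr1 (mcoeff mone) (fmode_neg i k u)) _.
by apply: mcoeff_varM0; rewrite cm1.
Qed.

(** The coefficient at a monomial is, up to a nonzero factor, the constant term of
    an iterated derivative. *)
Lemma vacuum_coef_detect (X : Type) (T : X -> M) :
  (forall (x : X) i (k : nat), exists (x1 x2 : X) (c1 c2 : K),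
    fm i (Posz k.+1) (T x) = c1 *: T x1 + c2 *: T x2) ->
  (forall x : X, vacuum_coef (T x) = 0) -> forall x : X, T x = 0.
Proof.
move=> TD T0 x; apply/malgP => m; rewrite mcoeff0; elim/cm_ind: m x => [|[i k] m IH] x.
  exact: T0.
have [x1 [x2 [c1 [c2 E]]]] := TD x i k.
have L : (k.+1%:R *: fderiv (i, k) (T x))@_m =
    k.+1%:R * ((m (i, k)).+1%:R * (T x)@_(mmul (ucm (i, k)) m)).
  exact: (etrans (fockZ _ _ _) (congr1 _ (mcoeff_fderiv _ _ _))).
have R : (c1 *: T x1 + c2 *: T x2)@_m = 0.
  apply: etrans (fockD _ _ _) _.
  apply: etrans (congr2 +%R (fockZ _ _ _) (fockZ _ _ _)) _.
  by rewrite (IH x1) (IH x2) !mulr0 addr0.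
have D := congr1 (mcoeff m) (etrans (esym (fmode_pos i k (T x))) E).
have /eqP := etrans (esym L) (etrans D R).
by rewrite !mulf_eq0 !(negPf (natSr_neq0 charK _)) => /eqP.
Qed.

Hypothesis eps_cocycle : is_cocycle eps.

(* The coefficient of [e^(al + be + ga)] in [e^al (e^be e^ga)]. *)
Let eps_assoc al be ga : eps be ga * eps al (be + ga) = eps al be * eps (al + be) ga.
Proof.
have E al' ga' : left_factor eps al' (ket ga') = eps al' ga' *: ket (al' + ga').
  exact: shift_single.
have L : eop eps al (eop eps be (ket ga)) =
    (eps be ga * eps al (be + ga)) *: ket (al + be + ga).
  apply: etrans (congr1 (eop eps al) (etrans (eopE _ _ _) (E be ga))) _.
  apply: etrans (eopE _ _ _) _; apply: etrans (linearZ_LR (left_factor eps al) _ _) _.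
  by apply: etrans (congr1 ( *:%R _) (E al (be + ga))) _; rewrite addrA; exact: scalerA.
have R : eps al be *: eop eps (al + be) (ket ga) =
    (eps al be * eps (al + be) ga) *: ket (al + be + ga).
  apply: etrans (congr1 ( *:%R _) (etrans (eopE _ _ _) (E _ _))) _; exact: scalerA.
pose vev0 := vev (vacuum_coef : {linear M -> K^o}) (al + be + ga).
have C c : vev0 (c *: ket (al + be + ga)) = c.
  apply: etrans (vevZ _ _ _ _) _; apply: etrans _ (mulr1 c); apply: (congr1 ( *%R c)).
  by apply: etrans (vev_ket vacuum_coef1 _ _) _; rewrite eqxx.
have E' := etrans (esym L) (etrans (cocycle_eop eps_cocycle al be (ket ga)) R).
exact: (etrans (esym (C _)) (etrans (congr1 vev0 E') (C _))).
Qed.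

Theorem vertex_borcherds al be ga u v : borcherds vertex_op (dotp al ga) (- dotp al be)
  (commutator eps al be) (weight_space ga) (single u al) (single v be).
Proof.
exact: (borcherds_identity charK fmodes_comm fmodes_vac fmodes_ind (ct := vacuum_coef)
  vacuum_coef1 vacuum_coef_creation vacuum_coef_detect vertex_op_linear1 vertex_trunc vertex_comm
  vertex_normal vertex_ket (cocycle_neq0 eps_cocycle) eps_assoc).
Qed.

Lemma vertex_weight al be x u w :
  weight_space be w -> weight_space (al + be) (vertex_op (single u al) x w).
Proof.
exact: (weight_Y charK fmodes_comm fmodes_vac fmodes_ind vertex_op_linear1 vertex_trunc
  vertex_normal vertex_ket).
Qed.

Lemma vertex_out al be x u w : weight_space be w ->
  (forall n : int, x != dotp al be + n%:~R) -> vertex_op (single u al) x w = 0.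
Proof.
exact: (Y_out fmodes_ind vertex_op_linear1 vertex_normal vertex_ket).
Qed.

End Vertex.

(** * Scalar series in three variables *)

Section Kernels.
Variable K : fieldType.
Hypothesis charK : [pchar K] =i pred0.
Implicit Types (x y ka s : K) (e d : 'rV[K]_3) (n : int) (r m : nat).

Lemma zexp_diag (i : 'I_3) x : zexp i x 0 i = x.
Proof. by rewrite /zexp !mxE !eqxx mulr1. Qed.

Lemma zexp_off (i j : 'I_3) x : i != j -> zexp i x 0 j = 0.
Proof. by move=> ij; rewrite /zexp !mxE [j == i]eq_sym (negPf ij) andbF mulr0. Qed.

Lemma rowD d e (i : 'I_3) : (d + e) 0 i = d 0 i + e 0 i.
Proof. by rewrite mxE. Qed.

Lemma smul_zmono (i : 'I_3) x (g : 'rV[K]_3 -> K) e :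
  smul (zmono i x) g e = g (e - zexp i x).
Proof.
rewrite /smul /cauchy (@fsum1 _ _ (e - zexp i x)) => [|d dx].
  by rewrite /zmono /monomial subKr eqxx mul1r.
have -> : zmono i x (e - d) = 0.
  rewrite /zmono /monomial (_ : (e - d == _) = false) //.
  by apply: contra_neqF dx => /eqP <-; rewrite subKr.
exact: mul0r.
Qed.

Lemma smulC (f g : 'rV[K]_3 -> K) e : smul f g e = smul g f e.
Proof.
rewrite /smul /cauchy (@fsum_inj _ _ _ (fun d => e - d)) => [|d d'|d _].
- by apply: eq_fsbigr => d _; rewrite subKr mulrC.
- by move=> /addrI /oppr_inj.
by exists (e - d); rewrite subKr.
Qed.

Variables (i j k : 'I_3).
Hypotheses (ij : i != j) (ik : i != k) (jk : j != k).

(** The exponents of [((z_i - z_j) / z_k)^x]. *)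
Definition quot_exp x r : 'rV[K]_3 := zexp i (x - r%:R) + zexp j r%:R + zexp k (- x).

Lemma quot_exp_i x r : quot_exp x r 0 i = x - r%:R.
Proof.
rewrite /quot_exp !rowD zexp_diag !zexp_off ?addr0 //.
  by rewrite eq_sym.
by rewrite eq_sym.
Qed.

Lemma quot_exp_j x r : quot_exp x r 0 j = r%:R.
Proof.
rewrite /quot_exp !rowD zexp_diag !zexp_off ?addr0 ?add0r //.
by rewrite eq_sym.
Qed.

Lemma quot_exp_k x r : quot_exp x r 0 k = - x.
Proof. by rewrite /quot_exp !rowD zexp_diag !zexp_off ?add0r. Qed.

Lemma quot_exp_inj x y r m : quot_exp x r = quot_exp y m -> x = y /\ r = m.
Proof.
move=> E; split.
  by have := congr1 (fun d : 'rV_3 => d 0 k) E; rewrite !quot_exp_k => /oppr_inj.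
have /eqP := congr1 (fun d : 'rV_3 => d 0 j) E.
by rewrite !quot_exp_j natr_eq // => /eqP.
Qed.

Lemma quot_expD x y r m : quot_exp x r + quot_exp y m = quot_exp (x + y) (r + m).
Proof.
rewrite /quot_exp addrACA [zexp i _ + _ + (_ + _)]addrACA /zexp -!scalerDl natrD.
by congr (_ *: _ + _ *: _ + _ *: _); ring.
Qed.

Lemma quot_powE x e :
  quot_pow i j k x e = \sum_(m \in [set: nat]) sbinom x m * (e == quot_exp x m)%:R.
Proof.
rewrite /quot_pow smulC smul_zmono /diff_pow; apply: eq_fsbigr => m _.
by rewrite /sbinom [in RHS](mulrC ((-1) ^+ m)); congr (_ * _); rewrite /monomial subr_eq.
Qed.

Lemma quot_pow_at x r : quot_pow i j k x (quot_exp x r) = sbinom x r.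
Proof.
rewrite quot_powE (@fsum1 _ _ r) ?eqxx ?mulr1 // => m /eqP mr.
case: eqP => [/quot_exp_inj[_ rm]|_]; first by case: mr.
by rewrite mulr0n mulr0.
Qed.

Lemma quot_pow_out x e : (forall r, e <> quot_exp x r) -> quot_pow i j k x e = 0.
Proof. by move=> er; rewrite quot_powE fsbig1 // => m _; case: eqP => [/er|_] //; rewrite mulr0n mulr0. Qed.

Lemma delta_quot_at s n r :
  delta_quot s i j k (quot_exp n%:~R r) = s ^ (- n) * sbinom n%:~R r.
Proof.
rewrite /delta_quot (@fsum1 _ _ n) ?quot_pow_at // => m /eqP mn.
rewrite quot_pow_out ?mulr0 // => t /quot_exp_inj[/(intr_inj_char0 charK)].
by move=> nm; case: mn.
Qed.

Lemma delta_quot_out s e : (forall n r, e <> quot_exp n%:~R r) -> delta_quot s i j k e = 0.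
Proof. by move=> en; apply: fsbig1 => n _; rewrite quot_pow_out ?mulr0. Qed.

(** The product [((z_i - z_j) / z_k)^ka delta((z_i - z_j) / (s z_k))] is
    [\sum_n s^(-n) ((z_i - z_j) / z_k)^(ka + n)], by Vandermonde's identity. *)
Lemma kernel_at s ka n r :
  smul (quot_pow i j k ka) (delta_quot s i j k) (quot_exp (ka + n%:~R) r) =
  s ^ (- n) * sbinom (ka + n%:~R) r.
Proof.
rewrite /smul /cauchy (@fsum_inj _ _ _ (quot_exp n%:~R)) => [|m m' /quot_exp_inj[]//|d]; last first.
  have [[m [t ->]]|no] := pselect (exists (m : int) (t : nat), d = quot_exp m%:~R t); last first.
    by rewrite delta_quot_out ?mulr0 ?eqxx // => m t dE; apply: no; exists m, t.
  have [[q qE]|no] := pselect (exists q, quot_exp (ka + n%:~R) r - quot_exp m%:~R t = quot_exp ka q).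
    move=> _; exists t; move/(canRL (subrK _)): qE; rewrite quot_expD => /quot_exp_inj[].
    by move=> /addrI /(intr_inj_char0 charK) ->.
  by rewrite quot_pow_out ?mul0r ?eqxx // => q qE; apply: no; exists q.
have sub m : (m <= r)%N ->
    quot_exp (ka + n%:~R) r - quot_exp n%:~R m = quot_exp ka (r - m).
  by move=> mr; apply: (canLR (addrK _)); rewrite quot_expD subnK.
rewrite -/(nsum _) (@nsumE _ r.+1) => [|m rm]; last first.
  rewrite quot_pow_out ?mul0r // => q /(canRL (subrK _)); rewrite quot_expD => /quot_exp_inj[_].
  by lia.
rewrite [in RHS]addrC -sbinom_vandermonde // mulr_sumr; apply: eq_bigr => -[m mr] _ /=.
by rewrite sub // quot_pow_at delta_quot_at; ring.
Qed.

Lemma kernel_out s ka e : (forall n r, e <> quot_exp (ka + n%:~R) r) ->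
  smul (quot_pow i j k ka) (delta_quot s i j k) e = 0.
Proof.
move=> en; apply: fsbig1 => d _.
have [[m [t dE]]|no] := pselect (exists (m : int) (t : nat), d = quot_exp m%:~R t); last first.
  by rewrite delta_quot_out ?mulr0 // => m t dE; apply: no; exists m, t.
rewrite quot_pow_out ?mul0r // => q /(canRL (subrK _)).
by rewrite dE quot_expD; apply: en.
Qed.

End Kernels.

(** * Series acting on products and iterates *)

Lemma fsum_inj2 (V : zmodType) (X : choiceType) (g : nat -> nat -> X) (F : X -> V) :
  (forall r m r' m', g r m = g r' m' -> r = r' /\ m = m') ->
  (forall x, F x != 0 -> exists r m, x = g r m) -> evz2 (fun r m => F (g r m)) ->
  \sum_(x \in [set: X]) F x = nsum (fun r => nsum (fun m => F (g r m))).
Proof.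
move=> ginj Fg /evz2_bound[B FB].
rewrite (@fsum_subset _ _ [seq g r m | r <- iota 0 B, m <- iota 0 B]).
- rewrite big_allpairs_dep (@nsumE _ B) => [|r Br]; last first.
    by apply: nsum0 => m; rewrite FB ?Br.
  rewrite -(big_mkord xpredT (fun r => nsum (fun m => F (g r m)))) /index_iota subn0.
  apply: eq_bigr => r _; rewrite (@nsumE _ B) => [|m Bm]; last by rewrite FB ?Bm ?orbT.
  by rewrite -(big_mkord xpredT (fun m => F (g r m))) /index_iota subn0.
- apply: allpairs_uniq; rewrite ?iota_uniq // => -[r m] [r' m'] _ _ /= /ginj[-> ->] //.
move=> x xg; apply/eqP; apply: contraNT xg => Fx; have [r [m xE]] := Fg _ Fx.
rewrite xE in Fx *; have [rB mB] : (r < B)%N /\ (m < B)%N.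
  by split; rewrite ltnNge; apply: contraNN Fx => Bm; rewrite FB ?Bm ?orbT.
by apply: allpairs_f; rewrite mem_iota.
Qed.

Definition summable (V : zmodType) (X : choiceType) (F : X -> V) :=
  exists r : seq X, forall x, x \notin r -> F x = 0.

Lemma summableD (V : zmodType) (X : choiceType) (F G : X -> V) : summable F -> summable G ->
  summable (fun x => F x + G x).
Proof.
move=> [r Fr] [q Gq]; exists (r ++ q) => x.
by rewrite mem_cat negb_or => /andP[/Fr -> /Gq ->]; rewrite addr0.
Qed.

Lemma fsumD (V : zmodType) (X : choiceType) (F G : X -> V) : summable F -> summable G ->
  \sum_(x \in [set: X]) (F x + G x) = \sum_(x \in [set: X]) F x + \sum_(x \in [set: X]) G x.
Proof.
move=> [r Fr] [q Gq].
have E x : x \notin undup (r ++ q) -> F x = 0 /\ G x = 0.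
  by rewrite mem_undup mem_cat negb_or => /andP[/Fr -> /Gq ->].
rewrite !(@fsum_subset _ _ (undup (r ++ q))) ?undup_uniq //.
- by rewrite big_split.
- by move=> x /E[].
- by move=> x /E[].
by move=> x /E[-> ->]; rewrite addr0.
Qed.

Lemma summable_inj2 (V : zmodType) (X : choiceType) (g : nat -> nat -> X) (F : X -> V) :
  (forall x, F x != 0 -> exists r m, x = g r m) -> evz2 (fun r m => F (g r m)) -> summable F.
Proof.
move=> Fg /evz2_bound[B FB]; exists [seq g r m | r <- iota 0 B, m <- iota 0 B].
move=> x xg; apply/eqP; apply: contraNT xg => Fx; have [r [m xE]] := Fg _ Fx.
rewrite xE in Fx *; have [rB mB] : (r < B)%N /\ (m < B)%N.
  by split; rewrite ltnNge; apply: contraNN Fx => Bm; rewrite FB ?Bm ?orbT.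
by apply: allpairs_f; rewrite mem_iota.
Qed.

Section Actions.
Variables (K : fieldType) (V : lmodType K).
Hypothesis charK : [pchar K] =i pred0.
Implicit Types (x y ka s : K) (e d : 'rV[K]_3) (n p : int) (r m : nat) (w : V).

Variables (i j k : 'I_3).
Hypotheses (ij : i != j) (ik : i != k) (jk : j != k).
Hypothesis decompose : forall e, e = zexp i (e 0 i) + zexp j (e 0 j) + zexp k (e 0 k).
Local Notation quot_exp := (quot_exp i j k).

Let eq_row d e : d 0 i = e 0 i -> d 0 j = e 0 j -> d 0 k = e 0 k -> d = e.
Proof. by move=> di dj dk; rewrite [d]decompose [e]decompose di dj dk. Qed.

Let rowB d e (h : 'I_3) : (d - e) 0 h = d 0 h - e 0 h.
Proof. by rewrite rowD mxE. Qed.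

Let kj : k != j. Proof. by rewrite eq_sym. Qed.
Let ki : k != i. Proof. by rewrite eq_sym. Qed.
Let ji : j != i. Proof. by rewrite eq_sym. Qed.

Lemma scomp_at_var (A B : K -> V -> V) d w : (forall x, A x 0 = 0) ->
  scomp (at_var i A) (at_var j B) d w =
  if d == zexp i (d 0 i) + zexp j (d 0 j) then A (d 0 i) (B (d 0 j) w) else 0.
Proof.
move=> A0; rewrite /scomp /cauchy (@fsum1 _ _ (zexp j (d 0 j))) => [|c cd].
  rewrite /at_var zexp_diag eqxx.
  have -> : (d - zexp j (d 0 j)) 0 i = d 0 i.
    by rewrite rowD mxE zexp_off 1?eq_sym // subr0.
  by rewrite subr_eq.
rewrite {2}/at_var; case: eqP => [cE|_]; last by rewrite /at_var A0 if_same.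
rewrite /at_var; case: eqP => // /(congr1 (fun b : 'rV_3 => b 0 j)).
rewrite zexp_off // rowD mxE => /eqP; rewrite subr_eq0 => /eqP dc.
by rewrite cE dc eqxx in cd.
Qed.

(** A kernel acting on a product of fields in [z_i] and [z_j]: the exponent of
    [z_k] singles out one power of [z_i - z_j]. *)
Section Product.
Variables (s ka : K) (A B : K -> V -> V).
Hypothesis A0 : forall x, A x 0 = 0.
Hypothesis B_trunc : forall y w, evz (fun m => B (y - m%:R) w).
Local Notation kernel :=
  (smul (zmono k (-1)) (smul (quot_pow i j k ka) (delta_quot s i j k))).

Let kernelE e d : kernel (e - d) =
  smul (quot_pow i j k ka) (delta_quot s i j k) (e - d - zexp k (-1)).
Proof. exact: smul_zmono. Qed.

Lemma sact_product_at n e w : e 0 k = - 1 - (ka + n%:~R) ->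
  sact kernel (scomp (at_var i A) (at_var j B)) e w =
  s ^ (- n) *: nsum (fun m => sbinom (ka + n%:~R) m *:
    A (e 0 i - (ka + n%:~R) + m%:R) (B (e 0 j - m%:R) w)).
Proof.
move=> ek; set N := ka + n%:~R in ek *.
pose g r := zexp i (e 0 i - N + r%:R) + zexp j (e 0 j - r%:R).
have gi r : g r 0 i = e 0 i - N + r%:R.
  by rewrite /g rowD zexp_diag zexp_off ?addr0 // eq_sym.
have gj r : g r 0 j = e 0 j - r%:R by rewrite /g rowD zexp_diag zexp_off ?add0r.
have gk r : g r 0 k = 0 by rewrite /g rowD !zexp_off ?addr0.
have eg r : e - g r - zexp k (-1) = quot_exp N r.
  apply: eq_row; rewrite !rowB ?gi ?gj ?gk ?quot_exp_i ?quot_exp_j ?quot_exp_k //.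
  - by rewrite zexp_off //; ring.
  - by rewrite zexp_off //; ring.
  by rewrite zexp_diag ek; ring.
rewrite /sact /cauchy (@fsum_inj _ _ _ g) => [|r r' /(congr1 (fun b : 'rV_3 => b 0 j))|d].
- rewrite -nsumZ; last first.
    have [b wb] := B_trunc (e 0 j) w; exists b => m bm.
    by rewrite wb // A0 scaler0.
  apply: eq_nsum => r; rewrite kernelE eg kernel_at // scomp_at_var // gi gj -/(g r) eqxx.
  by rewrite scalerA.
- by rewrite !gj => /addrI /oppr_inj /eqP; rewrite natr_eq // => /eqP.
rewrite kernelE scomp_at_var //.
case: (d =P zexp i (d 0 i) + zexp j (d 0 j)) => [dE|_]; last by rewrite scaler0 eqxx.
have [[m [t E]]|no] := pselect (exists (m : int) (t : nat),
    e - d - zexp k (-1) = quot_exp (ka + m%:~R) t); last first.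
  by rewrite kernel_out ?scale0r ?eqxx // => m t E; apply: no; exists m, t.
move=> _; exists t.
have dk : d 0 k = 0 by rewrite dE rowD !zexp_off ?addr0.
have Ek := congr1 (fun b : 'rV_3 => b 0 k) E.
have Ei := congr1 (fun b : 'rV_3 => b 0 i) E.
have Ej := congr1 (fun b : 'rV_3 => b 0 j) E.
rewrite quot_exp_k // !rowB zexp_diag dk ek in Ek.
rewrite quot_exp_i // !rowB zexp_off // subr0 in Ei.
rewrite quot_exp_j // !rowB zexp_off // subr0 in Ej.
have NE : ka + m%:~R = N by rewrite -[LHS]opprK -Ek; ring.
apply: eq_row; rewrite ?gi ?gj ?gk //; last by rewrite -Ej subKr.
rewrite NE in Ei; have -> : t%:R = N - (e 0 i - d 0 i) by rewrite Ei subKr.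
ring.
Qed.

Lemma sact_product_out e w : (forall n, e 0 k <> - 1 - (ka + n%:~R)) ->
  sact kernel (scomp (at_var i A) (at_var j B)) e w = 0.
Proof.
move=> ek; apply: fsbig1 => d _; rewrite kernelE scomp_at_var //.
case: (d =P zexp i (d 0 i) + zexp j (d 0 j)) => [dE|_]; last by rewrite scaler0.
rewrite kernel_out ?scale0r // => n r /(congr1 (fun b : 'rV_3 => b 0 k)).
have dk : d 0 k = 0 by rewrite dE rowD !zexp_off ?addr0.
rewrite quot_exp_k // !rowB zexp_diag dk => E; apply: (ek n).
by rewrite -[ka + _]opprK -E; ring.
Qed.

End Product.
(** The action of the delta function on an iterate in the variables [z_j] and
    [z_k], applied to a vector on which [al(0)] acts by [x]. *)
Section Iterate.
Variables (x : K) (W : K -> K -> V -> V) (I Q : 'rV[K]_3 -> V -> V) (w : V).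
Hypothesis W_scale : forall y t c, W y t (c *: w) = c *: W y t w.
Hypothesis W_trunc : forall y, exists B, forall m t, (B <= m)%N -> W (y - m%:R) t w = 0.
Hypothesis IE : forall e w, I e w =
  if e == zexp j (e 0 j) + zexp k (e 0 k) then W (e 0 j) (e 0 k) w else 0.
Hypothesis QE : forall e, Q e w = quot_pow i j k x e *: w.

Let W0 y t : W y t 0 = 0.
Proof. by have := W_scale y t 0; rewrite !scale0r. Qed.

Let I0 e : I e 0 = 0.
Proof. by rewrite IE W0 if_same. Qed.

Let inner_support d m c : d 0 i = x - m%:R -> c != quot_exp x m -> I (d - c) (Q c w) = 0.
Proof.
move=> di cm; rewrite QE; have [[q qE]|no] := pselect (exists q, c = quot_exp x q); last first.
  by rewrite quot_pow_out ?scale0r ?I0 // => q qE; apply: no; exists q.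
rewrite IE; case: (_ =P _ :> 'rV_3) => // /(congr1 (fun b : 'rV_3 => b 0 i)).
rewrite rowB (rowD (zexp j _)) !zexp_off // addr0 di qE quot_exp_i // => /eqP.
rewrite subr_eq add0r (inj_eq (addrI _)) eqr_opp natr_eq // => /eqP mq.
by rewrite qE mq eqxx in cm.
Qed.

Let inner_support_out d c : (forall m, d 0 i <> x - m%:R) -> I (d - c) (Q c w) = 0.
Proof.
move=> di; rewrite QE.
have [[q qE]|no] := pselect (exists q, c = quot_exp x q); last first.
  by rewrite quot_pow_out ?scale0r ?I0 // => q qE; apply: no; exists q.
rewrite IE; case: (_ =P _ :> 'rV_3) => // /(congr1 (fun b : 'rV_3 => b 0 i)).
rewrite rowB (rowD (zexp j _)) !zexp_off // addr0 qE quot_exp_i // => /subr0_eq E.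
by case: (di q).
Qed.

Lemma iterate_inner_summable d : summable (fun c => I (d - c) (Q c w)).
Proof.
have [[m dm]|no] := pselect (exists m : nat, d 0 i = x - m%:R).
  by exists [:: quot_exp x m] => c; rewrite inE; apply: inner_support.
by exists [::] => c _; apply: inner_support_out => m dm; apply: no; exists m.
Qed.

Lemma scomp_iterate_at d m : d 0 i = x - m%:R ->
  scomp I Q d w = sbinom x m *: W (d 0 j - m%:R) (d 0 k + x) w.
Proof.
move=> di; rewrite /scomp /cauchy (@fsum1 _ _ (quot_exp x m)) => [|c]; last exact: inner_support.
rewrite QE quot_pow_at // IE.
have -> : (d - quot_exp x m) 0 j = d 0 j - m%:R by rewrite rowB quot_exp_j.
have -> : (d - quot_exp x m) 0 k = d 0 k + x by rewrite rowB quot_exp_k // opprK.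
rewrite (_ : (d - quot_exp x m == _) = true); first exact: W_scale.
apply/eqP/eq_row; rewrite rowB (rowD (zexp j _)).
- by rewrite quot_exp_i // di subrr !zexp_off ?addr0.
- by rewrite quot_exp_j // zexp_diag zexp_off ?addr0.
by rewrite quot_exp_k // zexp_diag zexp_off // opprK add0r.
Qed.

Lemma scomp_iterate_out d : (forall m, d 0 i <> x - m%:R) -> scomp I Q d w = 0.
Proof. by move=> di; apply: fsbig1 => c _; apply: inner_support_out. Qed.

Local Notation kernel := (smul (zmono k (-1)) (delta_quot 1 i j k)).

Let kernelE e d : kernel (e - d) = delta_quot 1 i j k (e - d - zexp k (-1)).
Proof. exact: smul_zmono. Qed.

Let term e d := kernel (e - d) *: scomp I Q d w.

(* The exponents of the iterate that contribute to [z^e] are parametrized by the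
   exponent [r] of [z_j] in the delta function and the exponent [m] of [z_j] in
   [((z_i - z_j) / z_k)^x]. *)
Let iterate_family p e : e 0 i = x + p%:~R -> exists g : nat -> nat -> 'rV[K]_3,
  [/\ forall r m r' m', g r m = g r' m' -> r = r' /\ m = m',
      forall d, term e d != 0 -> exists r m, d = g r m &
      forall r m, term e (g r m) = (sbinom (p%:~R + (r + m)%:R) r * sbinom x m) *:
        W (e 0 j - (r + m)%:R) (e 0 i + e 0 k + 1 + (r + m)%:R) w].
Proof.
move=> ei; pose g r m := e - zexp k (-1) - quot_exp (p + (r + m)%N%:Z)%:~R r.
have pE (m : nat) : (p + m%:Z)%:~R = p%:~R + m%:R :> K by rewrite rmorphD /= -pmulrn.
have gi r m : g r m 0 i = x - m%:R.
  rewrite /g !rowB zexp_off // quot_exp_i // ei pE natrD; ring.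
have gj r m : g r m 0 j = e 0 j - r%:R.
  by rewrite /g !rowB zexp_off // quot_exp_j // subr0.
have gk r m : g r m 0 k = e 0 k + 1 + p%:~R + (r + m)%:R.
  by rewrite /g !rowB zexp_diag quot_exp_k // pE; ring.
have eg r m : e - g r m - zexp k (-1) = quot_exp (p + (r + m)%N%:Z)%:~R r.
  by apply: eq_row; rewrite /g !rowB; ring.
exists g; split=> [r m r' m' E|d|r m].
- have := congr1 (fun b : 'rV_3 => b 0 j) E; have := congr1 (fun b : 'rV_3 => b 0 i) E.
  rewrite !gi !gj => /addrI /oppr_inj /eqP; rewrite natr_eq // => /eqP ->.
  by move=> /addrI /oppr_inj /eqP; rewrite natr_eq // => /eqP ->.
- rewrite /term; have [[m dm]|no] := pselect (exists m : nat, d 0 i = x - m%:R); last first.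
    by rewrite scomp_iterate_out ?scaler0 ?eqxx // => m dm; apply: no; exists m.
  rewrite kernelE; have [[n [r E]]|no] := pselect (exists (n : int) (r : nat),
      e - d - zexp k (-1) = quot_exp n%:~R r); last first.
    by rewrite delta_quot_out ?scale0r ?eqxx // => n r E; apply: no; exists n, r.
  move=> _; exists r, m; have Ei := congr1 (fun b : 'rV_3 => b 0 i) E.
  rewrite quot_exp_i // !rowB zexp_off // subr0 ei dm in Ei.
  have nE : n = p + (r + m)%N%:Z.
    apply: (intr_inj_char0 charK); rewrite pE natrD -[LHS](subrK r%:R) -Ei; ring.
  by rewrite /g -nE -E; apply: eq_row; rewrite !rowB; ring.
rewrite /term kernelE eg delta_quot_at // exp1rz mul1r pE (scomp_iterate_at (gi r m)) scalerA.
rewrite gj gk natrD; congr (_ *: W _ _ _); first by ring.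
by rewrite ei; ring.
Qed.

Let iterate_evz p e : evz2 (fun r m => (sbinom (p%:~R + (r + m)%:R) r * sbinom x m) *:
  W (e 0 j - (r + m)%:R) (e 0 i + e 0 k + 1 + (r + m)%:R) w).
Proof.
have [B WB] := W_trunc (e 0 j).
by apply: (@evz2_add _ _ B) => r m Bm; rewrite WB // scaler0.
Qed.

(** The contributions with the same [r + m] are collected by Vandermonde's
    identity. *)
Lemma sact_iterate_at p e : e 0 i = x + p%:~R -> sact kernel (scomp I Q) e w =
  nsum (fun m => gbinom (- e 0 i - 1) m *: W (e 0 j - m%:R) (e 0 i + e 0 k + 1 + m%:R) w).
Proof.
move=> ei; have [g [ginj gsupp gE]] := iterate_family ei.
have gF : (fun r m => term e (g r m)) = _ := funext (fun r => funext (gE r)).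
rewrite /sact /cauchy (fsum_inj2 ginj gsupp); last by rewrite gF; exact: iterate_evz.
apply: etrans (eq_nsum (fun r => eq_nsum (gE r))) _.
rewrite nsum_antidiag; last exact: iterate_evz.
apply: eq_nsum => s; rewrite gbinom_neg // -/(sbinom _ s).
have -> : e 0 i + s%:R = (p%:~R + s%:R) + x by rewrite ei; ring.
rewrite -sbinom_vandermonde // scaler_suml; apply: eq_bigr => -[r rs] _ /=.
by rewrite subnKC.
Qed.

Let term_out e d : (forall p, e 0 i <> x + p%:~R) -> term e d = 0.
Proof.
move=> ei; rewrite /term kernelE.
have [[m dm]|no] := pselect (exists m : nat, d 0 i = x - m%:R); last first.
  by rewrite scomp_iterate_out ?scaler0 // => m dm; apply: no; exists m.
rewrite delta_quot_out ?scale0r // => n r /(congr1 (fun b : 'rV_3 => b 0 i)).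
rewrite quot_exp_i // !rowB zexp_off // subr0 dm => E; apply: (ei (n - (r + m)%N%:Z)).
rewrite rmorphB /= -pmulrn natrD -[e 0 i](subrK (x - m%:R)) E; ring.
Qed.

Lemma sact_iterate_out e : (forall p, e 0 i <> x + p%:~R) ->
  sact kernel (scomp I Q) e w = 0.
Proof. by move=> ei; apply: fsbig1 => d _; apply: term_out. Qed.

Lemma iterate_summable e : summable (fun d => kernel (e - d) *: scomp I Q d w).
Proof.
have [[p ei]|no] := pselect (exists p : int, e 0 i = x + p%:~R).
  have [g [ginj gsupp gE]] := iterate_family ei.
  have gF : (fun r m => term e (g r m)) = _ := funext (fun r => funext (gE r)).
  by apply: (summable_inj2 gsupp); rewrite gF; apply: iterate_evz.
by exists [::] => d _; apply: term_out => p ei; apply: no; exists p.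
Qed.

End Iterate.
End Actions.

(** * Comparison of coefficients *)

Lemma summable_ext (V : zmodType) (X : choiceType) (F G : X -> V) :
  F =1 G -> summable G -> summable F.
Proof. by move=> FG [r Gr]; exists r => x /Gr; rewrite FG. Qed.

Section SeriesAction.
Variables (K : fieldType) (V : lmodType K) (f : 'rV[K]_3 -> K).
Variables (I Q : 'rV[K]_3 -> V -> V).
Hypothesis IQD : forall b c w w', I b (Q c (w + w')) = I b (Q c w) + I b (Q c w').

Let good w := (forall d, summable (fun c => I (d - c) (Q c w))) /\
  (forall e, summable (fun d => f (e - d) *: scomp I Q d w)).

Let scompD d w w' : good w -> good w' -> scomp I Q d (w + w') = scomp I Q d w + scomp I Q d w'.
Proof.
move=> [gw _] [gw' _]; rewrite /scomp /cauchy -fsumD //.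
by apply: eq_fsbigr => c _; apply: IQD.
Qed.

Lemma sact_summableD w w' : good w -> good w' -> good (w + w').
Proof.
move=> gw gw'; split=> [d|e].
  by apply: summable_ext (fun c => IQD (d - c) c w w') _; apply: summableD; [apply: gw.1|apply: gw'.1].
apply: (@summable_ext _ _ _ (fun d => f (e - d) *: scomp I Q d w + f (e - d) *: scomp I Q d w')).
  by move=> d; rewrite scompD // scalerDr.
by apply: summableD; [apply: gw.2|apply: gw'.2].
Qed.

Lemma sactD e w w' : good w -> good w' ->
  sact f (scomp I Q) e (w + w') = sact f (scomp I Q) e w + sact f (scomp I Q) e w'.
Proof.
move=> gw gw'; rewrite /sact /cauchy -fsumD; [|exact: gw.2|exact: gw'.2].
by apply: eq_fsbigr => d _; rewrite scompD // scalerDr.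
Qed.

End SeriesAction.

Section Combination.
Variables (K : fieldType) (V : lmodType K).
Implicit Types (x y z p q r : V).

Lemma combine0 x y z (c : K) : x = 0 -> y = 0 -> z = 0 -> x - c *: y = z.
Proof. by move=> -> -> ->; rewrite scaler0 subr0. Qed.

Lemma combine x y z p q r (c s : K) : x = p -> y = s *: q -> z = r ->
  p = (c * s) *: q + r -> x - c *: y = z.
Proof. by move=> -> -> -> ->; rewrite scalerA addrC addKr. Qed.

Lemma combineD x y z p q r (c : K) : x - c *: y = z -> p - c *: q = r ->
  (x + p) - c *: (y + q) = z + r.
Proof. by move=> <- <-; rewrite scalerDr opprD addrACA. Qed.

End Combination.

Lemma zexp_decompose (K : fieldType) (e : 'rV[K]_3) :
  e = zexp z0 (e 0 z0) + zexp z1 (e 0 z1) + zexp z2 (e 0 z2).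
Proof.
apply/rowP => -[[|[|[|//]]] lt]; rewrite /zexp !mxE /= ?mulr1 ?mulr0 ?addr0 ?add0r;
  by congr (e _ _); apply: val_inj.
Qed.

Section Jacobi.
Variables (K : fieldType) (l : nat).
Hypothesis charK : [pchar K] =i pred0.
Variable eps : 'rV[K]_l -> 'rV[K]_l -> K.
Hypothesis eps_cocycle : is_cocycle eps.
Variables (u v : fock K l) (al be : 'rV[K]_l).
Local Notation MM := (heis_sum K l).
Local Notation U := (single u al).
Local Notation V := (single v be).
Local Notation Y := (vertex_op charK eps).
Local Notation ka := (- dotp al be).
Implicit Types (e : 'rV[K]_3) (w : MM) (n p : int).

Let Y_trunc U' w x := vertex_trunc charK eps U' w x.
Let Y0 U' x : vertex eps U' x 0 = 0.
Proof. exact: (linear0 (Y U' x)). Qed.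
Let Y0l x w : Y 0 x w = 0.
Proof. exact: (linear0_of (vertex_linear1 charK eps x w)). Qed.

Let z12 : z1 != z2 :> 'I_3. Proof. by []. Qed.
Let z10 : z1 != z0 :> 'I_3. Proof. by []. Qed.
Let z20 : z2 != z0 :> 'I_3. Proof. by []. Qed.
Let z21 : z2 != z1 :> 'I_3. Proof. by []. Qed.
Let z02 : z0 != z2 :> 'I_3. Proof. by []. Qed.

Let decompose120 e : e = zexp z1 (e 0 z1) + zexp z2 (e 0 z2) + zexp z0 (e 0 z0).
Proof. by rewrite addrC addrA -zexp_decompose. Qed.
Let decompose210 e : e = zexp z2 (e 0 z2) + zexp z1 (e 0 z1) + zexp z0 (e 0 z0).
Proof. by rewrite (addrC (zexp z2 _)) -decompose120. Qed.
Let decompose102 e : e = zexp z1 (e 0 z1) + zexp z0 (e 0 z0) + zexp z2 (e 0 z2).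
Proof. by rewrite (addrC (zexp z1 _)) -zexp_decompose. Qed.

Definition first_term e w : MM :=
  sact (smul (zmono z0 (-1)) (smul (quot_pow z1 z2 z0 ka) (delta_quot 1 z1 z2 z0)))
    (scomp (at_var z1 (vertex eps U)) (at_var z2 (vertex eps V))) e w.

Definition second_term e w : MM :=
  sact (smul (zmono z0 (-1)) (smul (quot_pow z2 z1 z0 ka) (delta_quot (-1) z2 z1 z0)))
    (scomp (at_var z2 (vertex eps V)) (at_var z1 (vertex eps U))) e w.

Definition third_term e w : MM :=
  sact (smul (zmono z2 (-1)) (delta_quot 1 z1 z0 z2))
    (scomp (vertex_iterate eps U V) (quot_pow0 z1 z0 z2 al)) e w.

Lemma first_term_at n e w : e 0 z0 = - 1 - (ka + n%:~R) ->
  first_term e w = product Y (ka + n%:~R) (e 0 z1) (e 0 z2) U V w.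
Proof.
move=> ek; apply: etrans (sact_product_at charK z12 z10 z20 decompose120 1
  (Y0 U) (fun y w => Y_trunc V w y) w ek) _.
by rewrite exp1rz; apply: scale1r.
Qed.

Lemma second_term_at n e w : e 0 z0 = - 1 - (ka + n%:~R) ->
  second_term e w = (-1) ^ n *: product Y (ka + n%:~R) (e 0 z2) (e 0 z1) V U w.
Proof.
move=> ek; apply: etrans (sact_product_at charK z21 z20 z10 decompose210 (-1)
  (Y0 V) (fun y w => Y_trunc U w y) w ek) _.
by rewrite -exprz_inv invrN1.
Qed.

Lemma first_term_out e w : (forall n, e 0 z0 <> - 1 - (ka + n%:~R)) -> first_term e w = 0.
Proof. by move=> en; apply: (sact_product_out z12 z10 z20 1 _ (Y0 U)). Qed.

Lemma second_term_out e w : (forall n, e 0 z0 <> - 1 - (ka + n%:~R)) -> second_term e w = 0.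
Proof. by move=> en; apply: (sact_product_out z21 z20 z10 (-1) _ (Y0 V)). Qed.

Section Weight.
Variables (ga : 'rV[K]_l) (t : fock K l).
Local Notation w := (single t ga).

Let W y x w' := vertex eps (vertex eps U y V) x w'.
Let W_scale y x c : W y x (c *: w) = c *: W y x w.
Proof. exact: (linearZ_LR (Y (vertex eps U y V) x)). Qed.

Let W_trunc y : exists B, forall m x, (B <= m)%N -> W (y - m%:R) x w = 0.
Proof.
have [B UB] := Y_trunc U V y; exists B => m x /UB E.
by apply: etrans (congr1 (fun U' => Y U' x w) E) _; apply: Y0l.
Qed.

Let IE e w' : vertex_iterate eps U V e w' =
  if e == zexp z0 (e 0 z0) + zexp z2 (e 0 z2) then W (e 0 z0) (e 0 z2) w' else 0.
Proof. by []. Qed.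

Let QE e : quot_pow0 z1 z0 z2 al e w = quot_pow z1 z0 z2 (dotp al ga) e *: w.
Proof.
have E := @blockwise_tens K l (fun ga t => quot_pow z1 z0 z2 (dotp al ga) e *: t) t ga
  (scaler0 _ _).
exact: etrans E (singleZ _ _ _).
Qed.

Lemma third_term_at p e : e 0 z1 = dotp al ga + p%:~R ->
  third_term e w = iterate Y (- 1 - e 0 z0) (e 0 z1) (e 0 z2) U V w.
Proof.
move=> ei; apply: etrans (sact_iterate_at charK z10 z12 z02 decompose102
  W_scale W_trunc IE QE ei) _.
by apply: eq_nsum => m; rewrite opprB addrCA subrr addr0.
Qed.

Lemma third_term_out e : (forall p, e 0 z1 <> dotp al ga + p%:~R) -> third_term e w = 0.
Proof. by move=> ei; apply: (sact_iterate_out z10 z12 W_scale IE QE). Qed.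

Lemma third_term_summable :
  (forall d, summable (fun c => vertex_iterate eps U V (d - c) (quot_pow0 z1 z0 z2 al c w))) /\
  (forall e, summable (fun d => smul (zmono z2 (-1)) (delta_quot 1 z1 z0 z2) (e - d) *:
    scomp (vertex_iterate eps U V) (quot_pow0 z1 z0 z2 al) d w)).
Proof.
split=> [d|e].
  exact: (iterate_inner_summable charK z10 z12 W_scale IE QE).
exact: (iterate_summable charK z10 z12 z02 decompose102 W_scale W_trunc IE QE).
Qed.

Let w_weight : weight_space ga w. Proof. by exists t. Qed.

(** For [e0] in [-1 - ka + Z] and [e1] in [al.ga + Z] this is the Borcherds
    identity. Otherwise all terms vanish: the kernels restrict the exponents of the
    series that they multiply, and [vertex_out] those of the fields. *)
Lemma jacobi_single e :
  first_term e w - commutator eps al be *: second_term e w = third_term e w.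
Proof.
have [[n ek]|no0] := pselect (exists n : int, e 0 z0 = - 1 - (ka + n%:~R)); last first.
  have en n : e 0 z0 <> - 1 - (ka + n%:~R) by move=> ek; apply: no0; exists n.
  apply: combine0; [exact: first_term_out|exact: second_term_out|].
  have [[p ei]|no1] := pselect (exists p : int, e 0 z1 = dotp al ga + p%:~R); last first.
    by apply: third_term_out => p ei; apply: no1; exists p.
  rewrite (third_term_at ei); apply: nsum0 => m.
  have E : Y U (- 1 - (- 1 - e 0 z0) - m%:R) V = 0.
    apply: vertex_out; first by exists v.
    move=> q; apply/eqP => E; apply: (en (- 1 - q - m%:Z)).
    rewrite !rmorphB rmorphN1 /= -pmulrn -[e 0 z0](subrK m%:R).
    by move: E; rewrite opprB addrCA subrr addr0 => ->; ring.
  apply: etrans (congr1 (fun U' => _ *: Y U' _ w) E) _.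
  apply: etrans (congr1 ( *:%R _) (Y0l _ w)) _; exact: scaler0.
have first := first_term_at w ek; have second := second_term_at w ek.
have [[p ei]|no1] := pselect (exists p : int, e 0 z1 = dotp al ga + p%:~R).
  have third := third_term_at ei.
  have NE : - 1 - e 0 z0 = ka + n%:~R by rewrite ek; ring.
  rewrite NE in third.
  apply: (combine first second third); rewrite ei.
  exact: (vertex_borcherds charK eps_cocycle al be u v n p (e 0 z2) w_weight).
have ei p : e 0 z1 <> dotp al ga + p%:~R by move=> ei; apply: no1; exists p.
apply: combine0; [apply: etrans first _|apply: etrans second _|exact: third_term_out].
  apply: nsum0 => m; apply: etrans (congr1 ( *:%R _) _) (scaler0 _ _).
  apply: vertex_out; first exact: (vertex_weight charK eps be (e 0 z2 - m%:R) v w_weight).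
  move=> q; apply/eqP => E; apply: (ei (q + n - m%:Z)).
  rewrite !rmorphD rmorphN /= -pmulrn; move: E; rewrite dotpDr => E.
  have -> : e 0 z1 = (e 0 z1 - (ka + n%:~R) + m%:R) + (ka + n%:~R) - m%:R by ring.
  by rewrite E; ring.
apply: etrans (congr1 ( *:%R _) _) (scaler0 _ _); apply: nsum0 => m.
have E : Y U (e 0 z1 - m%:R) w = 0.
  apply: (vertex_out charK eps u w_weight) => q; apply/eqP => /(canRL (subrK _)) E.
  by apply: (ei (q + m%:Z)); rewrite E rmorphD /= addrA.
apply: etrans (congr1 (fun w' => _ *: Y V _ w') E) _.
apply: etrans (congr1 ( *:%R _) (linear0 (Y V _))) _; exact: scaler0.
Qed.

End Weight.

Let IQD b c w w' : vertex_iterate eps U V b (quot_pow0 z1 z0 z2 al c (w + w')) =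
  vertex_iterate eps U V b (quot_pow0 z1 z0 z2 al c w) +
  vertex_iterate eps U V b (quot_pow0 z1 z0 z2 al c w').
Proof.
pose q ga := *:%R (quot_pow z1 z0 z2 (dotp al ga) c) : fock K l -> fock K l.
have qE w0 : quot_pow0 z1 z0 z2 al c w0 = blockw q w0 by exact: blockwE.
have ql : linear (blockw q).
  by apply: blockw_linear => ga b' t t'; rewrite /q scalerDr !scalerA mulrC.
have iD x y : vertex_iterate eps U V b (x + y) =
    vertex_iterate eps U V b x + vertex_iterate eps U V b y.
  rewrite /vertex_iterate; case: (b == _); last exact: (esym (addr0 _)).
  exact: (linearD (Y (vertex eps U (b 0 z0) V) (b 0 z2))).
apply: etrans (congr1 _ _) (iD _ _); apply: etrans (qE _) _.
exact: etrans (linearD_of w w' ql) (congr2 +%R (esym (qE w)) (esym (qE w'))).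
Qed.

(** Additivity in [w] of the third term needs that the sums defining it are
    finite for each vector over a single [ga] ([third_term_summable]). *)
Theorem jacobi e w :
  first_term e w - commutator eps al be *: second_term e w = third_term e w.
Proof.
have firstD w1 w2 : first_term e (w1 + w2) = first_term e w1 + first_term e w2.
  have [[n ek]|no] := pselect (exists n : int, e 0 z0 = - 1 - (ka + n%:~R)); last first.
    have en n : e 0 z0 <> - 1 - (ka + n%:~R) by move=> ek; apply: no; exists n.
    by rewrite !first_term_out // addr0.
  rewrite !(first_term_at _ ek); apply: linearD_of.
  exact: product_linear3.
have secondD w1 w2 : second_term e (w1 + w2) = second_term e w1 + second_term e w2.
  have [[n ek]|no] := pselect (exists n : int, e 0 z0 = - 1 - (ka + n%:~R)); last first.
    have en n : e 0 z0 <> - 1 - (ka + n%:~R) by move=> ek; apply: no; exists n.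
    by rewrite !second_term_out // addr0.
  rewrite !(second_term_at _ ek) -scalerDr; apply: (congr1 ( *:%R _)); apply: linearD_of.
  exact: product_linear3.
pose good w := (forall d, summable (fun c =>
    vertex_iterate eps U V (d - c) (quot_pow0 z1 z0 z2 al c w))) /\
  (forall e, summable (fun d => smul (zmono z2 (-1)) (delta_quot 1 z1 z0 z2) (e - d) *:
    scomp (vertex_iterate eps U V) (quot_pow0 z1 z0 z2 al) d w)).
suff [] : good w /\ first_term e w - commutator eps al be *: second_term e w = third_term e w.
  by [].
elim/dsum_ind: w => [w1 w2 [g1 E1] [g2 E2]||t ga].
- split; first exact: (sact_summableD IQD g1 g2).
  apply: etrans (congr2 (fun x y => x - commutator eps al be *: y) (firstD w1 w2) (secondD w1 w2)) _.
  exact: etrans (combineD E1 E2) (esym (sactD IQD e g1 g2)).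
- rewrite -(single0 (fock K l) (0 : 'rV[K]_l)); split; first exact: third_term_summable.
  exact: jacobi_single.
split; first exact: third_term_summable.
exact: jacobi_single.
Qed.

End Jacobi.

Theorem theorem4p4 (R : realType) (l : nat) (hl : (0 < l)%N)
  (eps : 'rV[R[i]]_l -> 'rV[R[i]]_l -> R[i]) (heps : is_cocycle eps)
  (u v : fock R[i] l) (al be : 'rV[R[i]]_l)
  (e : 'rV[R[i]]_3) (w : heis_sum R[i] l) :
  let U := tens u al in
  let V := tens v be in
  let kappa := - dotp al be in
  sact (smul (zmono z0 (-1))
             (smul (quot_pow z1 z2 z0 kappa) (delta_quot 1 z1 z2 z0)))
       (scomp (at_var z1 (vertex eps U)) (at_var z2 (vertex eps V))) e w
  - commutator eps al be *:
    sact (smul (zmono z0 (-1))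
               (smul (quot_pow z2 z1 z0 kappa) (delta_quot (-1) z2 z1 z0)))
         (scomp (at_var z2 (vertex eps V)) (at_var z1 (vertex eps U))) e w
  = sact (smul (zmono z2 (-1)) (delta_quot 1 z1 z0 z2))
         (scomp (vertex_iterate eps U V) (quot_pow0 z1 z0 z2 al)) e w.
Proof. exact: (jacobi (@pchar_num R[i]) heps). Qed.
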